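(* Let $\mathcal{H}$ be the class of split graphs, the class of interval graphs, or the class of chordal graphs. Then $\mathcal{H}$-Identification is NP-complete, and it does not admit a polynomial kernel when parameterized by $k$ unless $\mathsf{coNP}\subseteq\mathsf{NP/poly}$.
   Context: All graphs are finite, simple and undirected. An identification of two distinct vertices $u,v$ replaces them with a new vertex adjacent to every vertex of $(N(u)\cup N(v))\setminus\{u,v\}$. For a graph class $\mathcal{H}$, $\mathcal{H}$-Identification takes as input a graph $G$ and an integer $k\ge 0$ and asks whether $G$ can be transformed into a graph in $\mathcal{H}$ by at most $k$ identifications. A split graph is a graph whose vertex set can be partitioned into a clique and an independent set; an interval graph is the intersection graph of a family of intervals of the real line; a chordal graph is a graph with no induced cycle on four or more vertices. A polynomial kernel is a polynomial-time algorithm mapping each instance $(G,k)$ to an equivalent instance whose size is bounded by a polynomial in $k$. *)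

(* Defs.v *)
From HB Require Import structures.
From mathcomp Require Import all_boot all_order all_algebra.
From mathcomp Require Import reals.

Set Implicit Arguments.
Unset Strict Implicit.
Unset Printing Implicit Defensive.

(** * Graphs *)

Record graph := Graph {
  vertex :> finType;
  adj : rel vertex;
  adj_sym : symmetric adj;
  adj_irr : irreflexive adj
}.

Section Identify.
Variables (G : graph) (u v : G).

(* [None] is the new vertex; [Some] embeds the vertices outside {u, v}. *)
Definition identify_vertex : finType := option {w : G | (w != u) && (w != v)}.

Definition identify_adj (x y : identify_vertex) : bool :=
  match x, y with
  | Some a, Some b => adj (val a) (val b)
  | None, Some b | Some b, None => adj u (val b) || adj v (val b)
  | None, None => false
  end.

Lemma identify_sym : symmetric identify_adj.
Proof. by move=> [a|] [b|] //=; rewrite adj_sym. Qed.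

Lemma identify_irr : irreflexive identify_adj.
Proof. by move=> [a|] //=; rewrite adj_irr. Qed.

Definition identify : graph := Graph identify_sym identify_irr.
End Identify.

Inductive identifications : nat -> graph -> graph -> Prop :=
| Identifications0 (G : graph) : identifications 0 G G
| IdentificationsS (k : nat) (G G' : graph) (u v : G) :
    u != v -> identifications k (identify u v) G' ->
    identifications k.+1 G G'.

Definition graph_class := graph -> Prop.

Definition split_graph : graph_class := fun G =>
  exists K : {set G},
    {in K &, forall x y, x != y -> adj x y} /\
    {in ~: K &, forall x y, ~~ adj x y}.

Definition interval_graph (R : realType) : graph_class := fun G =>
  exists I : G -> interval R,
    (forall x, exists z : R, z \in I x) /\
    (forall x y, x != y ->
       (adj x y <-> exists z : R, (z \in I x) && (z \in I y))).

(* [ordS] is the cyclic successor on 'I_n, so [f] below ranges over the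
   embeddings of the cycle C_n as an induced subgraph. *)
Definition induced_cycle (G : graph) (n : nat) (f : 'I_n -> G) : Prop :=
  injective f /\
  forall i j : 'I_n, adj (f i) (f j) = (j == ordS i) || (i == ordS j).

Definition chordal_graph : graph_class := fun G =>
  forall (n : nat) (f : 'I_n -> G), 4 <= n -> ~ induced_cycle f.

(** * Polynomial time: deterministic multi-tape Turing machines *)

Inductive move := MoveL | MoveN | MoveR.

(* A tape alphabet has a blank ([None]), the two bits, and finitely many
   auxiliary symbols. *)
Definition symbol (X : finType) : finType := option (bool + X).

Record machine := Machine {
  state : finType;
  aux : finType;
  ntapes : nat;
  start : state;
  halted : pred state;
  trans : state -> {ffun 'I_ntapes.+1 -> symbol aux} ->
          state * ('I_ntapes.+1 -> symbol aux * move)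
}.

(* A two-way infinite tape: the cells left of the head (nearest first), the
   scanned cell, the cells right of the head; all other cells are blank. *)
Record tape (X : finType) := Tape {
  tleft : seq (symbol X);
  thead : symbol X;
  tright : seq (symbol X)
}.

Definition tape_of_seq (X : finType) (s : seq (symbol X)) : tape X :=
  Tape [::] (head None s) (behead s).

Definition tape_act (X : finType) (a : symbol X * move) (t : tape X) : tape X :=
  let: (s, m) := a in
  match m with
  | MoveL => Tape (behead (tleft t)) (head None (tleft t)) (s :: tright t)
  | MoveN => Tape (tleft t) s (tright t)
  | MoveR => Tape (s :: tleft t) (head None (tright t)) (behead (tright t))
  end.

Record config (M : machine) := Config {
  cstate : state M;
  ctape : 'I_(ntapes M).+1 -> tape (aux M)
}.

Definition step (M : machine) (c : config M) : config M :=
  if halted (cstate c) then c else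
  let: (q, act) := trans (cstate c) [ffun i => thead (ctape c i)] in
  Config q (fun i => tape_act (act i) (ctape c i)).

Definition init (M : machine) (x : seq bool) : config M :=
  Config (start M) (fun i =>
    tape_of_seq (if i == ord0 then [seq Some (inl b) | b <- x] else [::])).

Fixpoint bits_prefix (X : finType) (s : seq (symbol X)) : seq bool :=
  if s is Some (inl b) :: s' then b :: bits_prefix s' else [::].

(* The output is the longest bit string on the first tape that starts at the
   head. *)
Definition output (M : machine) (c : config M) : seq bool :=
  let t := ctape c ord0 in bits_prefix (thead t :: tright t).

(* [step] fixes halted configurations, so being halted after exactly t steps
   means halting within t steps. *)
Definition computes_in (M : machine) (x y : seq bool) (t : nat) : Prop :=
  let c := iter t (@step M) (init M x) in
  halted (cstate c) /\ output c = y.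

Definition polytime (A B : Type) (encA : A -> seq bool) (encB : B -> seq bool)
    (f : A -> B) : Prop :=
  exists (M : machine) (p : {poly nat}), forall a : A,
    computes_in M (encA a) (encB (f a)) (p.[size (encA a)])%R.

(** * Complexity classes *)

Definition language := seq bool -> Prop.

Definition in_P (L : language) : Prop :=
  exists f : seq bool -> bool,
    polytime id (fun b => [:: b]) f /\ forall x, L x <-> f x.

(* The self-delimiting pairing 1 x_1 1 x_2 ... 1 x_n 0 y. *)
Definition pair_code (x y : seq bool) : seq bool :=
  flatten [seq [:: true; b] | b <- x] ++ false :: y.

Definition in_NP (L : language) : Prop :=
  exists (V : language) (p : {poly nat}),
    in_P V /\
    forall x, L x <-> exists y, size y <= (p.[size x])%R /\ V (pair_code x y).

Definition in_coNP (L : language) : Prop := in_NP (fun x => ~ L x).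

Definition in_NPpoly (L : language) : Prop :=
  exists (L' : language) (advice : nat -> seq bool) (p : {poly nat}),
    [/\ in_NP L',
        forall n, size (advice n) <= (p.[n])%R
      & forall x, L x <-> L' (pair_code x (advice (size x)))].

Definition coNP_sub_NPpoly : Prop := forall L, in_coNP L -> in_NPpoly L.

Definition karp_reducible (L L' : language) : Prop :=
  exists f : seq bool -> seq bool,
    polytime id id f /\ forall x, L x <-> L' (f x).

Definition NP_hard (L : language) : Prop :=
  forall L', in_NP L' -> karp_reducible L' L.

Definition NP_complete (L : language) : Prop := in_NP L /\ NP_hard L.

(** * Graph problems with an integer parameter *)

Definition instance : Type := graph * nat.

(* Binary expansion, least significant bit first. *)
Definition bin_code (k : nat) : seq bool :=
  mkseq (fun i => odd (k %/ 2 ^ i)) (up_log 2 k.+1).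

(* The number of vertices in unary, the adjacency matrix, then k in binary. *)
Definition instance_code (x : instance) : seq bool :=
  let: (G, k) := x in
  nseq #|G| true ++ false ::
  [seq adj u v | u <- enum G, v <- enum G] ++ bin_code k.

Definition language_of (Q : instance -> Prop) : language :=
  fun w => exists x : instance, w = instance_code x /\ Q x.

Definition has_polynomial_kernel (Q : instance -> Prop) : Prop :=
  exists (f : instance -> instance) (p : {poly nat}),
    [/\ polytime instance_code instance_code f,
        forall x, Q x <-> Q (f x)
      & forall x, size (instance_code (f x)) <= (p.[x.2])%R].

Definition Identification (H : graph_class) (x : instance) : Prop :=
  let: (G, k) := x in
  exists (j : nat) (G' : graph), [/\ j <= k, identifications j G G' & H G'].

(* Main.v *)
(** Both halves rest on one reduction.  A verifier running for [T] steps on inputs of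
    length [n] is turned into a set-splitting instance whose ground set describes a
    [T] by [T] tableau, and so has size polynomial in [n].  An OR of [t] inputs only
    costs [t n] further sets, each forbidding the certificate to leave the binary trie
    of the inputs.  From a set system over [m + 2] elements, two of them adjacent, one
    builds a graph: the sets form a clique, an element is adjacent to the sets
    containing it, and [2 m + 2] independent apex vertices see all of these.  With [m]
    identifications two apices stay untouched, so a quotient without an induced 4-cycle
    must turn the rest into a clique; this happens exactly when the elements collapse to
    the two sides of a splitting, and the quotient is then split, interval and chordal
    at once.  Hence the problem is NP-hard and OR-compositional with a parameter
    independent of [t].

    A polynomial kernel then compresses [t] inputs to fewer than [t] bits, and the
    covering argument of Fortnow and Santhanam turns the outputs on no-instances into
    polynomial advice.

    Polynomial time is established by compiling a small language of bounded unary
    arithmetic to multitape machines once and for all. *)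

From mathcomp Require Import all_boot all_order all_algebra.
From mathcomp Require Import reals zify.
Require Import Defs.
From Stdlib Require Import FunctionalExtensionality ClassicalEpsilon.

Set Implicit Arguments.
Unset Strict Implicit.
Unset Printing Implicit Defensive.

(** * Machine fragments *)

(** An identification may merge non-adjacent vertices, so [k] of them amount to a surjection that
    loses at most [k] vertices, and the reduction becomes a count of fibres. This fixes the sizes:
    [m] lost vertices can spoil at most [2 m] apices, and [m + 2] ground elements with [m] losses
    leave just two classes, which the adjacent pair names and joins. The OR is taken over the
    complement of a language [L] in coNP, so that a tuple inside [L] is a no-instance. As the
    parameter ignores the number of inputs, [t = p(k) + 1] can be chosen without circularity.
    Membership in NP needs evidence that a bounded search can check: an ordering by left endpoints
    for interval graphs, and for chordal graphs reachability sets showing that non-adjacent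
    neighbours of a vertex are not linked off its neighbourhood. Machines are never built by hand: a
    string is given by formulas for its length and its letters, loops in these formulas are
    truncated so that values stay polynomial, and an arbitrary machine, such as the kernelization,
    may run between two such strings. *)

Section Fragments.
Variables (X : finType) (m : nat).
Notation tapes := ('I_m.+1 -> tape X).
Notation syms := {ffun 'I_m.+1 -> symbol X}.
Notation acts := ('I_m.+1 -> symbol X * move).

(* A piece of a machine with one entry; [None] as a next state is the exit. *)
Record frag := Frag {
  fstate : finType;
  fstart : fstate;
  ftrans : fstate -> syms -> option fstate * acts
}.

Definition heads (T : tapes) : syms := [ffun i => thead (T i)].
Definition act (a : acts) (T : tapes) : tapes := fun i => tape_act (a i) (T i).

(* Weakest precondition: [F] exits after exactly [n] steps, in [P]. *)
Fixpoint wp (F : frag) (n : nat) (q : fstate F) (T : tapes) (P : tapes -> Prop)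
    : Prop :=
  if n is n'.+1 then
    let: (o, a) := ftrans q (heads T) in
    if o is Some q' then wp n' q' (act a T) P else n' = 0 /\ P (act a T)
  else False.

Definition idle (h : syms) : acts := fun i => (h i, MoveN).

Lemma act_idle (T : tapes) : act (idle (heads T)) T = T.
Proof.
apply: functional_extensionality => i; rewrite /act /idle /heads ffunE /=.
by case: (T i).
Qed.

Definition fprim (a : syms -> acts) : frag :=
  @Frag unit tt (fun _ h => (None, a h)).

Definition fseq (F G : frag) : frag :=
  @Frag (fstate F + fstate G)%type (inl (fstart F)) (fun q h =>
    match q with
    | inl q => let: (o, a) := ftrans q h in
        (Some (if o is Some q' then inl q' else inr (fstart G)), a)
    | inr q => let: (o, a) := ftrans q h in (omap inr o, a)
    end).

Definition fif (t : pred syms) (F G : frag) : frag :=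
  @Frag (option (fstate F + fstate G)) None (fun q h =>
    match q with
    | None => (Some (Some (if t h then inl (fstart F) else inr (fstart G))), idle h)
    | Some (inl q) => let: (o, a) := ftrans q h in (omap (fun q => Some (inl q)) o, a)
    | Some (inr q) => let: (o, a) := ftrans q h in (omap (fun q => Some (inr q)) o, a)
    end).

Definition fwhile (t : pred syms) (F : frag) : frag :=
  @Frag (option (fstate F)) None (fun q h =>
    match q with
    | None => (if t h then Some (Some (fstart F)) else None, idle h)
    | Some q => let: (o, a) := ftrans q h in (Some o, a)
    end).

Lemma wp_prim a T (P : tapes -> Prop) : P (act (a (heads T)) T) -> @wp (fprim a) 1 tt T P.
Proof. by []. Qed.

Lemma wp_mono F n (q : fstate F) T (P Q : tapes -> Prop) :
  (forall T', P T' -> Q T') -> wp n q T P -> wp n q T Q.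
Proof.
move=> PQ; elim: n q T => //= n IH q T; case: (ftrans _ _) => [[q'|] a].
  exact: IH.
by case=> -> /PQ.
Qed.

Lemma wp_seq F G n n' (q : fstate F) T P Q :
  wp n q T P -> (forall T', P T' -> wp n' (fstart G) T' Q) ->
  @wp (fseq F G) (n + n') (inl q) T Q.
Proof.
move=> + H; elim: n q T => //= n IH q T; case: (ftrans _ _) => [[q'|] a].
  exact: IH.
case=> -> /H {H IH}.
rewrite add0n; move: (act a T) (fstart G); elim: n' => //= n' IH' T' q'.
case: (ftrans _ _) => [[q''|] a'] //=; exact: IH'.
Qed.

Lemma wp_if (t : pred syms) F G n T P :
  (if t (heads T) then wp n (fstart F) T P else wp n (fstart G) T P) ->
  @wp (fif t F G) n.+1 None T P.
Proof.
rewrite /= act_idle; case: (t _).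
  elim: n T (fstart F) => //= n IH T q.
  by case: (ftrans _ _) => [[q'|] a] //=; apply: IH.
elim: n T (fstart G) => //= n IH T q.
by case: (ftrans _ _) => [[q'|] a] //=; apply: IH.
Qed.

Lemma wp_while_end (t : pred syms) F T (P : tapes -> Prop) :
  ~~ t (heads T) -> P T -> @wp (fwhile t F) 1 None T P.
Proof. by rewrite /= act_idle => /negbTE ->. Qed.

Lemma wp_while_step (t : pred syms) F n n' T P (Q : tapes -> Prop) :
  t (heads T) -> wp n (fstart F) T P ->
  (forall T', P T' -> @wp (fwhile t F) n' None T' Q) ->
  @wp (fwhile t F) (n.+1 + n') None T Q.
Proof.
move=> Ht + H; rewrite addSn /= act_idle Ht.
elim: n T (fstart F) {Ht} => //= n IH T q.
case: (ftrans _ _) => [[q'|] a] /=; first exact: IH.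
by case=> -> /H; rewrite add0n.
Qed.

Definition machine_of (F : frag) : machine :=
  @Machine (option (fstate F)) X m (Some (fstart F)) (fun q => q == None)
    (fun q h => if q is Some q then ftrans q h else (None, idle h)).

Lemma wp_machine F n (q : fstate F) T P : wp n q T P ->
  let c := iter n (@step (machine_of F)) (@Config (machine_of F) (Some q) T) in
  cstate c = None /\ P (ctape c).
Proof.
elim: n q T => // n IH q T; rewrite iterSr /= {2 4}/step /= -/(heads T).
by case: (ftrans q _) => [[q'|] a] => [|[->]] //; apply: IH.
Qed.

(** * Stacks of bits on tapes *)

(** Cells past the end of a list are blank, so lists that differ by trailing blanks describe the
    same tape. *)
Definition tape_eqv (t u : tape X) :=
  [/\ thead t = thead u,
      forall k, nth None (tleft t) k = nth None (tleft u) k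
    & forall k, nth None (tright t) k = nth None (tright u) k].

Definition bitsyms (s : seq bool) : seq (symbol X) := [seq Some (inl b) | b <- s].

(* A register is a stack with its top under the head.  The strong form pins the
   whole tape, as needed before a foreign machine is run on it; the weak form
   tolerates the garbage such a machine leaves behind. *)
Definition holds (st : bool) (t : tape X) (s : seq bool) : Prop :=
  if st then tape_eqv t (tape_of_seq (bitsyms s))
  else bits_prefix (thead t :: tright t) = s.

Definition sbit (x : symbol X) : option bool :=
  if x is Some (inl b) then Some b else None.

Lemma bits_prefix_nth (s s' : seq (symbol X)) :
  (forall k, nth None s k = nth None s' k) -> bits_prefix s = bits_prefix s'.
Proof.
elim: s s' => [|x s IH] [|x' s'] //= H.
- by have /= := H 0; move <-.
- by have /= := H 0; move=> ->.
have /= -> := H 0; case: x' {H} (fun k => H k.+1) => [[b|]|] //= H.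
by rewrite (IH s').
Qed.

Lemma bits_prefix_eqv t u : tape_eqv t u ->
  bits_prefix (thead t :: tright t) = bits_prefix (thead u :: tright u).
Proof. by case=> h _ r; apply: bits_prefix_nth => -[|k] /=. Qed.

Lemma bits_prefix_syms s : bits_prefix (bitsyms s) = s.
Proof. by elim: s => //= b s ->. Qed.

Lemma holds_weak st t s : holds st t s -> holds false t s.
Proof.
case: st => // /bits_prefix_eqv; rewrite /holds => ->.
by case: s => //= b s; rewrite bits_prefix_syms.
Qed.

Lemma holds_sbit st t s : holds st t s -> sbit (thead t) = ohead s.
Proof. by move=> /holds_weak /= <-; case: (thead t) => [[]|]. Qed.

(** On an empty stack the scanned cell, which is no bit, stays behind as the end marker; the weak
    form therefore survives next to garbage. *)
Lemma holds_push st t s b : holds st t s ->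
  holds st (tape_act (Some (inl b), MoveN) (tape_act (thead t, MoveL) t)) (b :: s).
Proof.
case: st => /= [[h l r]|->] //; split=> //= k.
  by rewrite nth_behead l !nth_nil.
by case: k => [|k] /=; rewrite ?h ?r; case: s {h l r} => [|b' s] //=; rewrite ?nth_nil.
Qed.

Lemma holds_pop st t s : holds st t s ->
  holds st (tape_act (if sbit (thead t) then (None, MoveR) else (thead t, MoveN)) t)
    (behead s).
Proof.
move=> H; have := holds_sbit H; case: st H => /= [[h l r]|H].
  case: s h l r => [|b s] h l r -> /=.
    by split.
  split=> /=.
  - by have := r 0; rewrite -nth0 /= => ->; rewrite -nth0.
  - by case=> //= k; rewrite l !nth_nil.
  by move=> k; rewrite nth_behead r /= nth_behead.
case: t H => l h r /=; case: h => [[b'|x]|] /= <- //= _.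
by case: r.
Qed.

Definition store := nat -> seq bool.
Definition rep st (T : tapes) (s : store) := forall i : 'I_m.+1, holds st (T i) (s i).
Definition upd (s : store) (r : nat) (v : seq bool) : store :=
  fun i => if i == r then v else s i.

(** The step count is chosen before the tapes, hence depends on the stores alone; this lets
    [exe_seq] add the counts of two fragments. *)
Definition exe st (F : frag) (n : nat) (s s' : store) : Prop :=
  exists2 k, k <= n &
    forall T, rep st T s -> wp k (fstart F) T (fun T' => rep st T' s').

Lemma exe_le st F n n' s s' : n <= n' -> exe st F n s s' -> exe st F n' s s'.
Proof. by move=> le [k lek H]; exists k => //; apply: leq_trans le. Qed.

Lemma exe_seq st F G n n' s1 s2 s3 :
  exe st F n s1 s2 -> exe st G n' s2 s3 -> exe st (fseq F G) (n + n') s1 s3.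
Proof.
move=> [k lek H] [k' lek' H']; exists (k + k'); first exact: leq_add.
by move=> T /H /wp_seq; apply.
Qed.

Definition skip := fprim idle.
Lemma exe_skip st s : exe st skip 1 s s.
Proof. by exists 1 => // T H; apply: wp_prim; rewrite act_idle. Qed.

Definition test (r : nat) (f : pred (option bool)) : pred syms :=
  fun h => f (sbit (h (inord r))).

Lemma rep_test st T s r f : r <= m -> rep st T s -> test r f (heads T) = f (ohead (s r)).
Proof.
by move=> rm H; rewrite /test /heads ffunE (holds_sbit (H (inord r))) inordK.
Qed.

Definition nonempty : pred (option bool) := isSome.
Definition top_true : pred (option bool) := fun o => o == Some true.

Lemma exe_if st r f F G n s s' : r <= m ->
  (if f (ohead (s r)) then exe st F n s s' else exe st G n s s') ->
  exe st (fif (test r f) F G) n.+1 s s'.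
Proof.
move=> rm; case E: (f _) => -[k lek H]; exists k.+1 => // T HT;
  by apply: wp_if; rewrite (rep_test f rm HT) E; apply: H.
Qed.

Lemma exe_while st r F n k (s : nat -> store) : r <= m ->
  (forall i, i < k -> s i r <> [::] /\ exe st F n (s i) (s i.+1)) ->
  s k r = [::] ->
  exe st (fwhile (test r nonempty) F) (k * n.+1).+1 (s 0) (s k).
Proof.
move=> rm; elim: k s => [|k IH] s Hs Hk.
  exists 1 => // T HT; apply: wp_while_end => //.
  by rewrite (rep_test _ rm HT) Hk.
have [|//|k' lek' H'] := IH (fun i => s i.+1); first by move=> i ik; apply: Hs.
have [// | nz [k1 lek1 H1]] := Hs 0.
exists (k1.+1 + k'); first by rewrite mulSn; lia.
move=> T HT; apply: (wp_while_step _ (H1 T HT)) => //.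
by rewrite (rep_test _ rm HT); case: (s 0 r) nz.
Qed.

Definition push (r : nat) (b : bool) : frag :=
  fseq (fprim (fun h i => if val i == r then (h i, MoveL) else (h i, MoveN)))
       (fprim (fun h i => if val i == r then (Some (inl b), MoveN) else (h i, MoveN))).

Definition pop (r : nat) : frag :=
  fprim (fun h i => if (val i == r) && sbit (h i) then (None, MoveR) else (h i, MoveN)).

Lemma tape_act_idle (t : tape X) : tape_act (thead t, MoveN) t = t.
Proof. by case: t. Qed.

Lemma exe_push st r b s : exe st (push r b) 2 s (upd s r (b :: s r)).
Proof.
exists 2 => // T HT.
apply: (@wp_seq _ _ 1 1 _ _ (fun T' => T' = act (fun i => if val i == r
  then (heads T i, MoveL) else (heads T i, MoveN)) T)); first exact: wp_prim.
move=> _ ->; apply: wp_prim => i; rewrite /upd /act !ffunE /=.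
have := HT i; case: eqP => [->|_] H; first exact: holds_push.
by rewrite tape_act_idle tape_act_idle.
Qed.

Lemma exe_pop st r s : exe st (pop r) 1 s (upd s r (behead (s r))).
Proof.
exists 1 => // T HT; apply: wp_prim => i; rewrite /upd /act !ffunE /=.
have := HT i; case: eqP => [->|_] H; first exact: holds_pop.
by rewrite tape_act_idle.
Qed.

Definition clear r := fwhile (test r nonempty) (pop r).

Lemma exe_clear st r s : r <= m ->
  exe st (clear r) ((size (s r)).*2).+1 s (upd s r [::]).
Proof.
move=> rm; pose f i := upd s r (drop i (s r)).
have Ef i : f i r = drop i (s r) by rewrite /f /upd eqxx.
have -> : upd s r [::] = f (size (s r)) by rewrite /f drop_size.
have {2}-> : s = f 0.
  by apply: functional_extensionality => i; rewrite /f /upd drop0; case: eqP => // ->.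
rewrite -muln2; apply: exe_while => //; last by rewrite Ef drop_size.
move=> i ik; rewrite Ef (drop_nth true ik); split=> //.
have := @exe_pop st r (f i); congr (exe _ _ _ _ _).
apply: functional_extensionality => j; rewrite Ef /f /upd (drop_nth true ik) /=.
by case: eqP.
Qed.

Definition xfer a b : frag :=
  fif (test a top_true) (fseq (pop a) (push b true)) (fseq (pop a) (push b false)).

Lemma exe_xfer st a b s x u : a <= m -> a != b -> s a = x :: u ->
  exe st (xfer a b) 4 s (upd (upd s a u) b (x :: s b)).
Proof.
move=> am ab sa; apply: exe_if => //; rewrite sa /top_true /=.
have E y : exe st (fseq (pop a) (push b y)) 3 s (upd (upd s a u) b (y :: s b)).
  have := exe_seq (@exe_pop st a s) (@exe_push st b y _).
  by rewrite sa /= {3}/upd eq_sym (negbTE ab); apply.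
by case: x {sa}; apply: E.
Qed.

Definition mov a b := fwhile (test a nonempty) (xfer a b).

Lemma exe_mov st a b s : a <= m -> a != b ->
  exe st (mov a b) (5 * size (s a)).+1 s (upd (upd s a [::]) b (catrev (s a) (s b))).
Proof.
move=> am ab.
pose f i := upd (upd s a (drop i (s a))) b (catrev (take i (s a)) (s b)).
have -> : s = f 0.
  apply: functional_extensionality => i; rewrite /f /upd take0 drop0 /=.
  by do 2!case: eqP => [->|_] //.
have Ea i : f i a = drop i (s a) by rewrite /f /upd (negbTE ab) eqxx.
have Eb i : f i b = catrev (take i (s a)) (s b) by rewrite /f /upd eqxx.
have -> : upd (upd (f 0) a [::]) b (catrev (f 0 a) (f 0 b)) = f (size (f 0 a)).
  rewrite Ea Eb drop0 take0 /=; apply: functional_extensionality => i.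
  rewrite /f /upd take_size drop_size; case: eqP => // _; by case: eqP.
rewrite mulnC; apply: exe_while => //; last by rewrite !Ea drop0 drop_size.
move=> i; rewrite Ea drop0 => ik; rewrite Ea (drop_nth true ik); split=> //.
have := @exe_xfer st a b (f i) (nth true (s a) i) (drop i.+1 (s a)) am ab.
rewrite Ea (drop_nth true ik) => /(_ erefl).
congr (exe _ _ _ _ _); apply: functional_extensionality => j.
rewrite Eb /f /upd (take_nth true ik) !catrevE rev_rcons /=.
by case: eqP => // _; case: eqP.
Qed.

End Fragments.

Arguments exe_skip {X m}.
Arguments exe_push {X m}.
Arguments exe_pop {X m}.
Arguments exe_clear {X m}.
Arguments exe_xfer {X m}.
Arguments exe_mov {X m}.

(** * Polynomial bounds *)

(** One number serves as shift and as exponent, so the polynomial bounds form a single increasing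
    chain. *)
Definition pb (c n : nat) := (n + c) ^ c.
Definition polyb (f : nat -> nat) := exists c, forall n, f n <= pb c n.

Lemma pb_mono c c' n n' : c <= c' -> n <= n' -> pb c n <= pb c' n'.
Proof.
move=> cc nn; rewrite /pb; case: c cc => [|c] cc.
  by rewrite expn0 expn_gt0; case: c' {cc} => [|c'] //; rewrite ?addnS ?orbT.
by apply: leq_trans (leq_pexp2l _ cc); [rewrite leq_exp2r ?leq_add // ltnW | lia].
Qed.

Lemma polyb_le f g : (forall n, f n <= g n) -> polyb g -> polyb f.
Proof. by move=> fg [c H]; exists c => n; apply: leq_trans (H n). Qed.

Lemma polyb_cst k : polyb (fun=> k).
Proof.
exists k.+1 => n; rewrite /pb; apply: leq_trans (_ : k.+1 ^ k.+1 <= _).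
  by apply: leq_trans (ltnW (ltn_expl k _)) (_ : 2 ^ k <= _) => //;
     case: k => // k; apply: leq_trans (_ : 2 ^ k.+2 <= _); rewrite ?leq_exp2l ?leq_exp2r.
by rewrite leq_exp2r //; lia.
Qed.

Lemma polyb_id : polyb id.
Proof. by exists 1 => n; rewrite /pb expn1; lia. Qed.

Lemma polyb_mul f g : polyb f -> polyb g -> polyb (fun n => f n * g n).
Proof.
move=> [c Hf] [d Hg]; exists (c + d) => n.
rewrite /pb expnD leq_mul //; apply: leq_trans (Hf n) _ || apply: leq_trans (Hg n) _;
  by rewrite /pb; case: (posnP c) (posnP d) => [->|?] [->|?] //; rewrite leq_exp2r //; lia.
Qed.

Lemma polyb_add f g : polyb f -> polyb g -> polyb (fun n => f n + g n).
Proof.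
move=> Hf Hg; apply: (@polyb_le _ (fun n => (f n + 1) * (g n + 1))) => [n|]; first lia.
have H1 h : polyb h -> polyb (fun n => h n + 1).
  case=> c Hh; exists c.+2 => n; have := Hh n.
  have : 0 < (n + c.+2) ^ c.+1 by rewrite expn_gt0 addnS.
  have : pb c n <= (n + c.+2) ^ c.+1.
    apply: leq_trans (_ : pb c.+1 n <= _); first exact: pb_mono.
    by rewrite /pb leq_exp2r //; lia.
  have : 2 * (n + c.+2) ^ c.+1 <= (n + c.+2) * (n + c.+2) ^ c.+1.
    by apply: leq_mul => //; lia.
  have -> : pb c.+2 n = (n + c.+2) * (n + c.+2) ^ c.+1 by rewrite /pb expnS.
  by move: (_ ^ c.+1) (pb c n) (h n) => a b k; lia.
by apply: polyb_mul; apply: H1.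
Qed.

Lemma polyb_comp f g : polyb f -> polyb g -> polyb (fun n => f (g n)).
Proof.
move=> [c Hf] Hg; apply: (@polyb_le _ (fun n => (g n + c) ^ c)) => [n|]; first exact: Hf.
have {}Hg : polyb (fun n => g n + c) by apply: polyb_add => //; apply: polyb_cst.
move: {2}c => k; elim: k => [|k IH]; first exact: (polyb_cst 1).
by apply: polyb_le (polyb_mul Hg IH) => n; rewrite expnS.
Qed.

Lemma polyb_poly (p : {poly nat}) : polyb (fun n => p.[n])%R.
Proof.
elim/poly_ind: p => [|p c IH].
  by apply: polyb_le (polyb_cst 0) => n; rewrite horner0.
apply: polyb_le (polyb_add (polyb_mul IH polyb_id) (polyb_cst c)) => n.
by rewrite hornerMXaddC.
Qed.

Definition pb_poly (c : nat) : {poly nat} := (('X + c%:P) ^+ c)%R.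
Lemma pb_polyE c n : (pb_poly c).[n]%R = pb c n.
Proof.
rewrite /pb_poly horner_exp hornerD hornerX hornerC /pb.
change ((n + c)%R : nat) with (n + c).
by elim: {2 4}c => // k IH; rewrite GRing.exprS IH expnS.
Qed.

(** * A language of bounded unary arithmetic *)

(* [Bit false] and [Bit true] read the two input strings.  [Rec n b f] iterates
   [f] over [n] rounds, truncating the intermediate values at [b]; in [f],
   variable 0 is the current value and variable 1 the round. *)
Inductive expr :=
| Var of nat | Cst of nat | Add of expr & expr | Sub of expr & expr
| Mul of expr & expr | Rec of expr & expr & expr
| Bit of bool & expr | Len of bool.

Section Eval.
Variables (w z : seq bool).
Let str (s : bool) := if s then z else w.

Fixpoint eval (env : seq nat) (e : expr) : nat :=
  match e with
  | Var i => nth 0 env i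
  | Cst c => c
  | Add e1 e2 => eval env e1 + eval env e2
  | Sub e1 e2 => eval env e1 - eval env e2
  | Mul e1 e2 => eval env e1 * eval env e2
  | Rec n b f => iteri (eval env n)
      (fun i a => minn (eval (a :: i :: env) f) (eval env b)) 0
  | Bit s e => nth false (str s) (eval env e)
  | Len s => size (str s)
  end.
End Eval.

(** Truncation bounds the value of a loop by its cap, whatever the body does; this is what keeps
    values polynomial under nesting. *)
Fixpoint vb (e : expr) (N : nat) : nat :=
  match e with
  | Var _ | Len _ => N
  | Cst c => c
  | Add e1 e2 => vb e1 N + vb e2 N
  | Sub e1 e2 => vb e1 N
  | Mul e1 e2 => vb e1 N * vb e2 N
  | Rec _ b _ => vb b N
  | Bit _ _ => 1
  end.

Lemma nth_le (env : seq nat) N i : all (fun v => v <= N) env -> nth 0 env i <= N.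
Proof.
move=> /all_nthP H; case: (ltnP i (size env)) => [/H|?]; first exact.
by rewrite nth_default.
Qed.

Lemma eval_vb w z e env N : size w <= N -> size z <= N ->
  all (fun v => v <= N) env -> eval w z env e <= vb e N.
Proof.
move=> wN zN eN; elim: e => //=.
- by move=> i; apply: nth_le.
- by move=> e1 H1 e2 H2; apply: leq_add.
- by move=> e1 H1 e2 H2; apply: leq_trans H1; apply: leq_subr.
- by move=> e1 H1 e2 H2; apply: leq_mul.
- move=> n _ b Hb f _; case: (eval _ _ _ n) => //= k.
  by apply: leq_trans Hb; apply: geq_minr.
- by move=> s e _; case: nth.
by case.
Qed.

(** The body of [Rec] sees two more variables, a round below [vb n N] and a value at most [vb b N];
    hence the enlarged bound [N']. *)
Fixpoint tb (e : expr) (N : nat) : nat :=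
  match e with
  | Var _ | Len _ => 12 * N + 5
  | Cst c => c * 2 + 1
  | Add e1 e2 => tb e1 N + tb e2 N + 5 * vb e2 N + 1
  | Sub e1 e2 => tb e1 N + tb e2 N + 3 * vb e2 N + 1
  | Mul e1 e2 => tb e1 N + vb e1 N * (tb e2 N + 5 * vb e2 N + 3)
                 + 5 * (vb e1 N * vb e2 N) + 2
  | Rec n b f => let N' := N + vb n N + vb b N in
      tb n N + vb n N * (tb f N' + 8 * vb b N + tb b N + 2 * vb f N' + 10)
      + 2 * vb n N + 5 * vb b N + 5
  | Bit _ e => tb e N + 7 * vb e N + 5 * N + 10
  end.

Ltac polyb_tac := repeat first
  [ apply: polyb_add | apply: polyb_mul | apply: polyb_cst | apply: polyb_id | eassumption ].

Lemma polyb_vb e : polyb (vb e).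
Proof. elim: e => //=; intros; polyb_tac. Qed.

Lemma polyb_tb e : polyb (tb e).
Proof.
elim: e => //=; intros;
  repeat first [ apply: polyb_add | apply: polyb_mul | apply: polyb_cst
               | apply: polyb_id | apply: polyb_vb | eassumption ].
all: match goal with |- polyb (fun n => ?f (n + ?g n + ?h n)) =>
  eapply (@polyb_comp f (fun n => n + g n + h n)) end;
  rewrite ?(polyb_vb _) //; try exact: polyb_vb.
all: by apply: polyb_add; [apply: polyb_add; [apply: polyb_id|]|]; apply: polyb_vb.
Qed.

Fixpoint need (e : expr) : nat :=
  match e with
  | Var _ | Len _ | Cst _ => 3
  | Add e1 e2 | Sub e1 e2 | Mul e1 e2 => need e1 + need e2 + 3
  | Rec n b f => need n + need b + need f + 5
  | Bit _ e => need e + 3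
  end.

(** * Compilation of expressions to machine fragments *)

Section Compile.
Variables (X : finType) (m : nat).
Notation frag := (frag X m).
Local Notation "F ;; G" := (fseq F G) (at level 60, right associativity).
Local Notation wh r F := (fwhile (test r nonempty) F).
Local Notation push := (@push X m).
Local Notation pop := (@pop X m).
Local Notation mov := (@mov X m).
Local Notation clear := (@clear X m).
Local Notation skip := (@skip X m).
Local Notation xfer := (@xfer X m).
Local Notation test := (@test X m).

(* Variable [i] lives in register [nth 0 vs i]; the value goes to register [d],
   and the registers above [d] are scratch space. *)
Fixpoint comp (vs : seq nat) (d : nat) (e : expr) : frag :=
  match e with
  | Var i => if i < size vs then
      mov (nth 0 vs i) d.+1 ;;
      wh d.+1 (pop d.+1 ;; push (nth 0 vs i) true ;; push d true)
      else skip
  | Cst c => iter c (fun F => F ;; push d true) skip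
  | Add e1 e2 => comp vs d e1 ;; comp vs d.+1 e2 ;; mov d.+1 d
  | Sub e1 e2 => comp vs d e1 ;; comp vs d.+1 e2 ;; wh d.+1 (pop d.+1 ;; pop d)
  | Mul e1 e2 => comp vs d e1 ;;
      wh d (pop d ;; comp vs d.+2 e2 ;; mov d.+2 d.+1) ;; mov d.+1 d
  | Rec n b f => comp vs d n ;;
      wh d (pop d ;; comp [:: d.+2, d.+1 & vs] d.+3 f ;; clear d.+2 ;;
            comp vs d.+4 b ;;
            wh d.+4 (pop d.+4 ;;
                     fif (test d.+3 nonempty) (pop d.+3 ;; push d.+2 true) skip) ;;
            clear d.+3 ;; push d.+1 true) ;;
      clear d.+1 ;; mov d.+2 d
  | Bit s e => comp vs d e ;;
      wh d (pop d ;; fif (test s nonempty) (xfer s d.+1) skip) ;;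
      fif (test s top_true) (push d true) skip ;; mov d.+1 s
  | Len s => wh s (xfer s d.+1 ;; push d true) ;; mov d.+1 s
  end.

Record pre (w z : seq bool) (N : nat) (vs env : seq nat) (d : nat) (s : store) : Prop := Pre {
  pre_w : s 0 = w;
  pre_z : s 1 = z;
  pre_vs : forall r, r \in vs -> 1 < r < d;
  pre_env : [seq s r | r <- vs] = [seq nseq v true | v <- env];
  pre_fresh : forall r, d <= r -> s r = [::];
  pre_N : all (fun v => v <= N) env;
  pre_wN : size w <= N;
  pre_zN : size z <= N
}.

Lemma pre_agree w z N vs env d d' s s' : 1 < d -> d <= d' ->
  (forall r, r < d -> s' r = s r) -> (forall r, d' <= r -> s' r = [::]) ->
  pre w z N vs env d s -> pre w z N vs env d' s'.
Proof.
move=> d1 dd H H' [p1 p2 p3 p4 p5 p6 p7 p8]; split => //.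
- by rewrite H //; lia.
- by rewrite H.
- by move=> r /p3 /andP [-> rd] /=; apply: leq_trans dd.
by rewrite -p4; apply/eq_in_map => r /p3 /andP [_ /H].
Qed.

Lemma pre_le w z N N' vs env d s : N <= N' ->
  pre w z N vs env d s -> pre w z N' vs env d s.
Proof.
move=> NN [p1 p2 p3 p4 p5 p6 p7 p8]; split => //; try exact: leq_trans NN.
by apply: sub_all p6 => v /leq_trans; apply.
Qed.

Lemma pre_cons w z N vs env d s r v : 1 < r < d -> s r = nseq v true -> v <= N ->
  pre w z N vs env d s -> pre w z N (r :: vs) (v :: env) d s.
Proof.
move=> rd sr vN [p1 p2 p3 p4 p5 p6 p7 p8]; split => //=.
- by move=> r'; rewrite inE => /orP [/eqP ->|/p3].
- by rewrite sr p4.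
by rewrite vN.
Qed.

Lemma catrev_nseq a b : catrev (nseq a true) (nseq b true) = nseq (a + b) true.
Proof. by elim: a b => //= a IH b; rewrite (IH b.+1) addnS. Qed.

Ltac ev := rewrite /upd; repeat match goal with
  | |- context [if ?a == ?b then _ else _] =>
    first [ have -> : (a == b) = true by lia | have -> : (a == b) = false by lia ]
  end.
Ltac steq := apply: functional_extensionality => ?; rewrite /upd;
  repeat match goal with
  | |- context [if ?a == ?b then _ else _] => case: (eqVneq a b) => ?
  end; try (by []); try (exfalso; lia); subst; try congruence.

Ltac prea P := apply: (pre_agree _ _ _ _ P); [lia|lia|intros; ev; try done|
  intros; ev; try done; try (rewrite (pre_fresh P); [done|lia])].

Lemma exe_to st (F : frag) n s s1 s2 : s1 = s2 -> exe st F n s s1 -> exe st F n s s2.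
Proof. by move=> ->. Qed.

Lemma exe_cst st d c s : s d = [::] -> d <= m ->
  exe st (iter c (fun F => F ;; push d true) skip) (c * 2 + 1) s
    (upd s d (nseq c true)).
Proof.
move=> sd dm; elim: c => [|c IH].
  by rewrite mul0n; apply: exe_to (exe_skip _ _); steq.
apply: (@exe_le _ _ _ _ ((c * 2 + 1) + 2)); first lia.
apply: exe_seq IH _; apply: exe_to (exe_push _ _ _ _); steq.
Qed.

Section Strings.
Variables (st : bool) (w z : seq bool).
Let str (s : bool) := if s then z else w.

Lemma pre_str N vs env d sg (s : bool) : pre w z N vs env d sg -> sg s = str s.
Proof. by case: s => -[]. Qed.

Lemma size_str N vs env d sg (s : bool) : pre w z N vs env d sg -> size (str s) <= N.
Proof. by case: s => -[]. Qed.

Definition comp_ok e := forall vs env d N sg, 1 < d -> d + need e <= m ->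
  pre w z N vs env d sg ->
  exe st (comp vs d e) (tb e N) sg (upd sg d (nseq (eval w z env e) true)).

Lemma comp_var (i : nat) : comp_ok (Var i).
Proof.
move=> vs env d N sg d1 dm P; rewrite /= in dm *.
have sz : size vs = size env.
  by have /(congr1 size) := pre_env P; rewrite !size_map.
case: ltnP => ile; last first.
  rewrite nth_default -?sz //; apply: (@exe_le _ _ _ _ 1); first lia.
  by apply: exe_to (exe_skip _ _); steq; rewrite (pre_fresh P) //; lia.
set r := nth 0 vs i; set v := nth 0 env i.
have /andP [r1 rd] : 1 < r < d by apply: (pre_vs P); apply: mem_nth.
have sr : sg r = nseq v true.
  have /(congr1 (fun l => nth [::] l i)) := pre_env P.
  by rewrite (nth_map 0) // (nth_map 0) -?sz.
have vN : v <= N by apply: nth_le (pre_N P).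
apply: (@exe_le _ _ _ _ ((5 * v).+1 + (v * 6).+1)); first lia.
apply: exe_seq.
  have := @exe_mov X m st r d.+1 sg; rewrite sr size_nseq => H; apply: H; lia.
rewrite (pre_fresh P) // catrevE cats0 rev_nseq.
(* The variable has been emptied into [d.+1]; each round now restores one unit of it and copies one
   unit to [d]. *)
pose s i := upd (upd (upd sg r (nseq i true)) d.+1 (nseq (v - i) true)) d (nseq i true).
have -> : upd (upd sg r [::]) d.+1 (nseq v true) = s 0.
  by rewrite /s subn0; steq; rewrite (pre_fresh P) //; lia.
have -> : upd sg d (nseq v true) = s v.
  by rewrite /s subnn; steq; rewrite (pre_fresh P) //; lia.
apply: exe_while; [lia| |by rewrite /s subnn; ev].
move=> j jv; split; first by rewrite /s; ev; case: (v - j) (subn_gt0 j v); rewrite jv.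
have E : v - j = (v - j.+1).+1 by lia.
apply: (exe_seq (exe_pop _ _ _) (exe_to _ (exe_seq (exe_push _ _ _ _) (exe_push _ _ _ _)))).
by rewrite /s E; steq; ev.
Qed.

Lemma comp_cst (c : nat) : comp_ok (Cst c).
Proof.
move=> vs env d N sg d1 dm P; rewrite /= in dm *.
by apply: exe_cst; [apply: pre_fresh P _ _|lia].
Qed.

Lemma comp_add e1 e2 : comp_ok e1 -> comp_ok e2 -> comp_ok (Add e1 e2).
Proof.
move=> IH1 IH2 vs env d N sg d1 dm P; rewrite /= in dm *.
set v1 := eval _ _ _ e1; set v2 := eval _ _ _ e2.
have le2 : v2 <= vb e2 N by apply: eval_vb; case: P.
apply: (@exe_le _ _ _ _ (tb e1 N + (tb e2 N + (5 * v2).+1))); first lia.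
apply: exe_seq; first by apply: IH1 P; lia.
apply: exe_seq.
  apply: (IH2 vs env); [lia|lia|].
  by prea P.
have := @exe_mov X m st d.+1 d (upd (upd sg d (nseq v1 true)) d.+1 (nseq v2 true)).
rewrite {1 4 5}/upd eqxx size_nseq => H; apply: exe_to (H _ _); [|lia|lia].
steq; ev; rewrite ?(pre_fresh P) // catrev_nseq addnC //.
Qed.

Lemma comp_sub e1 e2 : comp_ok e1 -> comp_ok e2 -> comp_ok (Sub e1 e2).
Proof.
move=> IH1 IH2 vs env d N sg d1 dm P; rewrite /= in dm *.
set v1 := eval _ _ _ e1; set v2 := eval _ _ _ e2.
have le2 : v2 <= vb e2 N by apply: eval_vb; case: P.
apply: (@exe_le _ _ _ _ (tb e1 N + (tb e2 N + (v2 * 3).+1))); first lia.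
apply: exe_seq; first by apply: IH1 P; lia.
apply: exe_seq.
  apply: (IH2 vs env); [lia|lia|].
  by prea P.
pose s i := upd (upd sg d (nseq (v1 - i) true)) d.+1 (nseq (v2 - i) true).
have -> : upd (upd sg d (nseq v1 true)) d.+1 (nseq v2 true) = s 0 by rewrite /s !subn0.
have -> : upd sg d (nseq (v1 - v2) true) = s v2.
  by rewrite /s subnn; steq; rewrite (pre_fresh P) //; lia.
apply: exe_while; [lia| |by rewrite /s subnn; ev].
move=> j jv; split; first by rewrite /s; ev; case: (v2 - j) (subn_gt0 j v2); rewrite jv.
have E : v2 - j = (v2 - j.+1).+1 by lia.
apply: (exe_seq (exe_pop _ _ _) (exe_to _ (exe_pop _ _ _))).
rewrite /s E; steq; ev => //.
by case: (v1 - j) (subnS v1 j) => [|k] ->.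
Qed.

Lemma comp_mul e1 e2 : comp_ok e1 -> comp_ok e2 -> comp_ok (Mul e1 e2).
Proof.
move=> IH1 IH2 vs env d N sg d1 dm P; rewrite /= in dm *.
set v1 := eval _ _ _ e1; set v2 := eval _ _ _ e2.
have le1 : v1 <= vb e1 N by apply: eval_vb; case: P.
have le2 : v2 <= vb e2 N by apply: eval_vb; case: P.
apply: (@exe_le _ _ _ _ (tb e1 N + ((v1 * (1 + (tb e2 N + (5 * v2).+1)).+1).+1
  + (5 * (v1 * v2)).+1))).
  have := leq_mul le1 le2.
  have : v1 * (tb e2 N + 5 * v2 + 3) <= vb e1 N * (tb e2 N + 5 * vb e2 N + 3).
    by apply: leq_mul => //; lia.
  lia.
apply: exe_seq; first by apply: IH1 P; lia.
pose s i := upd (upd sg d (nseq (v1 - i) true)) d.+1 (nseq (i * v2) true).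
apply: (@exe_seq _ _ _ _ _ _ _ _ (s v1)).
  have -> : upd sg d (nseq v1 true) = s 0.
    by rewrite /s subn0; steq; rewrite (pre_fresh P) //; lia.
  apply: exe_while; [lia| |by rewrite /s subnn; ev].
  move=> j jv; split; first by rewrite /s; ev; case: (v1 - j) (subn_gt0 j v1); rewrite jv.
  have E : v1 - j = (v1 - j.+1).+1 by lia.
  apply: exe_seq; first exact: exe_pop.
  apply: exe_seq.
    apply: (IH2 vs env d.+2 N); [lia|lia|].
    by rewrite /s; prea P.
  set s' := upd _ d.+2 _.
  have := @exe_mov X m st d.+2 d.+1 s'.
  have -> : s' d.+2 = nseq v2 true by rewrite /s'; ev.
  have -> : s' d.+1 = nseq (j * v2) true by rewrite /s' /s; ev.
  rewrite size_nseq catrev_nseq => H; apply: exe_to (H _ _); [|lia|lia].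
  rewrite /s' /s E; steq; ev => //; rewrite ?mulSn // (pre_fresh P) //; lia.
have := @exe_mov X m st d.+1 d (s v1).
have -> : s v1 d.+1 = nseq (v1 * v2) true by rewrite /s; ev.
have -> : s v1 d = [::] by rewrite /s subnn; ev.
rewrite size_nseq catrevE cats0 rev_nseq => H; apply: exe_to (H _ _); [|lia|lia].
by rewrite /s; steq; rewrite (pre_fresh P) //; lia.
Qed.

Lemma comp_rec n b f : comp_ok n -> comp_ok b -> comp_ok f -> comp_ok (Rec n b f).
Proof.
move=> IHn IHb IHf vs env d N sg d1 dm P; rewrite /= in dm *.
set v := eval _ _ _ n; set B := eval _ _ _ b.
set g := fun i a => _; set N' := N + vb n N + vb b N.
have lev : v <= vb n N by apply: eval_vb; case: P.
have leB : B <= vb b N by apply: eval_vb; case: P.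
have leI j : iteri j g 0 <= B by case: j => //= j; apply: geq_minr.
have lef j : j <= v -> eval w z (iteri j g 0 :: j :: env) f <= vb f N'.
  move=> jv; apply: eval_vb.
  - by apply: leq_trans (pre_wN P) _; lia.
  - by apply: leq_trans (pre_zN P) _; lia.
  rewrite /=; apply/and3P; split; [have := leI j; lia|lia|].
  by apply: sub_all (pre_N P) => u; lia.
apply: (@exe_le _ _ _ _ (tb n N + ((v * (1 + (tb f N' + ((B.*2).+1 + (tb b N +
   ((B * 6).+1 + (((vb f N').*2).+1 + 2)))))).+1).+1 + ((v.*2).+1 + (5 * B).+1)))).
  have : v * (1 + (tb f N' + ((B.*2).+1 + (tb b N +
   ((B * 6).+1 + (((vb f N').*2).+1 + 2)))))).+1 <=
    vb n N * (tb f N' + 8 * vb b N + tb b N + 2 * vb f N' + 10).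
    by apply: leq_mul => //; lia.
  lia.
apply: exe_seq; first by apply: IHn P; lia.
pose s i := upd (upd (upd sg d (nseq (v - i) true)) d.+1 (nseq i true)) d.+2
  (nseq (iteri i g 0) true).
apply: (@exe_seq _ _ _ _ _ _ _ _ (s v)).
  have -> : upd sg d (nseq v true) = s 0.
    by rewrite /s subn0; steq; rewrite (pre_fresh P) //; lia.
  apply: exe_while; [lia| |by rewrite /s subnn; ev].
  move=> j jv; split; first by rewrite /s; ev; case: (v - j) (subn_gt0 j v); rewrite jv.
  have E : v - j = (v - j.+1).+1 by lia.
  apply: exe_seq; first exact: exe_pop.
  set s1 := upd (s j) _ _.
  have P1 : pre w z N vs env d.+3 s1 by rewrite /s1 /s; prea P.
  set F := eval w z (iteri j g 0 :: j :: env) f.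
  apply: exe_seq.
    apply: (IHf _ (iteri j g 0 :: j :: env) _ N'); [lia|lia|].
    apply: pre_cons; [lia|by rewrite /s1 /s; ev|have := leI j; lia|].
    apply: pre_cons; [lia|by rewrite /s1 /s; ev|lia|].
    by apply: pre_le P1; lia.
  set s2 := upd s1 _ _.
  apply: exe_seq.
    apply: (@exe_le _ _ _ _ (size (s2 d.+2)).*2.+1); last by apply: exe_clear; lia.
    by rewrite /s2 /s1 /s; ev; rewrite size_nseq; have := leI j; lia.
  set s3 := upd s2 _ _.
  apply: exe_seq.
    apply: (IHb vs env d.+4 N); [lia|lia|].
    by rewrite /s3 /s2 /s1 /s; prea P.
  have leF : F <= vb f N' by apply: lef; lia.
  (* Counting the cap down in [d.+4] while moving at most one unit of [F] per round leaves
     [minn B F], the truncated value. *)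
  pose t i := upd (upd (upd s3 d.+4 (nseq (B - i) true)) d.+3 (nseq (F - i) true))
    d.+2 (nseq (minn i F) true).
  apply: (@exe_seq _ _ _ _ _ _ _ _ (t B)).
    have -> : upd s3 d.+4 (nseq (eval w z env b) true) = t 0.
      by rewrite /t !subn0 min0n /s3 /s2; steq.
    apply: exe_while; [lia| |by rewrite /t subnn; ev].
    move=> i iB; split; first by rewrite /t; ev; case: (B - i) (subn_gt0 i B); rewrite iB.
    have EB : B - i = (B - i.+1).+1 by lia.
    apply: (@exe_seq _ _ _ _ _ 1 4); first exact: exe_pop.
    set t1 := upd (t i) _ _.
    have Et3 : t1 d.+3 = nseq (F - i) true by rewrite /t1 /t; ev.
    have Et2 : t1 d.+2 = nseq (minn i F) true by rewrite /t1 /t; ev.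
    apply: exe_if; first lia.
    rewrite Et3; case: (ltnP i F) => iF.
      have EF : F - i = (F - i.+1).+1 by lia.
      rewrite EF /=; apply: (exe_seq (exe_pop _ _ _) (exe_to _ (exe_push _ _ _ _))).
      have Em1 : minn i.+1 F = (minn i F).+1 by lia.
      have -> : upd t1 d.+3 (behead (t1 d.+3)) d.+2 = nseq (minn i F) true.
        by ev; rewrite Et2.
      by rewrite Et3 EF [t i.+1]/t Em1 /t1 /t EB; steq; ev.
    have -> : F - i = 0 by lia.
    apply: (@exe_le _ _ _ _ 1) => //; apply: exe_to (exe_skip _ _).
    rewrite /t1 /t; have [-> -> -> ->] : [/\ F - i = 0, F - i.+1 = 0, minn i F = F & minn i.+1 F = F] by split; lia.
    by steq; ev; rewrite EB.
  apply: exe_seq.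
    apply: (@exe_le _ _ _ _ (size (t B d.+3)).*2.+1); last by apply: exe_clear; lia.
    by rewrite /t; ev; rewrite size_nseq; lia.
  apply: exe_to (exe_push _ _ _ _).
  have Em : iteri j.+1 g 0 = minn B F by rewrite /= /g -/F minnC.
  rewrite [s j.+1]/s Em /t subnn /s3 /s2 /s1 /s E; steq; ev => //; rewrite (pre_fresh P) //; lia.
apply: exe_seq.
  apply: (@exe_le _ _ _ _ (size (s v d.+1)).*2.+1); last by apply: exe_clear; lia.
  by rewrite /s; ev; rewrite size_nseq.
set s' := upd (s v) _ _.
have := @exe_mov X m st d.+2 d s'.
have -> : s' d.+2 = nseq (iteri v g 0) true by rewrite /s' /s; ev.
have -> : s' d = [::] by rewrite /s' /s subnn; ev.
rewrite size_nseq catrevE cats0 rev_nseq => H.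
apply: exe_to (exe_le _ (H _ _)); [|have := leI v; lia|lia|lia].
by rewrite /s' /s; steq; rewrite (pre_fresh P) //; lia.
Qed.

(** The letters before the requested one are popped into scratch and pushed back afterwards. On a
    short string the pops stop early and the test meets an empty stack, in agreement with the
    default [false]. *)
Lemma comp_bit s e : comp_ok e -> comp_ok (Bit s e).
Proof.
move=> IH vs env d N sg d1 dm P; rewrite /= in dm *.
set v := eval _ _ _ e; rewrite -/(str s).
have lev : v <= vb e N by apply: eval_vb; case: P.
have szN := size_str s P; have Es := pre_str s P.
have s1 : s < 2 by case: (s).
move: (nat_of_bool s) (str s) szN Es s1 => r u szN Es s1.
apply: (@exe_le _ _ _ _ (tb e N + ((v * 7).+1 + (3 + (5 * N).+1)))); first lia.
apply: exe_seq; first by apply: IH P; lia.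
pose t i := upd (upd (upd sg d (nseq (v - i) true)) r (drop i u)) d.+1 (rev (take i u)).
apply: (@exe_seq _ _ _ _ _ _ _ _ (t v)).
  have -> : upd sg d (nseq (eval w z env e) true) = t 0.
    by rewrite /t subn0 drop0 take0; steq; rewrite (pre_fresh P) //; lia.
  apply: exe_while; [lia| |by rewrite /t subnn; ev].
  move=> i iv; split; first by rewrite /t; ev; case: (v - i) (subn_gt0 i v); rewrite iv.
  have E : v - i = (v - i.+1).+1 by lia.
  apply: (@exe_seq _ _ _ _ _ 1 5); first exact: exe_pop.
  set t1 := upd (t i) _ _.
  have Er : t1 r = drop i u by rewrite /t1 /t; ev.
  have Ed : t1 d.+1 = rev (take i u) by rewrite /t1 /t; ev.
  apply: exe_if; first lia.
  rewrite Er; case: (ltnP i (size u)) => iu.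
    rewrite (drop_nth true iu) /=.
    apply: exe_to (exe_xfer _ _ _ _ _ _ _ _ _); try exact: etrans Er (drop_nth true iu);
      try lia.
    by rewrite Ed /t1 /t E (take_nth true iu) rev_rcons; steq; ev.
  rewrite drop_oversize //=; apply: (@exe_le _ _ _ _ 1) => //; apply: exe_to (exe_skip _ _).
  rewrite /t1 /t E !drop_oversize ?take_oversize //; try lia.
  by steq; ev.
apply: (@exe_seq _ _ _ _ _ _ _ _ (upd (t v) d (nseq (nth false u v) true))).
  apply: exe_if; first lia.
  have -> : t v r = drop v u by rewrite /t; ev.
  have -> : ohead (drop v u) = onth u v.
    by elim: (u) (v) => [|x u' IHu] [|v'] //=; rewrite ?drop0.
  rewrite /top_true; have Et : t v d = [::] by rewrite /t subnn; ev.
  have -> : (onth u v == Some true) = nth false u v.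
    by elim: (u) (v) => [|x u' IHu] [|v'] //=; case: x.
  case: (nth false u v).
    by apply: exe_to (exe_push _ _ _ _); rewrite Et.
  by apply: (@exe_le _ _ _ _ 1) => //; apply: exe_to (exe_skip _ _); steq.
set t1 := upd _ d _.
have E1 : t1 d.+1 = rev (take v u) by rewrite /t1 /t; ev.
have Er : t1 r = drop v u by rewrite /t1 /t; ev.
apply: (@exe_le _ _ _ _ (5 * size (t1 d.+1)).+1).
  by rewrite E1 size_rev; have := size_take_min v u; lia.
apply: exe_to (exe_mov _ _ _ _ _ _); [|lia|lia].
rewrite E1 Er catrevE revK cat_take_drop /t1 /t; steq; ev => //.
by rewrite (pre_fresh P) //; lia.
Qed.

Lemma comp_len s : comp_ok (Len s).
Proof.
move=> vs env d N sg d1 dm P; rewrite /= in dm *.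
rewrite -/(str s).
have szN := size_str s P; have Es := pre_str s P.
have s1 : s < 2 by case: (s).
move: (nat_of_bool s) (str s) szN Es s1 => r u szN Es s1.
apply: (@exe_le _ _ _ _ ((size u * 7).+1 + (5 * N).+1)); first lia.
pose t i := upd (upd (upd sg d (nseq i true)) r (drop i u)) d.+1 (rev (take i u)).
apply: (@exe_seq _ _ _ _ _ _ _ _ (t (size u))).
  have -> : sg = t 0.
    by rewrite /t drop0 take0; steq; rewrite (pre_fresh P) //; lia.
  apply: exe_while; [lia| |by rewrite /t drop_size; ev].
  move=> i iu; split; first by rewrite /t; ev; rewrite (drop_nth true iu).
  apply: (@exe_seq _ _ _ _ _ 4 2).
    apply: (@exe_xfer _ _ st r d.+1 (t i) (nth true u i) (drop i.+1 u)); [lia|lia|].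
    by rewrite /t; ev; rewrite (drop_nth true iu).
  apply: exe_to (exe_push _ _ _ _).
  by rewrite /t (take_nth true iu) rev_rcons; steq; ev.
set t1 := t (size u).
have E1 : t1 d.+1 = rev u by rewrite /t1 /t; ev; rewrite take_size.
have Er : t1 r = [::] by rewrite /t1 /t; ev; rewrite drop_size.
apply: (@exe_le _ _ _ _ (5 * size (t1 d.+1)).+1); first by rewrite E1 size_rev; lia.
apply: exe_to (exe_mov _ _ _ _ _ _); [|lia|lia].
rewrite E1 Er catrevE revK cats0 /t1 /t; steq; ev => //.
by rewrite (pre_fresh P) //; lia.
Qed.

Lemma comp_exe e : comp_ok e.
Proof.
elim: e => *; [exact: comp_var|exact: comp_cst|exact: comp_add|exact: comp_sub
  |exact: comp_mul|exact: comp_rec|exact: comp_bit|exact: comp_len].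
Qed.


(** * Writing a string letter by letter *)

Definition gen b e1 e2 tgt : frag :=
  comp [::] b e1 ;;
  wh b (pop b ;; comp [:: b.+1] b.+3 e2 ;;
        fif (test b.+3 nonempty) (clear b.+3 ;; push b.+2 true) (push b.+2 false) ;;
        push b.+1 true) ;;
  clear b.+1 ;; clear tgt ;; mov b.+2 tgt.

Definition gb e1 e2 N := let V := vb e1 N in
  tb e1 N + V * (tb e2 (N + V) + 2 * vb e2 (N + V) + 10) + 7 * V + 2 * N + 10.

(** The new string is gathered in reverse in [b.+2] and replaces the target only at the end, because
    [e2] may read the target in every round. *)
Lemma gen_exe b e1 e2 (tgt : bool) N sg : 1 < b -> b + 3 + need e1 + need e2 <= m ->
  pre w z N [::] [::] b sg ->
  exe st (gen b e1 e2 tgt) (gb e1 e2 N) sg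
    (upd sg tgt (mkseq (fun i => 0 < eval w z [:: i] e2) (eval w z [::] e1))).
Proof.
move=> b1 bm P; set L := eval _ _ _ e1; set f := fun i => _.
have leL : L <= vb e1 N by apply: eval_vb; case: P.
have tN : size (sg tgt) <= N by rewrite (pre_str tgt P); apply: size_str P.
have t2 : tgt < 2 by case: (tgt).
move: (nat_of_bool tgt) tN t2 => tg tN t2.
set V := vb e1 N in leL.
apply: (@exe_le _ _ _ _ (tb e1 N + ((L * (1 + (tb e2 (N + V) +
   (((vb e2 (N + V)).*2 + 3).+1 + 2))).+1).+1
   + ((L.*2).+1 + ((N.*2).+1 + (5 * L).+1))))).
  have : L * (1 + (tb e2 (N + V) + (((vb e2 (N + V)).*2 + 3).+1 + 2))).+1 <=
    V * (tb e2 (N + V) + 2 * vb e2 (N + V) + 10) by apply: leq_mul => //; lia.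
  rewrite /gb -/V; lia.
apply: exe_seq; first by apply: (comp_exe _ _ P); lia.
pose s i := upd (upd (upd sg b (nseq (L - i) true)) b.+1 (nseq i true)) b.+2
  (rev (mkseq f i)).
apply: (@exe_seq _ _ _ _ _ _ _ _ (s L)).
  have -> : upd sg b (nseq (eval w z [::] e1) true) = s 0.
    by rewrite /s subn0; steq; rewrite (pre_fresh P) //; lia.
  apply: exe_while; [lia| |by rewrite /s subnn; ev].
  move=> j jL; split; first by rewrite /s; ev; case: (L - j) (subn_gt0 j L); rewrite jL.
  have E : L - j = (L - j.+1).+1 by lia.
  apply: exe_seq; first exact: exe_pop.
  set s1 := upd (s j) _ _.
  have P1 : pre w z N [::] [::] b.+3 s1 by rewrite /s1 /s; prea P.
  apply: exe_seq.
    apply: (@comp_exe _ _ [:: j] _ (N + V)); [lia|lia|].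
    apply: pre_cons; [lia|by rewrite /s1 /s; ev|lia|].
    by apply: pre_le P1; lia.
  set F := eval _ _ _ e2; set s2 := upd s1 _ _.
  have leF : F <= vb e2 (N + V).
    by apply: eval_vb; [have := pre_wN P; lia|have := pre_zN P; lia|rewrite /= andbT; lia].
  apply: (@exe_seq _ _ _ _ _ _ _ _ (upd s1 b.+2 (f j :: s1 b.+2))).
    apply: exe_if; first lia.
    have E3 : s2 b.+3 = nseq F true by rewrite /s2; ev.
    have E1 : s1 b.+3 = [::] by apply: (pre_fresh P1).
    rewrite E3 /f -/F; case EF: (F) => [|k] /=.
      apply: (@exe_le _ _ _ _ 2); first lia.
      by apply: exe_to (exe_push _ _ _ _); rewrite /s2 EF; steq; ev.
    apply: (@exe_le _ _ _ _ (F.*2.+1 + 2)); first lia.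
    apply: (@exe_seq _ _ _ _ _ _ _ _ (upd s2 b.+3 [::])).
      apply: (@exe_le _ _ _ _ (size (s2 b.+3)).*2.+1); last by apply: exe_clear; lia.
      by rewrite E3 size_nseq.
    by apply: exe_to (exe_push _ _ _ _); rewrite /s2; steq; ev.
  apply: exe_to (exe_push _ _ _ _).
  by rewrite /s1 /s E mkseqS rev_rcons; steq; ev.
apply: exe_seq.
  apply: (@exe_le _ _ _ _ (size (s L b.+1)).*2.+1); last by apply: exe_clear; lia.
  by rewrite /s; ev; rewrite size_nseq.
set s3 := upd _ _ _.
apply: exe_seq.
  apply: (@exe_le _ _ _ _ (size (s3 tg)).*2.+1); last by apply: exe_clear; lia.
  by rewrite /s3 /s; ev; lia.
set s4 := upd s3 _ _.
have E2 : s4 b.+2 = rev (mkseq f L) by rewrite /s4 /s3 /s; ev.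
have Et : s4 tg = [::] by rewrite /s4; ev.
apply: (@exe_le _ _ _ _ (5 * size (s4 b.+2)).+1).
  by rewrite E2 size_rev size_mkseq.
apply: exe_to (exe_mov _ _ _ _ _ _); [|lia|lia].
rewrite E2 Et catrevE revK cats0 /s4 /s3 /s subnn; steq; rewrite (pre_fresh P) //; lia.
Qed.

End Strings.
End Compile.

Lemma polyb_gb e1 e2 : polyb (gb e1 e2).
Proof.
have H : polyb (fun N => N + vb e1 N).
  by apply: polyb_add; [apply: polyb_id|apply: polyb_vb].
have := polyb_comp (polyb_tb e2) H; have := polyb_comp (polyb_vb e2) H => H1 H2.
rewrite /gb; repeat first [ apply: polyb_add | apply: polyb_mul | apply: polyb_cst
  | apply: polyb_id | apply: polyb_vb | apply: polyb_tb | eassumption ].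
Qed.

(** * Running a machine inside a program *)

Lemma step_halted (M : machine) (c : config M) n :
  halted (cstate c) -> iter n (@step M) c = c.
Proof. by move=> H; elim: n => //= n ->; rewrite /step H. Qed.

Lemma iter_halted (M : machine) (c : config M) n n' :
  halted (cstate (iter n (@step M) c)) -> n <= n' ->
  iter n' (@step M) c = iter n (@step M) c.
Proof. by move=> H /subnK <-; rewrite iterD step_halted. Qed.

Section Run.
Variables (M : machine) (m : nat).
Hypothesis Mm : (ntapes M).+1 <= m.
Notation tapes := ('I_m.+1 -> tape (aux M)).

(* Tape [i] of [M] is register [i + 1]. *)
Definition frun : frag (aux M) m :=
  @Frag _ m (state M) (start M) (fun q h =>
    if halted q then (None, idle h) else
    let: (q', a) := trans q [ffun i : 'I_(ntapes M).+1 => h (inord i.+1)] in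
    (Some q', fun j : 'I_m.+1 => if 0 < j <= (ntapes M).+1 then a (inord j.-1) else idle h j)).

Lemma tape_eqv_act (a : symbol (aux M) * move) t u :
  tape_eqv t u -> tape_eqv (tape_act a t) (tape_act a u).
Proof.
case: a => s [] [h l r]; split => //=.
- by have := l 0; rewrite !nth0.
- by move=> k; rewrite !nth_behead.
- by case.
- by have := r 0; rewrite !nth0.
- by case.
by move=> k; rewrite !nth_behead.
Qed.

Lemma wp_run t (c : config M) : halted (cstate (iter t (@step M) c)) ->
  exists2 k, k <= t.+1 & forall T : tapes,
    (forall i : 'I_(ntapes M).+1, tape_eqv (T (inord i.+1)) (ctape c i)) ->
    @wp _ _ frun k (cstate c) T (fun T' =>
      (forall i : 'I_(ntapes M).+1,
        tape_eqv (T' (inord i.+1)) (ctape (iter t (@step M) c) i)) /\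
      (forall j : 'I_m.+1, ~~ (0 < j <= (ntapes M).+1) -> T' j = T j)).
Proof.
elim: t c => [|t IH] c H.
  by exists 1 => // T HT; rewrite /= H act_idle.
case Hc: (halted (cstate c)).
  by exists 1 => // T HT; rewrite step_halted //= Hc act_idle.
rewrite iterSr in H *; have [k lek Hk] := IH _ H.
exists k.+1 => // T HT; rewrite /= Hc.
have -> : [ffun i : 'I_(ntapes M).+1 => heads T (inord i.+1)] = [ffun i => thead (ctape c i)].
  by apply/ffunP => i; rewrite !ffunE; case: (HT i).
have Es : step c = let: (q, act) := trans (cstate c) [ffun i => thead (ctape c i)] in
  Config q (fun i => tape_act (act i) (ctape c i)) by rewrite /step Hc.
case: (trans _ _) Es => q' a Es; rewrite Es in Hk *.
set T1 := act _ T.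
apply: (wp_mono _ (Hk T1 _)) => [T' [H1 H2]|i].
  split=> // j jn.
  by rewrite H2 // /T1 /act (negbTE jn) /idle /heads ffunE tape_act_idle.
have im : i.+1 < m.+1 by have := ltn_ord i; lia.
rewrite /T1 /act inordK // ltnS leq0n /= (ltn_ord i) inord_val.
exact: tape_eqv_act.
Qed.

Lemma exe_run t x y s : computes_in M x y t ->
  s 1 = x -> (forall j, 1 < j <= (ntapes M).+1 -> s j = [::]) ->
  exists k s', [/\ k <= t.+1,
    forall T, rep true T s -> @wp _ _ frun k (start M) T (fun T' => rep false T' s'),
    s' 1 = y & forall j, ~~ (0 < j <= (ntapes M).+1) -> s' j = s j].
Proof.
case=> Hh Ho s1 sj; have [k lek Hk] := wp_run Hh; exists k.
set c := iter t _ _ in Hh Ho Hk.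
exists (fun j => if 0 < j <= (ntapes M).+1 then
  let u := ctape c (inord j.-1) in bits_prefix (thead u :: tright u) else s j).
split => //; last by move=> j /negbTE ->.
  move=> T HT; apply: wp_mono (Hk T _) => [T' [H1 H2] j|i].
    case: ifP => Hj; last by rewrite H2 ?Hj //; apply: holds_weak (HT j).
    have /bits_prefix_eqv := H1 (inord j.-1).
    rewrite inordK; last by lia.
    by rewrite prednK ?inord_val //; lia.
  have := HT (inord i.+1); rewrite /holds inordK; last by have := ltn_ord i; lia.
  case: (posnP i) => i0.
    have -> : i = ord0 by apply: val_inj.
    by rewrite [s _]s1.
  rewrite sj; last by have := ltn_ord i; lia.
  by rewrite /= -val_eqE /= (gtn_eqF i0).
rewrite /= -Ho /output; have -> // : inord 0 = ord0 :> 'I_(ntapes M).+1.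
by apply: val_inj; rewrite /= inordK.
Qed.
End Run.

(** Register 0 keeps the input throughout, the registers from 1 on are the tapes of [M], and scratch
    space starts above them at [b]. The last two formulas can thus read both the input and the
    output of [M], as needed to inspect the result of a kernelization. *)
Theorem gen_run_polytime (A B : Type) (encA : A -> seq bool) (encB : B -> seq bool)
    (f : A -> B) (M : machine) (e1 e2 e3 e4 : expr) (pt ps : nat -> nat) :
  polyb pt -> polyb ps ->
  (forall a, let w := encA a in exists z,
    [/\ computes_in M (mkseq (fun i => 0 < eval w [::] [:: i] e2) (eval w [::] [::] e1))
          z (pt (size w)),
        size z <= ps (size w)
      & encB (f a) = mkseq (fun i => 0 < eval w z [:: i] e4) (eval w z [::] e3)]) ->
  polytime encA encB f.
Proof.
move=> Hpt Hps H.
pose b := (ntapes M).+3; pose m := b + 3 + need e1 + need e2 + need e3 + need e4.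
have Mm : (ntapes M).+1 <= m by lia.
pose F := fseq (gen (aux M) m b e1 e2 1) (fseq (frun M m) (gen (aux M) m b e3 e4 0)).
have [c Hc] : polyb (fun n => gb e1 e2 n + ((pt n).+1 + gb e3 e4 (n + ps n))).
  apply: polyb_add; first exact: polyb_gb.
  apply: polyb_add; first by apply: polyb_le (polyb_add Hpt (polyb_cst 1)) => n; lia.
  by apply: (@polyb_comp (gb e3 e4) (fun n => n + ps n)); [apply: polyb_gb|
    apply: polyb_add => //; apply: polyb_id].
exists (machine_of F), (pb_poly c) => a; rewrite pb_polyE.
have := H a; set w := encA a => -[z [Hz Sz Ez]].
set x := mkseq _ _ in Hz.
pose s0 : store := upd (fun=> [::]) 0 w.
have P0 : pre w [::] (size w) [::] [::] b s0.
  by split => //= r; rewrite /s0 /upd; case: r.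
have [k1 lek1 W1] := @gen_exe (aux M) m true w [::] b e1 e2 true _ _ erefl ltac:(lia) P0.
rewrite -/x in W1; set s1 := upd s0 _ _ in W1.
have [|k2 [s2 [lek2 W2 s21 s2j]]] := exe_run Mm Hz (s := s1) erefl.
  by case=> [|[|j]].
have P2 : pre w z (size w + ps (size w)) [::] [::] b s2.
  split => //; try lia; first by rewrite s2j.
  by case=> [|[|r]] // rb; rewrite s2j //; lia.
have [k3 lek3 W3] := @gen_exe (aux M) m false w z b e3 e4 false _ _ erefl ltac:(lia) P2.
rewrite -Ez in W3.
pose T0 := ctape (init (machine_of F) w).
have R0 : rep true T0 s0.
  move=> i; rewrite /T0 /= /s0 /upd.
  have -> : (i == ord0) = (val i == 0) by [].
  by case: eqP.
pose c0 := @Config (machine_of F) (Some (fstart F)) T0.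
have [Hq HT] := @wp_machine _ _ F _ (fstart F) T0 _
  (wp_seq (W1 T0 R0) (fun T' H' => wp_seq (W2 T' H') W3)).
rewrite -/c0 in Hq HT.
have Hh : @halted (machine_of F) (cstate (iter (k1 + (k2 + k3)) (@step (machine_of F)) c0)).
  by apply/eqP.
have lek : k1 + (k2 + k3) <= pb c (size w) by apply: leq_trans (Hc _); lia.
have E0 : init (machine_of F) w = c0 by [].
rewrite /computes_in E0 (iter_halted Hh lek); split=> //; exact: (HT ord0).
Qed.

(** * Definable functions *)

Definition inp := (seq bool * seq bool)%type.
(** Closure rules for this semantic predicate replace the writing of expressions; bound variables
    appear as positions of the environment. *)
Definition def (f : inp -> seq nat -> nat) : Prop :=
  exists e, forall w env, eval w.1 w.2 env e = f w env.
Definition defb (b : inp -> seq nat -> bool) : Prop := def (fun w e => nat_of_bool (b w e)).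

Lemma def_ext f g : (forall w e, f w e = g w e) -> def f -> def g.
Proof. by move=> fg [e He]; exists e => w env; rewrite He. Qed.

Lemma defb_ext f g : (forall w e, f w e = g w e) -> defb f -> defb g.
Proof. by move=> fg; apply: def_ext => w e; rewrite fg. Qed.

Fixpoint ren (r : nat -> nat) (e : expr) : expr :=
  match e with
  | Var i => Var (r i)
  | Cst _ | Len _ => e
  | Add e1 e2 => Add (ren r e1) (ren r e2)
  | Sub e1 e2 => Sub (ren r e1) (ren r e2)
  | Mul e1 e2 => Mul (ren r e1) (ren r e2)
  | Rec n b f => Rec (ren r n) (ren r b)
      (ren (fun i => if i is i'.+2 then (r i').+2 else i) f)
  | Bit s e => Bit s (ren r e)
  end.

Lemma eval_ren w z r e env env' : (forall i, nth 0 env' (r i) = nth 0 env i) ->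
  eval w z env' (ren r e) = eval w z env e.
Proof.
elim: e r env env' => //= [e1 IH1 e2 IH2|e1 IH1 e2 IH2|e1 IH1 e2 IH2|n IHn b IHb f IHf|s e IH]
  r env env' H; rewrite ?(IH1 _ env) ?(IH2 _ env) ?(IHn _ env) ?(IHb _ env) ?(IH _ env) //.
elim: (eval w z env n) => //= k ->; congr minn.
by apply: IHf => -[|[|i]] /=.
Qed.

Fixpoint subst (r : nat -> expr) (e : expr) : expr :=
  match e with
  | Var i => r i
  | Cst _ | Len _ => e
  | Add e1 e2 => Add (subst r e1) (subst r e2)
  | Sub e1 e2 => Sub (subst r e1) (subst r e2)
  | Mul e1 e2 => Mul (subst r e1) (subst r e2)
  | Rec n b f => Rec (subst r n) (subst r b)
      (subst (fun i => if i is i'.+2 then ren (fun j => j.+2) (r i') else Var i) f)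
  | Bit s e => Bit s (subst r e)
  end.

Lemma eval_subst w z r e env env' : (forall i, eval w z env' (r i) = nth 0 env i) ->
  eval w z env' (subst r e) = eval w z env e.
Proof.
elim: e r env env' => //= [e1 IH1 e2 IH2|e1 IH1 e2 IH2|e1 IH1 e2 IH2|n IHn b IHb f IHf|s e IH]
  r env env' H; rewrite ?(IH1 _ env) ?(IH2 _ env) ?(IHn _ env) ?(IHb _ env) ?(IH _ env) //.
elim: (eval w z env n) => //= k ->; congr minn.
by apply: IHf => -[|[|i]] //=; rewrite -H; apply: eval_ren.
Qed.

(** A loop body, written under its two variables, can be reused at any definable argument: [f] is
    substituted for the round, and the outer environment is reached past [k] binders. *)
Lemma def_body k (g : seq nat -> seq nat) (P : inp -> seq nat -> nat -> nat) f :
  def (fun w e => P w (drop 2 e) (nth 0 e 1)) -> def f ->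
  (forall e, g e = drop k e) -> def (fun w e => P w (g e) (f w e)).
Proof.
move=> [e He] [ef Hf] gk.
exists (subst (fun i => if i is i'.+2 then Var (k + i') else if i is 1 then ef else Cst 0) e).
move=> w env; rewrite gk -Hf.
have := He w [:: 0, eval w.1 w.2 env ef & drop k env]; rewrite /= drop0 => <-.
by apply: eval_subst => -[|[|i]] //=; rewrite nth_drop.
Qed.

Lemma def_shift k (g : seq nat -> seq nat) f :
  def f -> (forall e, g e = drop k e) -> def (fun w e => f w (g e)).
Proof.
move=> [e He] gk; exists (ren (addn k) e) => w env; rewrite -He gk.
by apply: eval_ren => i; rewrite nth_drop.
Qed.

Lemma defb_shift k (g : seq nat -> seq nat) f :
  defb f -> (forall e, g e = drop k e) -> defb (fun w e => f w (g e)).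
Proof. exact: def_shift. Qed.

Lemma def_var0 i : def (fun w e => nth 0 e i).
Proof. by exists (Var i). Qed.

Lemma def_var k (g : seq nat -> seq nat) i :
  (forall e, g e = drop k e) -> def (fun w e => nth 0 (g e) i).
Proof. by move=> gk; exists (Var (k + i)) => w e; rewrite gk nth_drop. Qed.

Lemma def_cst k : def (fun w e => k).
Proof. by exists (Cst k). Qed.

Lemma def_add f g : def f -> def g -> def (fun w e => f w e + g w e).
Proof. by move=> [e1 H1] [e2 H2]; exists (Add e1 e2) => w e /=; rewrite H1 H2. Qed.

Lemma def_sub f g : def f -> def g -> def (fun w e => f w e - g w e).
Proof. by move=> [e1 H1] [e2 H2]; exists (Sub e1 e2) => w e /=; rewrite H1 H2. Qed.

Lemma def_mul f g : def f -> def g -> def (fun w e => f w e * g w e).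
Proof. by move=> [e1 H1] [e2 H2]; exists (Mul e1 e2) => w e /=; rewrite H1 H2. Qed.

Lemma def_succ f : def f -> def (fun w e => (f w e).+1).
Proof. by move=> Hf; apply: def_ext (def_add Hf (def_cst 1)) => w e; rewrite addn1. Qed.

Lemma def_rec n b (f : inp -> seq nat -> nat -> nat -> nat) : def n -> def b ->
  def (fun w e => f w (drop 2 e) (nth 0 e 1) (nth 0 e 0)) ->
  def (fun w e => iteri (n w e) (fun i a => minn (f w e i a) (b w e)) 0).
Proof.
move=> [en Hn] [eb Hb] [ef Hf]; exists (Rec en eb ef) => w e /=; rewrite Hn Hb.
by elim: (n w e) => //= k ->; rewrite Hf /= drop0.
Qed.

Lemma def_bit1 f : def f -> defb (fun w e => nth false w.1 (f w e)).
Proof. by move=> [e1 H1]; exists (Bit false e1) => w e /=; rewrite H1. Qed.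

Lemma def_bit2 f : def f -> defb (fun w e => nth false w.2 (f w e)).
Proof. by move=> [e1 H1]; exists (Bit true e1) => w e /=; rewrite H1. Qed.

Lemma def_len1 : def (fun w e => size w.1).
Proof. by exists (Len false). Qed.

Lemma def_len2 : def (fun w e => size w.2).
Proof. by exists (Len true). Qed.

Lemma def_nat f : defb f -> def (fun w e => nat_of_bool (f w e)).
Proof. by []. Qed.

Lemma defb_cst b : defb (fun w e => b).
Proof. exact: def_cst. Qed.

Lemma defb_not f : defb f -> defb (fun w e => ~~ f w e).
Proof.
by move=> Hf; apply: def_ext (def_sub (def_cst 1) Hf) => w e; case: (f w e).
Qed.

Lemma defb_and f g : defb f -> defb g -> defb (fun w e => f w e && g w e).
Proof.
by move=> Hf Hg; apply: def_ext (def_mul Hf Hg) => w e; case: (f w e); case: (g w e).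
Qed.

Lemma defb_or f g : defb f -> defb g -> defb (fun w e => f w e || g w e).
Proof.
move=> Hf Hg; apply: defb_ext (defb_not (defb_and (defb_not Hf) (defb_not Hg))) => w e.
by rewrite negb_and !negbK.
Qed.

Lemma defb_impl f g : defb f -> defb g -> defb (fun w e => f w e ==> g w e).
Proof.
by move=> Hf Hg; apply: defb_ext (defb_or (defb_not Hf) Hg) => w e; rewrite implybE.
Qed.

Lemma defb_leq f g : def f -> def g -> defb (fun w e => f w e <= g w e).
Proof.
move=> Hf Hg; apply: def_ext (def_sub (def_cst 1) (def_sub Hf Hg)) => w e.
by rewrite leqNgt -subn_gt0; case: (f w e - g w e).
Qed.

Lemma defb_eq f g : def f -> def g -> defb (fun w e => f w e == g w e).
Proof.
move=> Hf Hg; apply: defb_ext (defb_and (defb_leq Hf Hg) (defb_leq Hg Hf)) => w e.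
by rewrite -eqn_leq.
Qed.

Lemma defb_eqb f g : defb f -> defb g -> defb (fun w e => f w e == g w e :> bool).
Proof.
move=> Hf Hg; apply: defb_ext (defb_eq Hf Hg) => w e.
by case: (f w e); case: (g w e).
Qed.

Lemma def_if b f g : defb b -> def f -> def g -> def (fun w e => if b w e then f w e else g w e).
Proof.
move=> Hb Hf Hg; apply: def_ext (def_add (def_mul Hb Hf) (def_mul (defb_not Hb) Hg)) => w e.
by case: (b w e) => /=; lia.
Qed.

Lemma defb_if b f g : defb b -> defb f -> defb g ->
  defb (fun w e => if b w e then f w e else g w e).
Proof.
by move=> Hb Hf Hg; apply: def_ext (def_if Hb Hf Hg) => w e; case: (b w e).
Qed.

Lemma def_min f g : def f -> def g -> def (fun w e => minn (f w e) (g w e)).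
Proof.
by move=> Hf Hg; apply: def_ext (def_sub Hf (def_sub Hf Hg)) => w e; lia.
Qed.

Lemma iotaSr n : iota 0 n.+1 = rcons (iota 0 n) n.
Proof. by rewrite -addn1 iotaD add0n cats1. Qed.

(** A partial count never exceeds the number of rounds, so a cap of [n] changes nothing. *)
Lemma def_count n (P : inp -> seq nat -> nat -> bool) : def n ->
  defb (fun w e => P w (drop 2 e) (nth 0 e 1)) ->
  def (fun w e => count (P w e) (iota 0 (n w e))).
Proof.
move=> Hn HP.
have := @def_rec n n (fun w e i a => a + P w e i) Hn Hn
  (def_add (def_var0 0) HP).
apply: def_ext => w e.
have H B k : k <= B -> iteri k (fun i a => minn (a + P w e i) B) 0 = count (P w e) (iota 0 k).
  elim: k => // k IH kB; rewrite iotaSr -cats1 count_cat /= addn0 IH; last lia.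
  by have := count_size (P w e) (iota 0 k); rewrite size_iota; case: (P w e k); lia.
exact: H.
Qed.

Lemma defb_has n (P : inp -> seq nat -> nat -> bool) : def n ->
  defb (fun w e => P w (drop 2 e) (nth 0 e 1)) ->
  defb (fun w e => has (P w e) (iota 0 (n w e))).
Proof.
move=> Hn HP; apply: defb_ext (defb_leq (def_cst 1) (def_count Hn HP)) => w e.
by rewrite has_count.
Qed.

Lemma defb_all n (P : inp -> seq nat -> nat -> bool) : def n ->
  defb (fun w e => P w (drop 2 e) (nth 0 e 1)) ->
  defb (fun w e => all (P w e) (iota 0 (n w e))).
Proof.
move=> Hn HP.
apply: defb_ext (defb_not (defb_has (P := fun w e i => ~~ P w e i) Hn (defb_not HP))) => w e.
by rewrite -all_predC; apply: eq_all => i /=; rewrite negbK.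
Qed.

Lemma count_ltn k n : count (fun i => i < k) (iota 0 n) = minn k n.
Proof.
elim: n => [|n IH]; first by rewrite minn0.
by rewrite iotaSr -cats1 count_cat IH /= addn0; case: ltnP; lia.
Qed.

(** The first hit is the number of indices up to and including which no hit occurs, so search
    reduces to counting. *)
Lemma find_iota (P : pred nat) n :
  find P (iota 0 n) = count (fun i => ~~ has P (iota 0 i.+1)) (iota 0 n).
Proof.
rewrite -(@eq_in_count _ (fun i => i < find P (iota 0 n))) ?count_ltn; last first.
  move=> i; rewrite mem_iota add0n leq0n andTb => ilt.
  rewrite -[RHS]/(~~ has P (iota 0 i.+1)).
  rewrite (_ : iota 0 i.+1 = take i.+1 (iota 0 n)); last by rewrite take_iota; congr iota; lia.
  by rewrite has_take_leq ?size_iota // ltnS ltnNge.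
by have := find_size P (iota 0 n); rewrite size_iota => /minn_idPl.
Qed.

Lemma def_find n (P : inp -> seq nat -> nat -> bool) : def n ->
  defb (fun w e => P w (drop 2 e) (nth 0 e 1)) ->
  def (fun w e => find (P w e) (iota 0 (n w e))).
Proof.
move=> Hn HP.
have H : defb (fun w e => ~~ has (P w (drop 2 e)) (iota 0 (nth 0 e 1).+1)).
  apply: defb_not; apply: (@defb_has _ (fun w e => P w (drop 2 e))).
    exact/def_succ/def_var0.
  by apply: (@def_body 4 (fun e => drop 2 (drop 2 e)) (fun w e i => nat_of_bool (P w e i))
    _ HP (def_var0 1)) => e; rewrite drop_drop.
by apply: def_ext (def_count (P := fun w e i => ~~ has (P w e) (iota 0 i.+1)) Hn H) => w e;
  rewrite find_iota.
Qed.

(** The quotient counts the positive multiples of the divisor up to the dividend; multiplying by the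
    test [1 <= g] gives the conventional 0 for division by zero. *)
Lemma def_div f g : def f -> def g -> def (fun w e => f w e %/ g w e).
Proof.
move=> Hf Hg.
have H : def (fun w e => count (fun i => i.+1 * g w e <= f w e) (iota 0 (f w e))).
  apply: (def_count (P := fun w e i => i.+1 * g w e <= f w e)) => //.
  apply: defb_leq; last exact: def_shift (fun=> erefl).
  by apply: def_mul; [apply/def_succ/def_var0|apply: def_shift (fun=> erefl)].
apply: def_ext (def_mul (defb_leq (def_cst 1) Hg) H) => w e.
case: (posnP (g w e)) => [->|g0]; first by rewrite divn0.
rewrite mul1n (@eq_count _ _ (fun i => i < f w e %/ g w e)) ?count_ltn.
  by apply/minn_idPl; apply: leq_div.
by move=> i; rewrite /= leq_divRL.
Qed.

Lemma def_mod f g : def f -> def g -> def (fun w e => f w e %% g w e).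
Proof.
move=> Hf Hg; apply: def_ext (def_sub Hf (def_mul (def_div Hf Hg) Hg)) => w e.
by rewrite {1}(divn_eq (f w e) (g w e)) addKn.
Qed.

Lemma defb_odd f : def f -> defb (fun w e => odd (f w e)).
Proof. by move=> Hf; apply: def_ext (def_mod Hf (def_cst 2)) => w e; rewrite modn2. Qed.

Lemma def_pb c f : def f -> def (fun w e => pb c (f w e)).
Proof.
move=> Hf; rewrite /pb; elim: {2}c => [|k IH]; first exact: def_cst.
apply: def_ext (def_mul (def_add Hf (def_cst c)) IH) => w e.
by rewrite expnS.
Qed.

Lemma def_double f : def f -> def (fun w e => (f w e).*2).
Proof. by move=> Hf; apply: def_ext (def_add Hf Hf) => w e; rewrite addnn. Qed.

Lemma def_pred f : def f -> def (fun w e => (f w e).-1).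
Proof. by move=> Hf; apply: def_ext (def_sub Hf (def_cst 1)) => w e; rewrite subn1. Qed.


(** Finite tables: this is how the transition function of a fixed machine enters a formula. *)
Lemma def_fin d (F : nat -> inp -> seq nat -> nat) f : def f ->
  (forall i, i < d -> def (F i)) ->
  def (fun w e => if f w e < d then F (f w e) w e else 0).
Proof.
move=> Hf; elim: d => [|d IH] HF; first exact: def_cst.
have {}IH := IH (fun i id => HF i (leqW id)).
apply: def_ext (def_if (defb_eq Hf (def_cst d)) (HF d (ltnSn d)) IH) => w e.
by rewrite ltnS (leq_eqVlt (f w e) d); case: (eqVneq (f w e) d) => [->|].
Qed.

Lemma defb_fin d (F : nat -> inp -> seq nat -> bool) f : def f ->
  (forall i, i < d -> defb (F i)) ->
  defb (fun w e => (f w e < d) && F (f w e) w e).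
Proof.
move=> Hf HF; apply: def_ext (def_fin Hf HF) => w e.
by case: (f w e < d).
Qed.

(** Loops start at 0, so powers of two are computed shifted by one; capping [a.*2.+1] in every round
    has the same effect as capping once at the end. *)
Lemma pow2_iteri i B :
  iteri i (fun _ a => minn (a.*2.+1) B) 0 = minn (2 ^ i - 1) B.
Proof.
elim: i => [|i IH]; first by rewrite expn0 subnn min0n.
rewrite [LHS]/= IH expnS; have : 0 < 2 ^ i by rewrite expn_gt0.
lia.
Qed.

Lemma def_pow2 f B : def f -> def B -> def (fun w e => minn (2 ^ f w e - 1) (B w e)).
Proof.
move=> Hf HB; have := @def_rec f B (fun w e i a => a.*2.+1) Hf HB.
case=> [|e He].
  by apply: def_succ; apply: def_ext (def_add (def_var0 0) (def_var0 0)) => w e; rewrite addnn.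
by exists e => w env; rewrite He pow2_iteri.
Qed.

Lemma pow2_le i k : (2 ^ i <= k) = (minn (2 ^ i - 1) k < k).
Proof. have : 0 < 2 ^ i by rewrite expn_gt0. lia. Qed.

Lemma up_log_gt i k : (2 ^ i <= k) = (i < up_log 2 k.+1).
Proof.
rewrite [RHS]ltnNge -ltnS ltnNge; congr (~~ _); apply/idP/idP => [|H]; first exact: up_log_min.
by apply: (@leq_trans (2 ^ up_log 2 k.+1)); [apply: up_logP|rewrite leq_exp2l].
Qed.

Lemma up_log_count k : up_log 2 k.+1 = count (fun i => 2 ^ i <= k) (iota 0 k).
Proof.
rewrite (@eq_count _ _ (fun i => i < up_log 2 k.+1)) ?count_ltn; last first.
  by move=> i; rewrite /= -up_log_gt.
by apply/esym/minn_idPl; apply: up_log_min => //; apply: ltn_expl.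
Qed.

Lemma def_bin_len f : def f -> def (fun w e => up_log 2 (f w e).+1).
Proof.
move=> Hf; have H : def (fun w e => count (fun i => minn (2 ^ i - 1) (f w e) < f w e)
  (iota 0 (f w e))).
  apply: (def_count (P := fun w e i => minn (2 ^ i - 1) (f w e) < f w e)) => //.
  apply: defb_leq; last exact: def_shift (fun=> erefl).
  by apply/def_succ/def_pow2; [apply: def_var0|apply: def_shift (fun=> erefl)].
by apply: def_ext H => w e; rewrite up_log_count; apply: eq_count => i /=; rewrite pow2_le.
Qed.

Lemma bin_code_bit k i : i < up_log 2 k.+1 ->
  nth false (bin_code k) i = odd (k %/ (minn (2 ^ i - 1) k).+1).
Proof.
move=> il; rewrite nth_mkseq //; congr (odd (k %/ _)).
have : 2 ^ i <= k by rewrite up_log_gt.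
have : 0 < 2 ^ i by rewrite expn_gt0. lia.
Qed.

(** * Definable strings *)

Definition sdef (s : inp -> seq bool) : Prop :=
  exists (n : inp -> nat) (b : inp -> nat -> bool),
    [/\ def (fun w e => n w), defb (fun w e => b w (nth 0 e 0))
      & forall w, s w = mkseq (b w) (n w)].

Lemma sdef_ext s s' : (forall w, s w = s' w) -> sdef s -> sdef s'.
Proof. by move=> E [n [b [H1 H2 H3]]]; exists n, b; split=> // w; rewrite -E. Qed.

Lemma sdef_mk n (b : inp -> nat -> bool) : def (fun w e => n w) ->
  defb (fun w e => b w (nth 0 e 0)) -> sdef (fun w => mkseq (b w) (n w)).
Proof. by move=> H1 H2; exists n, b. Qed.

Lemma def_arg (b : inp -> nat -> nat) f : def (fun w e => b w (nth 0 e 0)) -> def f ->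
  def (fun w e => b w (f w e)).
Proof.
move=> [e He] [ef Hf].
exists (subst (fun i => if i is i'.+1 then Var i' else ef) e) => w env; rewrite -Hf.
have /= <- := He w (eval w.1 w.2 env ef :: env).
by apply: eval_subst => -[|i].
Qed.

Lemma mkseq_cat (f g : nat -> bool) a b :
  mkseq f a ++ mkseq g b = mkseq (fun i => if i < a then f i else g (i - a)) (a + b).
Proof.
apply: (@eq_from_nth _ false) => [|i]; rewrite !(size_cat, size_mkseq) // => ilt.
rewrite nth_cat size_mkseq [RHS]nth_mkseq //; case: ltnP => ia; rewrite nth_mkseq //.
by lia.
Qed.

Lemma sdef_cat s t : sdef s -> sdef t -> sdef (fun w => s w ++ t w).
Proof.
move=> [n [b [H1 H2 H3]]] [n' [b' [H1' H2' H3']]].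
exists (fun w => n w + n' w), (fun w i => if i < n w then b w i else b' w (i - n w)).
split; last by move=> w; rewrite H3 H3' mkseq_cat.
  exact: def_add.
apply: defb_if => //; first by apply: defb_leq => //; apply/def_succ/def_var0.
by apply: (def_arg (b := fun w i => nat_of_bool (b' w i))) => //; apply: def_sub => //; apply: def_var0.
Qed.

Lemma sdef_nseq n b : def (fun w e => n w) -> sdef (fun w => nseq (n w) b).
Proof.
move=> Hn; exists n, (fun=> fun=> b); split=> // [|w]; first exact: defb_cst.
by apply: (@eq_from_nth _ b) => [|i]; rewrite size_nseq ?size_mkseq // => H;
  rewrite nth_nseq nth_mkseq H.
Qed.

Lemma sdef_bin k : def (fun w e => k w) -> sdef (fun w => bin_code (k w)).
Proof.
move=> Hk; exists (fun w => up_log 2 (k w).+1),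
  (fun w i => odd (k w %/ (minn (2 ^ i - 1) (k w)).+1)).
split; first exact: def_bin_len.
  by apply/defb_odd/def_div => //; apply/def_succ/def_pow2 => //; apply: def_var0.
move=> w; apply: (@eq_from_nth _ false) => [|i]; rewrite !size_mkseq // => il.
by rewrite bin_code_bit // nth_mkseq.
Qed.

(** Running this machine in the middle turns [run_polytime] into the case of a single formula. *)
Definition halting_machine : machine :=
  @Machine unit void 0 tt predT (fun q h => (q, fun i => (h i, MoveN))).

Lemma halting_computes t : computes_in halting_machine [::] [::] t.
Proof. by split => //; rewrite step_halted. Qed.

Lemma sdef_exprs s : sdef s -> exists e1 e2, forall w z,
  s (w, z) = mkseq (fun i => 0 < eval w z [:: i] e2) (eval w z [::] e1).
Proof.
move=> [n [b [[e1 H1] [e2 H2] H3]]]; exists e1, e2 => w z; rewrite H3.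
rewrite (H1 (w, z) [::]) /=; apply/eq_mkseq => i.
by rewrite (H2 (w, z) [:: i]) /=; case: (b _ _).
Qed.

Lemma run_polytime (A B : Type) (encA : A -> seq bool) (encB : B -> seq bool)
    (f : A -> B) (M : machine) (s1 s2 : inp -> seq bool) (pt ps : nat -> nat) :
  polyb pt -> polyb ps -> sdef s1 -> sdef s2 ->
  (forall a, let w := encA a in exists z,
    [/\ computes_in M (s1 (w, [::])) z (pt (size w)),
        size z <= ps (size w) & encB (f a) = s2 (w, z)]) ->
  polytime encA encB f.
Proof.
move=> Hpt Hps /sdef_exprs [e1 [e2 H1]] /sdef_exprs [e3 [e4 H2]] H.
apply: (@gen_run_polytime _ _ _ _ _ M e1 e2 e3 e4 _ _ Hpt Hps) => a /=.
by have [z [? ? ?]] := H a; exists z; split; rewrite -?H1 -?H2.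
Qed.

Lemma sdef_polytime (A B : Type) (encA : A -> seq bool) (encB : B -> seq bool)
    (f : A -> B) (s : inp -> seq bool) : sdef s ->
  (forall a, encB (f a) = s (encA a, [::])) -> polytime encA encB f.
Proof.
move=> Hs H; have H0 : sdef (fun=> [::]) by apply: sdef_ext (sdef_nseq true (def_cst 0)) => w.
apply: (run_polytime (polyb_cst 0) (polyb_cst 0) H0 Hs) => a /=.
by exists [::]; split => //; apply: (halting_computes 0).
Qed.


(** Search over the closure rules; facts in the context about auxiliary functions serve as further
    rules. *)
Ltac dsolve := lazymatch goal with
  | |- def _ => first
    [ eassumption
    | apply: def_cst | apply: def_var0 | apply: def_len1 | apply: def_len2
    | (apply: def_var; move=> ?; rewrite ?drop_drop; reflexivity)
    | (apply: def_shift; [eassumption | move=> ?; rewrite ?drop_drop; reflexivity])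
    | (apply: def_nat; dsolve) | (apply: def_succ; dsolve)
    | (apply: def_add; dsolve) | (apply: def_sub; dsolve) | (apply: def_mul; dsolve)
    | (apply: def_div; dsolve) | (apply: def_mod; dsolve) | (apply: def_min; dsolve)
    | (apply: def_pb; dsolve) | (apply: def_if; dsolve)
    | (apply: def_double; dsolve) | (apply: def_pred; dsolve)
    | (apply: def_count; [dsolve|cbv beta; dsolve])
    | (apply: def_find; [dsolve|cbv beta; dsolve])
    | match goal with H : _ |- _ => solve [apply: H; dsolve] end ]
  | |- defb _ => first
    [ eassumption | apply: defb_cst
    | (apply: defb_shift; [eassumption | move=> ?; rewrite ?drop_drop; reflexivity])
    | (apply: defb_not; dsolve) | (apply: defb_and; dsolve) | (apply: defb_or; dsolve)
    | (apply: defb_impl; dsolve) | (apply: defb_if; dsolve)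
    | (apply: defb_leq; dsolve) | (apply: defb_eq; dsolve) | (apply: defb_eqb; dsolve)
    | (apply: defb_odd; dsolve) | (apply: def_bit1; dsolve) | (apply: def_bit2; dsolve)
    | (apply: defb_has; [dsolve|cbv beta; dsolve])
    | (apply: defb_all; [dsolve|cbv beta; dsolve])
    | match goal with H : _ |- _ => solve [apply: H; dsolve] end ]
  | |- forall _, _ => intro; dsolve
  end.

(** * Identifications and quotients *)

(** Fibres are arbitrary nonempty sets, connected or not: identification, unlike contraction, asks
    for no edge. *)
Definition qmap (G G' : graph) (f : G -> G') : Prop :=
  (forall x, exists u, f u = x) /\
  (forall x y, adj x y <-> x <> y /\ exists u v, [/\ f u = x, f v = y & adj u v]).

Lemma adj_neq (G : graph) (x y : G) : adj x y -> x <> y.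
Proof. by move=> H E; rewrite E adj_irr in H. Qed.

Lemma qmap_id (G : graph) : @qmap G G id.
Proof.
split=> [x|x y]; first by exists x.
split=> [H|[_ [u [v [<- <-]]]]] //; split; first exact: adj_neq.
by exists x, y.
Qed.

Lemma qmap_comp (G1 G2 G3 : graph) (f : G1 -> G2) (g : G2 -> G3) :
  qmap f -> qmap g -> qmap (g \o f).
Proof.
move=> [sf af] [sg ag]; split=> [z|z z'].
  by have [x <-] := sg z; have [u <-] := sf x; exists u.
split=> [/ag [nz [x [y [Ex Ey /af [_ [u [v [Eu Ev uv]]]]]]]]|].
  by split=> //; exists u, v; rewrite /= Eu Ev.
move=> [nz [u [v [/= Eu Ev uv]]]]; apply/ag; split=> //; exists (f u), (f v); split=> //.
apply/af; split; last by exists u, v.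
by move=> E; apply: nz; rewrite -Eu -Ev E.
Qed.

Section Identify.
Variables (G : graph) (u v : G).
Hypothesis uv : u != v.

Definition to_identify (w : G) : identify u v := insub w.

Lemma to_identify_some (w : G) (Hw : (w != u) && (w != v)) :
  to_identify w = Some (exist _ w Hw).
Proof. by rewrite /to_identify insubT. Qed.

Lemma to_identify_none (w : G) : (to_identify w = None) <-> (w = u \/ w = v).
Proof.
rewrite /to_identify; case: insubP => [s H E|].
  split=> // -[]E'; move: H; rewrite E' eqxx ?andbF //.
by rewrite negb_and !negbK => /orP [] /eqP ->; split=> // _; [left|right].
Qed.

Lemma to_identifyP (w : G) (a : {w : G | (w != u) && (w != v)}) :
  to_identify w = Some a <-> w = val a.
Proof.
split; last by case: a => x Hx /= ->; rewrite to_identify_some.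
by rewrite /to_identify; case: insubP => // s _ <- [->].
Qed.

Lemma qmap_identify : qmap to_identify.
Proof.
split=> [[a|]|].
- by exists (val a); apply/to_identifyP.
- by exists u; apply/to_identify_none; left.
move=> [a|] [b|] /=; split=> //.
- move=> H; split; first by move=> [E]; rewrite E adj_irr in H.
  by exists (val a), (val b); split=> //; apply/to_identifyP.
- by move=> [_ [x [y [/to_identifyP -> /to_identifyP ->]]]].
- move=> /orP [] H; split=> //; [exists (val a), u|exists (val a), v]; split=> //;
    by [apply/to_identifyP|apply/to_identify_none; auto|rewrite adj_sym].
- move=> [_ [x [y [/to_identifyP -> /to_identify_none [] ->]]]]; rewrite adj_sym => -> //.
  by rewrite orbT.
- move=> /orP [] H; split=> //; [exists u, (val b)|exists v, (val b)]; split=> //;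
    by [apply/to_identifyP|apply/to_identify_none; auto].
- move=> [_ [x [y [/to_identify_none [] -> /to_identifyP -> ->]]]] //.
  by rewrite orbT.
by case.
Qed.

Lemma card_identify : #|G| = #|identify u v|.+1.
Proof.
rewrite card_option card_sig -(cardsC [set u; v]) cards2 uv /= add2n; congr _.+2.
by apply: eq_card => w; rewrite !inE negb_or.
Qed.
End Identify.

Definition iso_invariant (H : graph_class) := forall (G G' : graph) (f : G -> G'),
  bijective f -> (forall x y, adj (f x) (f y) = adj x y) -> H G -> H G'.

(** Each identification is a quotient map that loses one vertex. Conversely, a quotient map that is
    not injective factors through the identification of two vertices with equal images, and an
    injective one is an isomorphism, which is where invariance enters. *)
Theorem Identification_qmap H (G : graph) k : iso_invariant H ->
  Identification H (G, k) <->
  exists (G' : graph) (f : G -> G'), [/\ qmap f, #|G| <= #|G'| + k & H G'].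
Proof.
move=> Hinv; split.
  move=> [j [G' [jk Hj HG']]]; exists G'.
  suff [f Hf le] : exists2 f : G -> G', qmap f & #|G| <= #|G'| + j.
    by exists f; split=> //; lia.
  elim: Hj => {jk j HG' k} [G0|j G1 G2 u v uv _ [f Hf le]]; first by exists id; [apply: qmap_id|lia].
  exists (f \o @to_identify G1 u v); first by apply: qmap_comp Hf; apply: qmap_identify.
  by rewrite (card_identify uv); lia.
move=> [G' [f [Hf le HG']]].
have inj_case (G0 : graph) (g : G0 -> G') : qmap g -> injective g -> forall n, Identification H (G0, n).
  move=> [sg ag] ig n; exists 0, G0; split=> //; first exact: Identifications0.
  have cg : forall x, exists u, g u == x by move=> x; have [u <-] := sg x; exists u.
  pose h x := xchoose (cg x).
  have hK : cancel h g by move=> x; apply/eqP/(xchooseP (cg x)).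
  have gK : cancel g h by move=> x; apply: ig; rewrite hK.
  apply: (Hinv _ _ h) HG'; first by exists g.
  move=> x y; apply/idP/idP => [xy|/ag [_ [u [v [<- <-]]]]]; last by rewrite !gK.
  apply/ag; split; last by exists (h x), (h y); rewrite !hK.
  by move=> E; rewrite E adj_irr in xy.
elim: k G f Hf le => [|k IH] G f Hf le.
  apply: (inj_case _ _ Hf).
  have sf : f @: G = [set: G'].
    by apply/setP => x; rewrite inE; have [u <-] := Hf.1 x; apply: imset_f.
  have : #|f @: G| == #|G| by rewrite eqn_leq leq_imset_card sf cardsT; lia.
  by move=> /imset_injP ii x y; apply: ii.
have [/injectiveP ij|/injectivePn [u [v uv Euv]]] := boolP (injectiveb f).
  exact: (inj_case _ _ Hf ij).
pose f1 (x : identify u v) := if x is Some a then f (val a) else f u.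
have E1 w : f1 (to_identify u v w) = f w.
  case E: (to_identify u v w) => [a|]; first by move/to_identifyP: E => ->.
  by move/to_identify_none: E => -[] ->.
have [sq aq] := qmap_identify u v.
have Hf1 : qmap f1.
  split=> [x|x y]; first by have [w <-] := Hf.1 x; exists (to_identify u v w).
  split.
    move=> /(Hf.2 x y) [nxy [a [b [Ea Eb ab]]]]; split=> //.
    exists (to_identify u v a), (to_identify u v b); split; rewrite ?E1 //.
    apply/aq; split; last by exists a, b.
    by move/(congr1 f1); rewrite !E1 Ea Eb.
  move=> [nxy [a [b [Ea Eb /aq [_ [a' [b' [Ea' Eb' ab]]]]]]]].
  apply/(Hf.2 x y); split=> //; exists a', b'; split=> //.
    by rewrite -Ea -Ea' E1.
  by rewrite -Eb -Eb' E1.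
have [|j [G2 [jk Hj HG2]]] := IH _ f1 Hf1; first by have := card_identify uv; lia.
by exists j.+1, G2; split=> //; apply: IdentificationsS Hj.
Qed.

Section Quotient.
Variables (G : graph) (T : finType) (f : G -> T).
Definition quot_adj : rel {t : T | t \in codom f} := fun x y =>
  (x != y) && [exists u, exists v, [&& f u == val x, f v == val y & adj u v]].
Lemma quot_sym : symmetric quot_adj.
Proof.
move=> x y; rewrite /quot_adj eq_sym; congr (_ && _).
apply/existsP/existsP => -[u /existsP [v /and3P [H1 H2 H3]]]; exists v;
  by apply/existsP; exists u; rewrite H1 H2 adj_sym.
Qed.
Lemma quot_irr : irreflexive quot_adj.
Proof. by move=> x; rewrite /quot_adj eqxx. Qed.
Definition quot : graph := Graph quot_sym quot_irr.
Definition to_quot (u : G) : quot := exist _ (f u) (codom_f f u).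

Lemma quot_adjP (x y : quot) : adj x y <-> val x <> val y /\
  exists u v, [/\ f u = val x, f v = val y & adj u v].
Proof.
split=> [/andP [nxy /existsP [u /existsP [v /and3P [/eqP H1 /eqP H2 H3]]]]|[nxy [u [v [H1 H2 H3]]]]].
  by split; [move/val_inj => E; rewrite E eqxx in nxy|exists u, v].
apply/andP; split; first by apply/eqP => E; apply: nxy; rewrite E.
by apply/existsP; exists u; apply/existsP; exists v; rewrite H1 H2 !eqxx.
Qed.

Lemma qmap_quot : qmap to_quot.
Proof.
split=> [[t Ht]|x y].
  by case/codomP: (Ht) => u Eu; exists u; apply: val_inj.
split=> [/quot_adjP [nxy [u [v [H1 H2 H3]]]]|[nxy [u [v [H1 H2 H3]]]]].
  split; first by move=> E; apply: nxy; rewrite E.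
  by exists u, v; split=> //; apply: val_inj.
by apply/quot_adjP; split; [move/val_inj|exists u, v; rewrite -H1 -H2].
Qed.

Lemma card_quot : #|quot| = #|codom f|.
Proof. by rewrite /= card_sig; apply: eq_card => t. Qed.
End Quotient.

(** * The three graph classes *)

Definition c4 (G : graph) (a b c d : G) :=
  [/\ a <> c, b <> d, [&& adj a b, adj b c, adj c d & adj d a], ~~ adj a c & ~~ adj b d].

(** A clique joined completely to an independent set, also known as a complete split graph. *)
Definition threshold (G : graph) (K : pred G) :=
  (forall x y, K x -> x <> y -> adj x y) /\ (forall x y, ~~ K x -> ~~ K y -> ~~ adj x y).

(** What the reduction uses of a class: it lies between the complete split graphs and the graphs
    without induced 4-cycle. One instance therefore has the same answer for all three classes. *)
Record tame (H : graph_class) : Prop := Tame {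
  tame_inv : iso_invariant H;
  tame_c4 : forall (G : graph) (a b c d : G), H G -> ~ c4 a b c d;
  tame_threshold : forall (G : graph) (K : pred G), threshold K -> H G
}.

Lemma tame_split : tame split_graph.
Proof.
split.
- move=> G G' f [g fK gK] Hf [K [H1 H2]]; exists (g @^-1: K).
  by split=> x y; rewrite !inE => Kx Ky; rewrite -(gK x) -(gK y) Hf ?(inj_eq (can_inj fK));
    [apply: H1|apply: H2; rewrite inE].
- move=> G a b c d [K [H1 H2]] [ac bd /and4P [ab bc cd da] nac nbd].
  have N x y : x <> y -> ~~ adj x y -> x \notin K \/ y \notin K.
    move=> nxy xy; case: (boolP (x \in K)) => xK; last by left.
    by right; apply: contra xy => yK; apply: H1 => //; apply/eqP.
  have C x y : adj x y -> x \notin K -> y \notin K -> False.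
    by move=> xy xK yK; have := H2 x y; rewrite !inE xy => /(_ xK yK).
  (* Each diagonal has an end outside [K], and ends of different diagonals are adjacent. *)
  have [Ka|Kc] := N _ _ ac nac; have [Kb|Kd] := N _ _ bd nbd.
  + exact: C ab _ _.
  + exact: C da _ _.
  + exact: C bc _ _.
  exact: C cd _ _.
move=> G K [H1 H2]; exists [set x | K x]; split=> x y; rewrite !inE => Kx Ky.
  by move=> /eqP; apply: H1.
exact: H2.
Qed.

Lemma tame_chordal : tame chordal_graph.
Proof.
split.
- move=> G G' f [g fK gK] Hf H n h n4 [ih ah]; apply: (H n (g \o h) n4); split.
    by apply: inj_comp ih; apply: can_inj gK.
  by move=> i j; rewrite -ah -Hf /= !gK.
- move=> G a b c d H [ac bd /and4P [ab bc cd da] nac nbd].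
  pose f (i : 'I_4) := nth a [:: a; b; c; d] i.
  apply: (H 4 f erefl); split.
    have := adj_neq ab; have := adj_neq bc; have := adj_neq cd; have := adj_neq da.
    move=> n1 n2 n3 n4 [[|[|[|[|i]]]] Hi] [[|[|[|[|j]]]] Hj] //=; rewrite /f /= => E;
      try (by apply: val_inj); exfalso; congruence.
  have s (x y : G) : adj x y -> adj y x by rewrite adj_sym.
  have ns (x y : G) : ~~ adj x y -> adj y x = false by rewrite adj_sym => /negbTE.
  have [ba cb dc ad] := And4 (s _ _ ab) (s _ _ bc) (s _ _ cd) (s _ _ da).
  have [ca db] := conj (ns _ _ nac) (ns _ _ nbd).
  move=> [[|[|[|[|i]]]] Hi] [[|[|[|[|j]]]] Hj] //; rewrite /f /=;
    by rewrite ?adj_irr ?ab ?bc ?cd ?da ?ba ?cb ?dc ?ad ?ca ?db ?(negbTE nac) ?(negbTE nbd).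
move=> G K [H1 H2] n f n4 [ih ah].
have lt i : i < 4 -> i < n by move=> i4; apply: leq_trans n4.
pose o i (i4 : i < 4) : 'I_n := Ordinal (lt i i4).
pose a := o 0 isT; pose b := o 1 isT; pose c := o 2 isT; pose d := o 3 isT.
have N x y : x != y :> 'I_n -> ~~ adj (f x) (f y) -> ~~ K (f x) /\ ~~ K (f y).
  move=> nxy xy; have nf : f x <> f y by move/ih => E; rewrite E eqxx in nxy.
  split; apply: contra xy => Kf; first exact: H1.
  by rewrite adj_sym; apply: H1 => //; apply: nesym.
have ab : adj (f a) (f b).
  by rewrite ah -!val_eqE /= (@modn_small 1 n) //; lia.
have nac : ~~ adj (f a) (f c).
  by rewrite ah -!val_eqE /= !modn_small; lia.
have nbd : ~~ adj (f b) (f d).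
  rewrite ah -!val_eqE /= modn_small; last lia.
  case: (eqVneq n 4) => [->|?] //.
  by rewrite modn_small //; lia.
have [Ka _] : ~~ K (f a) /\ ~~ K (f c) by apply: N.
have [Kb _] : ~~ K (f b) /\ ~~ K (f d) by apply: N.
by have := H2 _ _ Ka Kb; rewrite ab.
Qed.

Section Interval.
Import Order.TTheory GRing.Theory Num.Theory.
Local Open Scope ring_scope.
Variable R : realType.

Lemma itv_convex (I : interval R) (x y z : R) : x \in I -> z \in I -> x <= y <= z -> y \in I.
Proof.
case: I => l u; rewrite !itv_boundlr => /andP [lx _] /andP [_ zu] /andP [xy yz].
apply/andP; split; first by apply: le_trans lx _.
by apply: le_trans zu.
Qed.

Lemma tame_interval : tame (interval_graph R).
Proof.
split.
- move=> G G' f [g fK gK] Hf [I [H1 H2]]; exists (I \o g); split=> [x|x y nxy] /=.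
    exact: H1.
  rewrite -{1}(gK x) -{1}(gK y) Hf; apply: H2.
  by apply: contra nxy => /eqP /(can_inj gK) ->.
- move=> G a b c d [I [H1 H2]] [/eqP ac /eqP bd /and4P [ab bc cd da] nac nbd].
  have M x y : adj x y -> exists z : R, z \in I x /\ z \in I y.
    move=> xy; have /eqP nxy := adj_neq xy.
    by have [/(_ xy) [z /andP [? ?]] _] := H2 x y nxy; exists z.
  have D x y : x != y -> ~~ adj x y -> forall z : R, z \in I x -> z \in I y -> False.
    move=> nxy /negP xy z zx zy; apply: xy; apply/(H2 x y nxy).
    by exists z; rewrite zx zy.
  have sep x y (s s' t t' : R) : x != y -> ~~ adj x y -> s \in I x -> s' \in I x ->
    t \in I y -> t' \in I y -> s < t -> s' < t'.
    move=> nxy xy sx s'x ty t'y st; rewrite ltNge; apply/negP => ts.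
    case: (leP s t') => c1.
      by apply: (D x y nxy xy t') => //; apply: itv_convex sx s'x _; rewrite c1 ts.
    by apply: (D x y nxy xy s) => //; apply: itv_convex t'y ty _; rewrite !ltW.
  (* From [p < q] the interval of [x] lies wholly to the left of that of [y], so [p] and [s] precede
     [q] and [r]. The larger of [p] and [s] then belongs to both [b] and [d], which are disjoint. *)
  have key (x y : G) (p q r s : R) : x != y -> ~~ adj x y -> p \in I x -> s \in I x ->
    q \in I y -> r \in I y -> p \in I b -> q \in I b -> r \in I d -> s \in I d -> p < q -> False.
    move=> nxy xy px sx qy ry pb' qb' rd' sd' pq.
    have sr := sep x y p s q r nxy xy px sx qy ry pq.
    have sq := sep x y p s q q nxy xy px sx qy qy pq.
    have pr := sep x y p p q r nxy xy px px qy ry pq.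
    case: (leP p s) => ps.
      apply: (D b d bd nbd s) => //; apply: itv_convex pb' qb' _.
      by rewrite ps ltW.
    apply: (D b d bd nbd p) => //; apply: itv_convex sd' rd' _.
    by rewrite !ltW.
  have [p [pa pb]] := M _ _ ab; have [q [qb qc]] := M _ _ bc.
  have [r [rc rd]] := M _ _ cd; have [s [sd sa]] := M _ _ da.
  case: (ltgtP p q) => pq.
  + exact: (key a c p q r s).
  + by apply: (key c a q p s r) => //; rewrite 1?eq_sym // adj_sym.
  by apply: (D a c ac nac p) => //; rewrite pq.
move=> G K [H1 H2].
exists (fun x => if K x then `]-oo, +oo[ else `[(enum_rank x)%:R, (enum_rank x)%:R])%R.
split=> [x|x y nxy].
  by exists ((enum_rank x)%:R); case: ifP; rewrite !in_itv /= ?lexx.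
split=> [xy|[z]].
  case: (boolP (K x)) => Kx; last first.
    case: (boolP (K y)) => Ky; last by have := H2 _ _ Kx Ky; rewrite xy.
    by exists ((enum_rank x)%:R); rewrite !in_itv /= !lexx.
  by exists ((enum_rank y)%:R); case: ifP; rewrite !in_itv /= ?lexx.
have ne : x <> y by apply/eqP.
case: (boolP (K x)) => Kx; first by move=> _; apply: H1.
case: (boolP (K y)) => Ky; first by move=> _; rewrite adj_sym; apply: H1 => //; apply: nesym.
rewrite !in_itv /= => /andP [/andP [a1 a2] /andP [a3 a4]].
have : (enum_rank x)%:R = (enum_rank y)%:R :> R.
  by apply/eqP; rewrite eq_le !(le_trans a1 a4, le_trans a3 a2).
by move/eqP; rewrite eqr_nat => /eqP /val_inj /enum_rank_inj.
Qed.
End Interval.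

(** * Instance codes *)

Definition bin_val (s : seq bool) : nat := foldr (fun (b : bool) a => b + a.*2) 0 s.

Lemma bin_code0 : bin_code 0 = [::].
Proof. by rewrite /bin_code up_log1. Qed.

Lemma bin_codeS k : 0 < k -> bin_code k = odd k :: bin_code k./2.
Proof.
move=> k0; rewrite /bin_code up_log2S // /mkseq /= divn1; congr (_ :: _).
rewrite (iotaDl 1 0) -map_comp; apply: eq_map => i /=.
by rewrite expnS divnMA divn2.
Qed.

Lemma bin_valK k : bin_val (bin_code k) = k.
Proof.
elim/ltn_ind: k => -[|k] IH; first by rewrite bin_code0.
rewrite bin_codeS // -[LHS]/(odd k.+1 + (bin_val (bin_code k.+1./2)).*2) IH.
  exact: odd_double_half.
by rewrite ltn_half_double -addnn; lia.
Qed.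

Lemma bin_code_last k : 0 < k -> last false (bin_code k).
Proof.
elim/ltn_ind: k => k IH k0; rewrite bin_codeS //=.
case: (posnP k./2) => [E|k2]; last first.
  have lt : k./2 < k by rewrite ltn_half_double -addnn; lia.
  by have := IH k./2 lt k2; case: (bin_code k./2).
by rewrite E bin_code0 /=; case: k k0 E {IH} => [|[|k]].
Qed.

(** The least significant bit comes first, so a last bit [true] rules out idle zeros in front of the
    number. *)
Lemma bin_codeK s : (s == [::]) || last false s -> bin_code (bin_val s) = s.
Proof.
elim: s => [|b s IH]; first by rewrite bin_code0.
rewrite orFb [last _ _]/=; case: s IH => [|b' s] IH; first by case: b => //= _; rewrite bin_codeS //= bin_code0.
move=> L; have {}IH : bin_code (bin_val (b' :: s)) = b' :: s by exact: IH L.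
have p : 0 < bin_val (b' :: s).
  by rewrite lt0n; apply/eqP => E; move: IH; rewrite E bin_code0.
rewrite -[bin_val [:: b, b' & s]]/(b + (bin_val (b' :: s)).*2).
move: (bin_val _) p IH => t p IH; rewrite bin_codeS; last by lia.
rewrite oddD odd_double addbF half_bit_double.
by rewrite IH; case: (b).
Qed.

Lemma allpairs_mkseq (T : Type) (x0 : T) (s t : seq T) (f : T -> T -> bool) :
  [seq f u v | u <- s, v <- t] =
  mkseq (fun i => f (nth x0 s (i %/ size t)) (nth x0 t (i %% size t))) (size s * size t).
Proof.
elim: s => //= u s ->.
have -> : [seq f u y | y <- t] = mkseq (fun i => f u (nth x0 t i)) (size t).
  apply: (@eq_from_nth _ false) => [|i]; first by rewrite size_mkseq size_map.
  rewrite size_map => il.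
  by rewrite (nth_map x0) // nth_mkseq.
rewrite mkseq_cat mulSn /mkseq; apply/eq_in_map => i; rewrite mem_iota add0n /= => il.
case: ltnP => it; first by rewrite divn_small // modn_small.
have t0 : 0 < size t by case: (size t) il it => //; rewrite muln0.
have E : i = (i - size t) + size t by lia.
by rewrite [in RHS]E modnDr divnDr ?divnn ?t0 ?addn1.
Qed.

Lemma code_split (n n' : nat) (s s' : seq bool) :
  nseq n true ++ false :: s = nseq n' true ++ false :: s' -> n = n' /\ s = s'.
Proof. by elim: n n' => [|n IH] [|n'] //= [] // /IH [-> ->]. Qed.

Lemma instance_code_inj (G G' : graph) k k' :
  instance_code (G, k) = instance_code (G', k') ->
  k = k' /\ exists f : G -> G', bijective f /\ forall x y, adj (f x) (f y) = adj x y.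
Proof.
move=> /code_split [En]; move/eqP; rewrite eqseq_cat; last by rewrite !size_allpairs -!cardE En.
case/andP => /eqP EA /eqP /(congr1 bin_val); rewrite !bin_valK => Ek; split=> //.
pose f (u : G) : G' := enum_val (cast_ord En (enum_rank u)).
exists f; split.
  exists (fun u => enum_val (cast_ord (esym En) (enum_rank u))) => u;
    by rewrite /f enum_valK cast_ordKV ?cast_ordK enum_rankK || rewrite /f enum_valK cast_ordK enum_rankK.
move=> x y; move: EA; rewrite (allpairs_mkseq x) (allpairs_mkseq (f x)) -!cardE -En.
move/(congr1 (fun s => nth false s (enum_rank x * #|G| + enum_rank y))).
have lx : enum_rank x < #|G| := ltn_ord _; have ly : enum_rank y < #|G| := ltn_ord _.
have lxy : enum_rank x * #|G| + enum_rank y < #|G| * #|G| by nia.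
have G0 : 0 < #|G| by lia.
rewrite !nth_mkseq // divnMDl // modnMDl divn_small // modn_small // addn0.
have Ef z : f z = nth (f x) (enum G') (enum_rank z) by rewrite {1}/f (enum_val_nth (f x)).
by move=> E; rewrite (Ef y) [X in adj X _]Ef -E !nth_enum_rank.
Qed.

(** A code determines its graph only up to isomorphism, so the answer can be read off the code when
    the class is invariant. *)
Lemma language_of_code H (x : instance) : iso_invariant H ->
  language_of (Identification H) (instance_code x) <-> Identification H x.
Proof.
move=> Hi; split=> [[[G' k'] [E HQ]]|HQ]; last by exists x.
case: x E => G k /instance_code_inj [-> [f [bf af]]].
move: HQ => /(Identification_qmap _ _ Hi) [G2 [g [Hg le HG2]]].
apply/(Identification_qmap _ _ Hi); exists G2, (g \o f); split=> //.
  case: bf => h fK hK; apply: qmap_comp Hg; split=> [x|x y]; first by exists (h x).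
  split=> [xy|[_ [u [v [<- <-]]]]]; last by rewrite af.
  by split; [apply: adj_neq|exists (h x), (h y); rewrite !hK -af !hK].
by rewrite (bij_eq_card bf).
Qed.

Lemma Identification_code H (x y : instance) : iso_invariant H ->
  instance_code x = instance_code y -> Identification H x <-> Identification H y.
Proof.
by move=> Hi E; rewrite -(language_of_code x Hi) -(language_of_code y Hi) E.
Qed.

(** * Graphs on an initial segment of the integers *)

Section OrdinalGraph.
Variables (N : nat) (A : nat -> nat -> bool).
Definition oadj (u v : nat) := (u != v) && (A u v || A v u).
Lemma oadj_sym : symmetric (fun u v : 'I_N => oadj u v).
Proof. by move=> u v; rewrite /oadj eq_sym orbC. Qed.
Lemma oadj_irr : irreflexive (fun u v : 'I_N => oadj u v).
Proof. by move=> u; rewrite /oadj eqxx. Qed.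
Definition ograph : graph := Graph oadj_sym oadj_irr.

Lemma ograph_code k : instance_code (ograph, k) =
  nseq N true ++ false :: mkseq (fun i => oadj (i %/ N) (i %% N)) (N * N) ++ bin_code k.
Proof.
rewrite /instance_code /= card_ord; congr (_ ++ _ :: _ ++ _).
case: (posnP N) => [N0|N0].
  have E : enum 'I_N = [::] by apply/size0nil; rewrite size_enum_ord.
  by rewrite E /= N0.
rewrite (allpairs_mkseq (Ordinal N0)) size_enum_ord /mkseq; apply/eq_in_map => i.
rewrite mem_iota add0n /= => il.
by rewrite !nth_enum_ord ?ltn_pmod // ltn_divLR.
Qed.
End OrdinalGraph.

(** * From set splitting to identification *)

(* Vertices below [m + 2] are the ground set, the next [C] are the hyperedges,
   and the last [2m + 2] force the image of the others to be a clique.  The two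
   special ground elements [m] and [m + 1] are the only adjacent ones. *)
Section Splitting.
Variables (m C : nat) (mem : nat -> nat -> bool).
Let U := m.+2.
Let X := m.+2 + C.
Definition sg_size := m.+2 + C + (m.+1).*2.
Definition sg_rel (u v : nat) :=
  [|| (u == m) && (v == m.+1), (u < U) && (U <= v < X) && mem (v - U) u,
      (U <= u < X) && (U <= v < X) | (u < X) && (X <= v)].
Definition sg_graph := ograph sg_size sg_rel.

Definition splits (a : nat -> bool) :=
  [/\ a m, ~~ a m.+1 & forall c, c < C ->
    (exists v, [/\ v < U, mem c v & a v]) /\ (exists v, [/\ v < U, mem c v & ~~ a v])].

Lemma sg_adj (u v : sg_graph) : adj u v = oadj sg_rel u v.
Proof. by []. Qed.

Lemma sg_special : oadj sg_rel m m.+1.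
Proof. by rewrite /oadj /sg_rel !eqxx /=; lia. Qed.

Lemma sg_member v c : v < U -> c < C -> oadj sg_rel v (U + c) = mem c v.
Proof.
by rewrite /oadj /sg_rel => vU cC; rewrite addKn; case: (mem c v); rewrite /X /U in vU *; lia.
Qed.

Lemma sg_clauses i j : i < j -> U <= i -> j < X -> oadj sg_rel i j.
Proof. by rewrite /oadj /sg_rel => *; apply/andP; split; lia. Qed.

Lemma sg_far i j : i < X -> X <= j -> oadj sg_rel i j.
Proof. by move=> iX Xj; rewrite /oadj /sg_rel iX Xj !orbT andbT; lia. Qed.

Lemma sg_indep i j : X <= i -> X <= j -> ~~ oadj sg_rel i j.
Proof. by rewrite /oadj /sg_rel /X /U => *; lia. Qed.

Lemma sg_ground i j : i < U -> j < U -> oadj sg_rel i j ->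
  (i = m /\ j = m.+1) \/ (i = m.+1 /\ j = m).
Proof. by rewrite /oadj /sg_rel /X /U => *; lia. Qed.

Variable (H : graph_class).
Hypothesis tH : tame H.

Lemma splits_identification a : splits a -> Identification H (sg_graph, m).
Proof.
move=> [am am1 Hc]; apply/(Identification_qmap _ _ (tame_inv tH)).
have mN : m < sg_size by rewrite /sg_size; lia.
have m1N : m.+1 < sg_size by rewrite /sg_size; lia.
(* Each side of the splitting collapses to its special element. Everything from [m] on stays fixed,
   so at most [m] vertices are lost. *)
pose f (v : sg_graph) : 'I_sg_size :=
  if v < U then (if a v then Ordinal mN else Ordinal m1N) else v.
have fid v : m <= nat_of_ord v -> f v = v.
  move=> mv; rewrite /f /U; case: ltnP => // vU; apply: val_inj.
  have [Ev|Ev] : nat_of_ord v = m \/ nat_of_ord v = m.+1 by lia.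
    by rewrite [a v](_ : _ = true) //= Ev.
  by rewrite [a v](_ : _ = false) //= Ev //; apply/negbTE.
exists (quot f), (to_quot f); split; first exact: qmap_quot.
  rewrite card_quot card_ord.
  have : #|[set v : 'I_sg_size | m <= v]| <= #|codom f|.
    apply: subset_leq_card; apply/subsetP => v; rewrite inE => mv.
    by rewrite -(fid v mv); apply: codom_f.
  suff -> : #|[set v : 'I_sg_size | m <= v]| = sg_size - m by rewrite leq_subLR addnC.
  rewrite -[RHS](card_ord (sg_size - m)).
  have lt (i : 'I_(sg_size - m)) : m + i < sg_size by have := ltn_ord i; lia.
  have ih : injective (fun i : 'I_(sg_size - m) => Ordinal (lt i)).
    by move=> i j [/addnI E]; apply: val_inj.
  rewrite -cardsT -(card_imset _ ih); apply: eq_card => v; rewrite inE.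
  apply/idP/imsetP => [mv|[i _ ->]]; last by rewrite /= leq_addr.
  have vlt : nat_of_ord v - m < sg_size - m by have := ltn_ord v; lia.
  by exists (Ordinal vlt); rewrite ?inE //; apply: val_inj => /=; lia.
(* A hyperedge meets both sides, so its vertex sees both collapsed elements; these are joined by the
   special edge, and the only non-adjacent pairs left are pairs of apices. *)
apply: (tame_threshold tH (K := fun x : quot f => val x < X)); split.
  have fval (x : quot f) : exists v : sg_graph, f v = val x.
    by case: x => t /= /codomP [v ->]; exists v.
  have main (x y : quot f) : nat_of_ord (val x) < nat_of_ord (val y) -> nat_of_ord (val x) < X -> adj x y.
    move=> xy xX; apply/quot_adjP; split; first by move=> E; rewrite E ltnn in xy.
    have [vx Ex] := fval x; have [vy Ey] := fval y.
    have mx : m <= val x.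
      by rewrite -Ex /f; case: ifP => vU; [case: ifP|rewrite /U in vU; lia].
    have vN (v : nat) (vU : v < U) : v < sg_size by rewrite /U in vU; rewrite /sg_size; lia.
    case: (ltnP (nat_of_ord (val y)) X) => yX.
      case: (ltnP (nat_of_ord (val x)) U) => xU.
        case: (ltnP (nat_of_ord (val y)) U) => yU.
          exists (val x), (val y); rewrite !fid //; last lia.
          have [E1 E2] : nat_of_ord (val x) = m /\ nat_of_ord (val y) = m.+1.
            by rewrite /U in xU yU; lia.
          by split=> //; rewrite sg_adj E1 E2 sg_special.
        have cC : nat_of_ord (val y) - U < C by rewrite /X /U in yX yU *; lia.
        have [[v [vU mv av]] [v' [v'U mv' av']]] := Hc _ cC.
        have Hf (v0 : nat) (v0U : v0 < U) : mem (nat_of_ord (val y) - U) v0 ->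
           f (Ordinal (vN v0 v0U)) = val x ->
           exists u w : sg_graph, [/\ f u = val x, f w = val y & adj u w].
          move=> mv0 fv; exists (Ordinal (vN v0 v0U)), (val y); split=> //.
            by rewrite fid //; lia.
          have Ey' : nat_of_ord (val y) = U + (nat_of_ord (val y) - U) by lia.
          by rewrite sg_adj Ey' sg_member.
        have [E|E] : nat_of_ord (val x) = m \/ nat_of_ord (val x) = m.+1 by rewrite /U in xU; lia.
          apply: (Hf v vU mv); apply: val_inj; rewrite /f /= vU av /= E //.
        by apply: (Hf v' v'U mv'); apply: val_inj; rewrite /f /= v'U (negbTE av') /= E.
      exists (val x), (val y); rewrite !fid //; last lia.
      by split=> //; rewrite sg_adj sg_clauses.
    exists (val x), (val y); rewrite !fid //; last lia.
    by split=> //; rewrite sg_adj sg_far.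
  move=> x y xX nxy.
  have /eqP n : nat_of_ord (val x) != nat_of_ord (val y) by apply/eqP => /ord_inj/val_inj.
  case: (ltngtP (nat_of_ord (val x)) (nat_of_ord (val y))) => // xy; first exact: main.
  by rewrite adj_sym; apply: main => //; lia.
move=> x y; rewrite -!leqNgt => xX yX; apply/negP => /quot_adjP [_ [u [v [Eu Ev]]]].
have big (w : sg_graph) (x' : quot f) : X <= nat_of_ord (val x') -> f w = val x' -> w = val x'.
  move=> xX' E; move: xX'; rewrite -E /f; case: ifP => //.
  by rewrite /X; case: ifP => /= _ _; lia.
by rewrite (big u x xX Eu) (big v y yX Ev) sg_adj; apply/negP/sg_indep.
Qed.

(** The forced clique leaves room for two classes made of ground elements only. Counting vertices
    shows that both exist and that, the bound now being tight, no two of the other vertices share a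
    class. *)
Lemma identification_splits : Identification H (sg_graph, m) -> exists a, splits a.
Proof.
move=> /(Identification_qmap _ _ (tame_inv tH)) [G' [f [[sf af] le HG']]].
have adjf (u v : sg_graph) : f u <> f v -> adj u v -> adj (f u) (f v).
  by move=> n uv; apply/af; split=> //; exists u, v.
(* With a representative fixed in each fibre, a vertex is alone in its fibre unless it is a
   non-representative or represents one. There are at most [m] vertices of either kind, against
   [2 m + 2] apices. *)
have single2 : exists a b : sg_graph, [/\ a != b, X <= nat_of_ord a, X <= nat_of_ord b,
   forall u, f u = f a -> u = a & forall u, f u = f b -> u = b].
  have cf : forall x, exists u, f u == x by move=> x; have [u <-] := sf x; exists u.
  pose r x := xchoose (cf x).
  have rK x : f (r x) = x by apply/eqP/(xchooseP (cf x)).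
  pose B := ~: [set r x | x : G'].
  have cB : #|B| <= m.
    have := cardsC [set r x | x : G']; rewrite -/B card_imset ?cardsT; last exact: can_inj rK.
    by rewrite /= in le *; lia.
  pose B2 := [set r (f u) | u in B].
  have cB2 : #|B2| <= m by apply: leq_trans (leq_imset_card _ _) cB.
  pose Aset := [set v : sg_graph | X <= nat_of_ord v].
  have cA : #|Aset| = (m.+1).*2.
    rewrite -[RHS]card_ord.
    have lt (i : 'I_(m.+1).*2) : X + i < sg_size by rewrite /sg_size /X; have := ltn_ord i; lia.
    have ih : injective (fun i : 'I_(m.+1).*2 => Ordinal (lt i)).
      by move=> i j [/addnI E]; apply: val_inj.
    rewrite -cardsT -(card_imset _ ih); apply: eq_card => v; rewrite inE.
    apply/idP/imsetP => [mv|[i _ ->]]; last by rewrite /= leq_addr.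
    have vlt : v - X < (m.+1).*2 by have := ltn_ord v; rewrite /sg_size /X in mv *; lia.
    by exists (Ordinal vlt); rewrite ?inE //; apply: val_inj => /=; lia.
  have c2 : 1 < #|Aset :\: (B :|: B2)|.
    have H1 := leq_trans (leq_card_setU B B2) (leq_add cB cB2).
    have H2 := leq_trans (subset_leq_card (subsetIr Aset (B :|: B2))) H1.
    rewrite -(ltn_add2l #|Aset :&: (B :|: B2)|) (cardsID (B :|: B2) Aset) cA.
    by apply: (@leq_ltn_trans (m + m + 1)); [rewrite leq_add2r|lia].
  have sing v : v \notin B -> v \notin B2 -> forall u, f u = f v -> u = v.
    rewrite !inE negbK => /imsetP [x _ Ev] vB2 u Euv.
    case: (eqVneq u v) => // nuv; case/negP: vB2; apply/imsetP; exists u; last first.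
      by rewrite Euv Ev rK.
    rewrite inE; apply/imsetP => -[y _ Eu]; case/eqP: nuv.
    by move: Euv; rewrite Eu Ev !rK => ->.
  have [a [b [/setDP [aA aB] /setDP [bA bB] nab]]] := card_gt1P c2.
  rewrite in_setU negb_or in aB; rewrite in_setU negb_or in bB.
  case/andP: aB => aB aB2; case/andP: bB => bB bB2.
  exists a, b; split=> //; [by rewrite inE in aA|by rewrite inE in bA| |]; exact: sing.
have [a [b [nab aX bX sa sb]]] := single2.
have clique (u v : sg_graph) : nat_of_ord u < X -> nat_of_ord v < X -> f u <> f v -> adj (f u) (f v).
  move=> uX vX nuv; apply/negPn/negP => nadj.
  have far (c w : sg_graph) : (forall u, f u = f c -> u = c) -> X <= nat_of_ord c -> nat_of_ord w < X ->
     adj (f c) (f w).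
    move=> sc cX wX; apply: adjf.
      by move=> /esym /sc E; rewrite E in wX; lia.
    by rewrite adj_sym sg_adj sg_far.
  apply: (tame_c4 tH HG' (a := f a) (b := f u) (c := f b) (d := f v)); split=> //.
  - by move/sb/eqP; rewrite (negbTE nab).
  - apply/and4P; split; [exact: far|rewrite adj_sym; exact: far|exact: far|rewrite adj_sym; exact: far].
  apply/negP => /af [_ [a' [b' [/sa -> /sb ->]]]].
  by rewrite sg_adj; apply/negP/sg_indep.
(* The classes made of ground elements only. All other classes meet [FA], and [G'] has at least
   [#|FA| + 2] vertices, so [P] has at least two elements. *)
pose P := [set x : G' | [forall u, (f u == x) ==> (nat_of_ord u < U)]].
have inP x u : x \in P -> f u = x -> nat_of_ord u < U.
  by rewrite inE => /forallP /(_ u) /implyP H1 /eqP /H1.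
pose FA := [set v : sg_graph | U <= nat_of_ord v].
have cFA : #|FA| + U = sg_size.
  have -> : FA = ~: [set v : sg_graph | nat_of_ord v < U] by apply/setP => v; rewrite !inE leqNgt.
  rewrite addnC.
  apply: etrans (etrans (cardsC [set v : sg_graph | nat_of_ord v < U]) (card_ord _)).
  congr (_ + _).
  rewrite -[LHS]card_ord.
  have lt (i : 'I_U) : i < sg_size by rewrite /sg_size; have := ltn_ord i; rewrite /U; lia.
  have ih : injective (fun i : 'I_U => Ordinal (lt i)) by move=> i j [E]; apply: val_inj.
  rewrite -cardsT -(card_imset _ ih); apply: eq_card => v; rewrite !inE.
  apply/imsetP/idP => [[i _ ->]|vU]; first exact: (ltn_ord i).
  by exists (Ordinal vU); rewrite ?inE //; apply: val_inj.
have cG' : #|G'| <= #|P| + #|f @: FA|.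
  apply: leq_trans (leq_card_setU _ _); rewrite -cardsT; apply: subset_leq_card.
  apply/subsetP => x _; rewrite !in_setU; case: (boolP (x \in P)) => //=.
  rewrite inE negb_forall => /existsP [u]; rewrite negb_imply => /andP [/eqP <- uU].
  by apply: imset_f; rewrite inE leqNgt.
have cim := leq_imset_card f FA.
have leN : #|FA| + 2 <= #|P| + #|f @: FA|.
  rewrite [#|sg_graph|]card_ord in le; rewrite /U in cFA; lia.
have mN : m < sg_size by rewrite /sg_size; lia.
have m1N : m.+1 < sg_size by rewrite /sg_size; lia.
pose p : sg_graph := Ordinal mN; pose q : sg_graph := Ordinal m1N.
have adjU (u v : sg_graph) : nat_of_ord u < U -> nat_of_ord v < U -> adj u v ->
   (u = p /\ v = q) \/ (u = q /\ v = p).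
  move=> uU vU; rewrite sg_adj => /(sg_ground uU vU).
  by case=> -[E1 E2]; [left|right]; split; apply: val_inj.
(* Two classes in [P] are adjacent because of the clique, and the special edge is the only edge
   between ground elements. *)
have P2 : P \subset [set f p; f q].
  apply/subsetP => x xP.
  have [y [yP nxy]] : exists y, y \in P /\ y <> x.
    have /card_gt1P [y1 [y2 [y1P y2P ny]]] : 1 < #|P| by lia.
    case: (eqVneq y1 x) => [E|/eqP]; last by exists y1.
    by exists y2; split=> // E2; rewrite E E2 eqxx in ny.
  have [u Eu] := sf x; have [v Ev] := sf y.
  have uU := inP _ _ xP Eu; have vU := inP _ _ yP Ev.
  have : adj (f u) (f v).
    by apply: clique; rewrite ?Eu ?Ev; rewrite /X /U in uU vU *; try lia; apply: nesym.
  move=> /af [_ [u' [v' [Eu' Ev' uv]]]].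
  have := adjU u' v'; rewrite (inP x) ?Eu' // (inP y) ?Ev' // => /(_ isT isT uv).
  by rewrite !inE -Eu -Eu' => -[[-> _]|[-> _]]; rewrite eqxx ?orbT.
have cP := subset_leq_card P2; rewrite cards2 in cP.
have npq : f p <> f q by move=> E; move: cP; rewrite E eqxx /=; lia.
have EP : P = [set f p; f q].
  by apply/eqP; rewrite eqEcard P2 cards2; case: eqP => //=; lia.
have cP2 : #|P| <= 2 by apply: leq_trans cP _; case: eqP.
have /imset_injP injFA : #|f @: FA| == #|FA| 
  by rewrite eqn_leq cim -(leq_add2r 2) (leq_trans leN) // addnC leq_add2l.
have pP : f p \in P by rewrite EP !inE eqxx.
have qP : f q \in P by rewrite EP !inE eqxx orbT.
have Iv (v : sg_graph) : insub (nat_of_ord v) = Some v :> option 'I_sg_size := valK v.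
(* Ground elements merged into classes outside [P] land on the false side; the witnesses below come
   from the two classes in [P]. *)
exists (fun v => if insub v is Some v' then f v' == f p else false); split.
- by have -> : insub m = Some p :> option 'I_sg_size by exact: Iv p; rewrite eqxx.
- have -> : insub m.+1 = Some q :> option 'I_sg_size by exact: Iv q.
  exact/eqP/nesym.
move=> c cC; have sN : U + c < sg_size by rewrite /sg_size /U; lia.
pose s : sg_graph := Ordinal sN.
(* The edge joining the two classes must start at [s] itself: a ground element at that end would be
   special and put [f s] into [P], and any other vertex with the image of [s] is [s] by injectivity
   on [FA]. *)
have hit x : f x \in P -> nat_of_ord x < X -> exists v : sg_graph, [/\ nat_of_ord v < U, mem c v & f v = f x].
  move=> xP xX.
  have ns : f s <> f x by move=> E; have := inP _ s xP E; rewrite /=; lia.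
  have : adj (f s) (f x) by apply: clique => //=; rewrite /X /U; lia.
  move=> /af [_ [u [v [Eu Ev uv]]]]; have vU := inP _ _ xP Ev.
  case: (ltnP (nat_of_ord u) U) => uU.
    have [[Eu' _]|[Eu' _]] := adjU _ _ uU vU uv.
      by have := inP _ s pP; rewrite -Eu Eu' => /(_ erefl) /=; lia.
    by have := inP _ s qP; rewrite -Eu Eu' => /(_ erefl) /=; lia.
  have Es : u = s by apply: injFA => //; rewrite inE //= leq_addr.
  by exists v; split=> //; move: uv; rewrite Es adj_sym sg_adj sg_member.
split.
  have [|v [vU mv Ev]] := hit p pP; first by rewrite /= /X; lia.
  by exists (nat_of_ord v); split=> //; rewrite Iv Ev eqxx.
have [|v [vU mv Ev]] := hit q qP; first by rewrite /= /X; lia.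
by exists (nat_of_ord v); split=> //; rewrite Iv Ev; apply/eqP/nesym.
Qed.

Theorem splitting_identification : Identification H (sg_graph, m) <-> exists a, splits a.
Proof. by split=> [/identification_splits|[a /splits_identification]]. Qed.
End Splitting.

(** * Certificates for the graph classes *)

(* [r] labels the vertices by numbers; [used] and [cadj] describe the graph
   through its labels. *)
Record labels (G : graph) (N : nat) (r : G -> nat) (used : pred nat) (cadj : rel nat)
    : Prop := Labels {
  lab_inj : injective r;
  lab_lt : forall x, r x < N;
  lab_used : forall x, used (r x);
  lab_all : forall c, used c -> exists x, r x = c;
  lab_cadj : forall x y, cadj (r x) (r y) = adj x y;
  lab_adj : forall c d, cadj c d -> used c && used d
}.

Definition checker := nat -> pred nat -> rel nat -> (nat -> nat -> nat -> bool) -> bool.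

(** The labelling is chosen along with the evidence because it can itself carry information, such as
    an order. The last clause is there because a certificate string fixes [S] only below [N]. *)
Record certifies (H : graph_class) (chk : checker) : Prop := Certifies {
  cert_sound : forall (G : graph) N (r : G -> nat) used cadj S,
    labels N r used cadj -> chk N used cadj S -> H G;
  cert_complete : forall G : graph, H G -> exists r : G -> nat,
    [/\ injective r, forall x, r x < #|G| & forall N used cadj,
      labels N r used cadj -> exists S, chk N used cadj S];
  cert_ext : forall N used cadj S S',
    (forall b a v, b < N -> a < N -> v < N -> S b a v = S' b a v) ->
    chk N used cadj S -> chk N used cadj S'
}.

Lemma all_iotaP (P : pred nat) n : reflect (forall i, i < n -> P i) (all P (iota 0 n)).
Proof.
by apply: (iffP allP) => H i; [move=> ilt; apply: H|rewrite mem_iota => /= ?; apply: H];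
  rewrite ?mem_iota.
Qed.

Lemma has_iotaP (P : pred nat) n : reflect (exists2 i, i < n & P i) (has P (iota 0 n)).
Proof.
apply: (iffP hasP) => -[i]; last by exists i; rewrite ?mem_iota.
by rewrite mem_iota => /= ? ?; exists i.
Qed.

Definition split_check : checker := fun N used cadj S =>
  all (fun a => all (fun b =>
    [&& used a, used b & a != b] ==>
    (((S a 0 0 && S b 0 0) ==> cadj a b) && ((~~ S a 0 0 && ~~ S b 0 0) ==> ~~ cadj a b)))
    (iota 0 N)) (iota 0 N).

Lemma split_certifies_ext N used cadj S S' :
  (forall b a v, b < N -> a < N -> v < N -> S b a v = S' b a v) ->
  split_check N used cadj S -> split_check N used cadj S'.
Proof.
move=> E /all_iotaP H; apply/all_iotaP => a aN; apply/all_iotaP => b bN.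
by have /all_iotaP /(_ b bN) := H a aN; rewrite !E //; lia.
Qed.

Lemma split_certifies : certifies split_graph split_check.
Proof.
split; [| |exact: split_certifies_ext].
  move=> G N r used cadj S L chk; exists [set x | S (r x) 0 0].
  have K x y : x != y -> ((S (r x) 0 0 && S (r y) 0 0) ==> adj x y) &&
      ((~~ S (r x) 0 0 && ~~ S (r y) 0 0) ==> ~~ adj x y).
    move=> nxy; move/all_iotaP: chk => /(_ _ (lab_lt L x)) /all_iotaP /(_ _ (lab_lt L y)).
    by rewrite !(lab_used L) (inj_eq (lab_inj L)) nxy (lab_cadj L).
  split=> x y; rewrite !inE => Sx Sy.
    by move=> nxy; have := K x y nxy; rewrite Sx Sy => /andP [].
  case: (eqVneq x y) => [->|nxy]; first by rewrite adj_irr.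
  by have := K x y nxy; rewrite (negbTE Sx) (negbTE Sy) /=.
move=> G [K [H1 H2]]; exists (fun x => nat_of_ord (enum_rank x)); split.
- by move=> x y /ord_inj /enum_rank_inj.
- by move=> x; apply: ltn_ord.
move=> N used cadj L; exists (fun a _ _ => [exists x, (x \in K) && (enum_rank x == a :> nat)]).
have E x : [exists y, (y \in K) && (enum_rank y == enum_rank x :> nat)] = (x \in K).
  apply/existsP/idP => [[y /andP [yK /eqP /ord_inj /enum_rank_inj <-]]|xK] //.
  by exists x; rewrite xK eqxx.
apply/all_iotaP => a _; apply/all_iotaP => b _; apply/implyP => /and3P [].
move=> /(lab_all L) [x <-] /(lab_all L) [y <-] nxy; rewrite !E (lab_cadj L).
have {}nxy : x != y by apply: contra nxy => /eqP ->.
apply/andP; split; apply/implyP => /andP [Kx Ky]; first exact: H1.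
by apply: H2; rewrite inE.
Qed.

(* The labels list the intervals by left endpoint. *)
Definition interval_check : checker := fun N used cadj _ =>
  all (fun a => all (fun b => all (fun c =>
    [&& used a, used b, used c, a < b, b < c & cadj a c] ==> cadj a b)
    (iota 0 N)) (iota 0 N)) (iota 0 N).

Section IntervalCertificate.
Import Order.TTheory GRing.Theory Num.Theory.
Local Open Scope ring_scope.

Lemma interval_certifies (R : realType) : certifies (interval_graph R) interval_check.
Proof.
split; [| |by []].
  move=> G N r used cadj S L chk.
  have K x y z : (r x < r y)%N -> (r y < r z)%N -> adj x z -> adj x y.
    move=> xy yz xz; move/all_iotaP: chk => /(_ _ (lab_lt L x)) /all_iotaP /(_ _ (lab_lt L y)).
    move/all_iotaP => /(_ _ (lab_lt L z)).
    by rewrite !(lab_used L) !(lab_cadj L) xy yz xz.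
  (* The interval of [x] runs from its own label to that of its last neighbour; the check makes [x]
     adjacent to every vertex whose label lies in between. *)
  pose t x := (\max_(y | (y == x) || adj x y) r y)%N.
  have le_t x y : (y == x) || adj x y -> (r y <= t x)%N.
    by move=> H; apply: (leq_bigmax_cond (F := r)).
  have key x y : (r x < r y)%N -> adj x y = (r y <= t x)%N.
    move=> xy; apply/idP/idP => [H|]; first by apply: le_t; rewrite H orbT.
    have [|y' Hy' Ey'] := eq_bigmax_cond r (A := fun y => (y == x) || adj x y).
      by apply/card_gt0P; exists x; rewrite -topredE /= eqxx.
    rewrite /t Ey'; move: Hy'; rewrite -topredE => /orP [/eqP ->|xy']; first by rewrite leqNgt xy.
    by rewrite leq_eqVlt => /orP [/eqP /(lab_inj L) -> //|yy']; apply: K xy yy' xy'.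
  exists (fun x => `[(r x)%:R, (t x)%:R]); split=> [x|].
    by exists ((r x)%:R); rewrite in_itv /= lexx ler_nat le_t ?eqxx.
  have main x y : (r x < r y)%N ->
     adj x y <-> exists z : R, (z \in `[(r x)%:R, (t x)%:R]) && (z \in `[(r y)%:R, (t y)%:R]).
    move=> xy; rewrite key //; split=> [yt|[z]].
      by exists ((r y)%:R); rewrite !in_itv /= lexx !ler_nat yt (ltnW xy) le_t ?eqxx.
    rewrite !in_itv /= => /andP [/andP [_ zt] /andP [yz _]].
    by rewrite -(ler_nat R); apply: le_trans zt.
  move=> x y nxy; case: (ltngtP (r x) (r y)) => [|yx|/(lab_inj L) E]; first exact: main.
    rewrite adj_sym main //; split=> -[z zz]; by exists z; rewrite andbC.
  by rewrite E eqxx in nxy.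
move=> G [I [H1 H2]].
pose l (x : G) : itv_bound R := let: Interval l _ := I x in l.
pose le := [rel x y : G | (l x <= l y)%O].
have tot : total le by move=> x y; apply: le_total.
have rf : reflexive le by move=> x; apply: lexx.
have tr : transitive le by move=> y x z; apply: le_trans.
pose s := sort le (enum G).
have ss x : x \in s by rewrite mem_sort mem_enum.
exists (fun x => index x s); split.
- by move=> x y /(congr1 (nth x s)); rewrite !nth_index.
- by move=> x; rewrite cardE -(size_sort le) index_mem.
move=> N used cadj L; exists (fun _ _ _ => false).
have mono x y : (index x s < index y s)%N -> (l x <= l y)%O.
  move=> xy; have := sorted_leq_index tr rf (sort_sorted tot (enum G)).
  by move=> /(_ x y (ss x) (ss y) (ltnW xy)).
apply/all_iotaP => a _; apply/all_iotaP => b _; apply/all_iotaP => c _; apply/implyP.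
move=> /and5P [/(lab_all L) [x <-] /(lab_all L) [y <-] /(lab_all L) [z <-] xy /andP [yz]].
rewrite !(lab_cadj L) => xz.
have nxz : x != z by apply/eqP; apply: adj_neq.
have nxy : x != y by apply/eqP => E; rewrite E ltnn in xy.
have /(H2 x z nxz) [u uu] := xz.
apply/(H2 x y nxy); have [v vy] := H1 y.
move: (mono _ _ xy) (mono _ _ yz) vy uu; rewrite /l.
case: (I x) => lx rx; case: (I y) => ly ry; case: (I z) => lz rz lxy lyz.
rewrite !itv_boundlr => /andP [lyv vry] /andP [/andP [lxu urx] /andP [lzu urz]].
(* The point [u] is common to [x] and [z], and lies after the left end of [y]. Either it lies in
   [y], or [y] ends before [u] and its point [v] lies in [x]. Comparing bounds instead of reals
   treats open, closed and infinite ends alike. *)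
case: (leP (BRight u) ry) => ury.
  by exists u; rewrite !itv_boundlr lxu urx ury (le_trans lyz lzu).
exists v; rewrite !itv_boundlr lyv vry (le_trans lxy lyv) !andbT /=.
apply: le_trans vry _; apply: le_trans (ltW ury) urx.
Qed.
End IntervalCertificate.

(* [S b a] is the set reached from the neighbour [a] of [b] through vertices outside
   the closed neighbourhood of [b]; a neighbour of [b] that sees it must see [a]. *)
Definition chordal_check : checker := fun N used cadj S =>
  all (fun b => all (fun a => cadj b a ==>
    [&& S b a a,
        all (fun v => all (fun v' =>
          [&& S b a v, cadj v v', v' != b & ~~ cadj b v'] ==> S b a v')
          (iota 0 N)) (iota 0 N)
      & all (fun c => [&& cadj b c, c != a & ~~ cadj a c] ==>
          all (fun v => S b a v ==> ~~ cadj v c) (iota 0 N)) (iota 0 N)])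
    (iota 0 N)) (iota 0 N).

Ltac split_if := repeat match goal with
  | |- context [if ?c then _ else _] => let E := fresh in destruct c eqn:E
  end.

(* A shortest detour from [a] to [c] off the neighbourhood of [b] closes an
   induced cycle through [b]. *)
Lemma chordal_no_detour (G : graph) (a b c : G) (p : seq G) : chordal_graph G ->
  adj b a -> adj b c -> a != c -> ~~ adj a c ->
  path (fun x y => adj x y && ((y == c) || (y != b) && ~~ adj b y)) a p ->
  last a p = c -> False.
Proof.
set e := (fun x y => _); move=> chG ba bc nac adjac pp lp.
have ex : exists n, [exists q : n.-tuple G, path e a q && (last a q == c)].
  by exists (size p); apply/existsP; exists (in_tuple p); rewrite pp lp eqxx.
case: (ex_minnP ex) => r /existsP [q /andP [pq /eqP lq]] rmin {pp lp p ex}.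
have {}rmin p : path e a p -> last a p = c -> r <= size p.
  by move=> pp lp; apply: rmin; apply/existsP; exists (in_tuple p); rewrite pp lp eqxx.
have szq : size q = r by rewrite size_tuple.
move: pq lq szq; move: (tval q) => {q}p pp lp szp.
pose x i := nth c (a :: p) i.
have xr : x r = c by rewrite /x -szp -last_nth.
have lastx i : i <= r -> last a (take i p) = x i.
  by move=> ir; rewrite (last_nth c) size_takel ?szp // -[_ :: take i p]/(take i.+1 (a :: p)) nth_take.
have pathd i : i <= r -> path e (x i) (drop i p).
  by move=> ir; have := pp; rewrite -{1}(cat_take_drop i p) cat_path lastx // => /andP [].
have patht i : path e a (take i p).
  by have := pp; rewrite -{1}(cat_take_drop i p) cat_path => /andP [].
have lastd i : i <= r -> last (x i) (drop i p) = c.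
  by move=> ir; have := lp; rewrite -{1}(cat_take_drop i p) last_cat lastx.
have dropx i : i < r -> drop i p = x i.+1 :: drop i.+1 p.
  by move=> ir; rewrite (drop_nth c) ?szp.
have step i : i < r -> e (x i) (x i.+1).
  by move=> ir; have := pathd i (ltnW ir); rewrite dropx //= => /andP [].
(* An edge that skips ahead would give a shorter detour. *)
have short i j : i <= r -> j < r -> e (x i) (x j.+1) -> j <= i.
  move=> ir jr eij.
  have := @rmin (take i p ++ drop j p); rewrite cat_path patht lastx // dropx //= eij pathd //.
  rewrite last_cat lastx //= lastd // => /(_ isT erefl).
  by rewrite size_cat size_takel ?szp //= size_drop szp; lia.
have P i : 0 < i -> i <= r -> (x i == c) || (x i != b) && ~~ adj b (x i).
  by case: i => // i _ ir; have /andP [] := step i ir.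
have nadj i j : i <= r -> j <= r -> i.+1 < j -> ~~ adj (x i) (x j).
  case: j => // j ir jr ij; apply/negP => xij.
  have : e (x i) (x j.+1) by rewrite /e xij P.
  by move/short => /(_ ir jr); lia.
have dist i j : i < j -> j <= r -> x i <> x j.
  move=> ij jr E.
  case: (ltnP j r) => jr'.
    have : e (x i) (x j.+1) by rewrite E; apply: step.
    by move/short => /(_ _ jr'); lia.
  have {jr'}Ej : j = r by lia.
  subst j; rewrite xr in E.
  have := @rmin (take i p) (patht i); rewrite lastx ?E; last lia.
  by rewrite size_takel ?szp; [move=> /(_ erefl); lia|lia].
have x0 : x 0 = a by [].
have r1 : 1 < r.
  case: r {rmin lastx pathd lastd dropx short P nadj dist} xr step szp => [|[|r]] // xr step szp.
    by move: nac; rewrite -x0 xr eqxx.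
  by have := step 0 isT; rewrite x0 xr /e (negbTE adjac).
have inner i : 0 < i -> i < r -> (x i != b) && ~~ adj b (x i).
  move=> i0 ir; have := P i i0 (ltnW ir); case: eqP => // E.
  by case: (dist i r ir (leqnn r)); rewrite E xr.
have xb i : i <= r -> x i <> b.
  move=> ir; case: (posnP i) => [->|i0].
    by rewrite x0 => E; rewrite E adj_irr in ba.
  case: (eqVneq i r) => [->|ne]; first by rewrite xr => E; rewrite E adj_irr in bc.
  by have := inner i i0; rewrite ltn_neqAle ne ir => /(_ isT) /andP [/eqP].
have bx i : i <= r -> adj b (x i) = (i == 0) || (i == r).
  move=> ir; case: (posnP i) => [->|i0]; first by rewrite x0 ba.
  case: (eqVneq i r) => [->|ne]; first by rewrite xr bc orbT.
  by have := inner i i0; rewrite ltn_neqAle ne ir => /(_ isT) /andP [_ /negbTE ->];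
    rewrite orbF; case: i i0 {ir ne}.
have xx i j : i <= r -> j <= r -> adj (x i) (x j) = (j == i.+1) || (i == j.+1).
  move=> ir jr; wlog ij : i j ir jr / i <= j.
    move=> W; case: (leqP i j) => [/W|/ltnW /W]; first exact.
    by rewrite adj_sym orbC; apply.
  case: (ltngtP i j) ij => // [ij|->] _; last by rewrite adj_irr; lia.
  case: (eqVneq j i.+1) => [E|ne].
    by subst j; have /andP [-> _] := step i jr.
  rewrite (negbTE (nadj i j ir jr _)); lia.
pose f (i : 'I_r.+2) := if nat_of_ord i is i'.+1 then x i' else b.
apply: (chG r.+2 f); first lia; split.
  move=> [[|i] Hi] [[|j] Hj] //; rewrite /f /= => E; apply: val_inj => //=.
  - by case: (xb j) => //; lia.
  - by case: (xb i) => //; lia.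
  by case: (ltngtP i j) => [ij|ji|->] //; [case: (dist i j ij)|case: (dist j i ji)] => //; lia.
have modE (i : nat) : i < r.+2 -> i.+1 %% r.+2 = if i == r.+1 then 0 else i.+1.
  by move=> ir; case: eqP => [->|ne]; rewrite ?modnn // modn_small //; lia.
move=> [[|i] Hi] [[|j] Hj]; rewrite /f -!val_eqE /= ?modE //.
- by rewrite adj_irr.
- by rewrite bx //; split_if; lia.
- by rewrite adj_sym bx //; split_if; lia.
by rewrite xx //; split_if; lia.
Qed.

Lemma chordal_certifies_ext N used cadj S S' :
  (forall b a v, b < N -> a < N -> v < N -> S b a v = S' b a v) ->
  chordal_check N used cadj S -> chordal_check N used cadj S'.
Proof.
move=> E /all_iotaP H; apply/all_iotaP => b bN; apply/all_iotaP => a aN.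
have /all_iotaP /(_ a aN) /implyP K := H b bN; apply/implyP => /K /and3P [].
rewrite E // => -> /all_iotaP S1 /all_iotaP S2; rewrite andTb; apply/andP; split.
  apply/all_iotaP => v vN; apply/all_iotaP => v' vN'.
  by have /all_iotaP /(_ v' vN') := S1 v vN; rewrite !E.
apply/all_iotaP => c cN; apply/implyP => Hc; apply/all_iotaP => v vN.
by have /implyP /(_ Hc) /all_iotaP /(_ v vN) := S2 c cN; rewrite E.
Qed.

Lemma chordal_certifies : certifies chordal_graph chordal_check.
Proof.
split; [| |exact: chordal_certifies_ext].
  move=> G N r used cadj S L chk n f n4 [ih ah].
  have K b a : adj b a -> [/\ S (r b) (r a) (r a),
     forall v v', S (r b) (r a) (r v) -> adj v v' -> v' != b -> ~~ adj b v' -> S (r b) (r a) (r v')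
     & forall c v, adj b c -> c != a -> ~~ adj a c -> S (r b) (r a) (r v) -> ~~ adj v c].
    move=> ba; move/all_iotaP: chk => /(_ _ (lab_lt L b)) /all_iotaP /(_ _ (lab_lt L a)).
    rewrite (lab_cadj L) ba /= => /and3P [S0 /all_iotaP S1 /all_iotaP S2]; split=> //.
      move=> v v' Sv vv' nb bv'; have := S1 _ (lab_lt L v) => /all_iotaP /(_ _ (lab_lt L v')).
      by rewrite Sv !(lab_cadj L) (inj_eq (lab_inj L)) vv' nb bv'.
    move=> c v bc nca ac Sv; have := S2 _ (lab_lt L c).
    rewrite !(lab_cadj L) (inj_eq (lab_inj L)) bc nca ac /= => /all_iotaP /(_ _ (lab_lt L v)).
    by rewrite Sv (lab_cadj L).
  case: n f n4 ih ah => // n f n4 ih ah; pose g i := f (inord i).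
  have ag i j : i <= n -> j <= n -> adj (g i) (g j) =
    [|| (j == i.+1) && (i != n), (i == n) && (j == 0), (i == j.+1) && (j != n)
      | (j == n) && (i == 0)].
    move=> ilt jlt; rewrite /g ah -!val_eqE /= !inordK //.
    have modE k : k <= n -> k.+1 %% n.+1 = if k == n then 0 else k.+1.
      by move=> kn; case: eqP => [->|ne]; rewrite ?modnn // modn_small //; lia.
    by rewrite !modE //; case: (eqVneq i n) => ?; case: (eqVneq j n) => ?; lia.
  have ig i j : i <= n -> j <= n -> (g i == g j) = (i == j).
    by move=> ilt jlt; rewrite /g (inj_eq ih) -val_eqE /= !inordK.
  (* Take [b = g 0] and [a = g 1] on an induced cycle. Closure carries [S] along the cycle up to
     [g n.-1], which sees [g n], the other neighbour of [b], although [g 1] does not. *)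
  have [|S0 S1 S2] := K (g 0) (g 1); first by rewrite ag //; lia.
  have SS i : 0 < i -> i < n -> S (r (g 0)) (r (g 1)) (r (g i)).
    elim: i => // -[|i] IH _ ilt //.
    by apply: (S1 (g i.+1)); rewrite ?IH ?ag ?ig //; lia.
  have /negP[] : ~~ adj (g n.-1) (g n).
    by apply: S2; rewrite ?SS ?ag ?ig //; lia.
  by rewrite ag; lia.
move=> G chG; exists (fun x => nat_of_ord (enum_rank x)); split.
- by move=> x y /ord_inj /enum_rank_inj.
- by move=> x; apply: ltn_ord.
move=> N used cadj L.
pose e b := [rel x y : G | adj x y && ((y != b) && ~~ adj b y)].
exists (fun b a v => [exists b', exists a', exists v',
  [&& enum_rank b' == b :> nat, enum_rank a' == a :> nat, enum_rank v' == v :> nat &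
      connect (e b') a' v']]).
have E b a v : [exists b', exists a', exists v',
  [&& enum_rank b' == enum_rank b :> nat, enum_rank a' == enum_rank a :> nat,
      enum_rank v' == enum_rank v :> nat & connect (e b') a' v']] = connect (e b) a v.
  apply/existsP/idP => [[b' /existsP [a' /existsP [v' /and4P []]]]|H].
    by move=> /eqP/ord_inj/enum_rank_inj -> /eqP/ord_inj/enum_rank_inj -> /eqP/ord_inj/enum_rank_inj ->.
  by exists b; apply/existsP; exists a; apply/existsP; exists v; rewrite !eqxx.
have U c d : cadj c d -> (exists x : G, enum_rank x = c :> nat) /\
  (exists x : G, enum_rank x = d :> nat).
  by move/(lab_adj L) => /andP [/(lab_all L) ? /(lab_all L) ?].
apply/all_iotaP => b0 _; apply/all_iotaP => a0 _; apply/implyP => Hba.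
case: (U _ _ Hba) => -[b Eb] [a Ea]; move: Hba; rewrite -Eb -Ea (lab_cadj L) => ba.
rewrite E connect0 /=; apply/andP; split.
  apply/all_iotaP => v0 _; apply/all_iotaP => v0' _; apply/implyP => /and4P [Sv Hv].
  case: (U _ _ Hv) => -[v Ev] [v' Ev']; move: Hv Sv; rewrite -Ev -Ev' !(lab_cadj L) !E.
  move=> vv' cv nb nadj; apply: connect_trans cv _; apply: connect1 => /=.
  by rewrite vv' nadj andbT; apply: contra nb => /eqP ->.
apply/all_iotaP => c0 _; apply/implyP => /and3P [Hbc nc Hac].
case: (U _ _ Hbc) => _ [c Ec]; move: Hbc nc Hac; rewrite -Ec !(lab_cadj L) => bc nc ac.
apply/all_iotaP => v0 _; apply/implyP => Sv; apply/negP => Hvc.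
case: (U _ _ Hvc) => -[v Ev] _; move: Hvc Sv; rewrite -Ev !(lab_cadj L) E => vc.
move=> /connectP [p pp Ep].
apply: (@chordal_no_detour G a b c (rcons p c)) => //; rewrite ?last_rcons //.
  by apply: contra nc => /eqP ->.
rewrite rcons_path -Ep vc eqxx /= andbT.
by apply: sub_path pp => x y /= /andP [-> ->]; rewrite orbT.
Qed.

(** * Membership in NP *)


Section PairCode.
Variables (x y : seq bool).

Lemma pair_code_even l : l <= size x -> nth false (pair_code x y) l.*2 = (l < size x).
Proof. by elim: x l => [|b x' IH] [|l] // ?; rewrite doubleS; apply: IH. Qed.

Lemma pair_code_odd l : l < size x -> nth false (pair_code x y) l.*2.+1 = nth false x l.
Proof. by elim: x l => [|b x' IH] [|l] // ?; rewrite doubleS; apply: IH. Qed.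

Lemma pair_code_snd l : nth false (pair_code x y) ((size x).*2.+1 + l) = nth false y l.
Proof. by elim: x => //= b x' IH; rewrite doubleS addSn. Qed.

Lemma size_pair_code : size (pair_code x y) = (size x).*2.+1 + size y.
Proof. by elim: x => //= b x' IH; rewrite doubleS addSn /= IH. Qed.
End PairCode.

(** The even positions of a pair code are flags up to the end of the first component, which is
    marked by the first [false] flag. *)
Definition plen (n : nat) (b : nat -> bool) := find (fun l => ~~ b l.*2) (iota 0 n).
Definition pfst n (b : nat -> bool) i := (i < plen n b) && b i.*2.+1.
Definition psnd n (b : nat -> bool) i := b ((plen n b).*2.+1 + i).

Lemma find_iotaE (P : pred nat) n k : k < n -> P k -> (forall i, i < k -> ~~ P i) ->
  find P (iota 0 n) = k.
Proof.
move=> kn Pk H; case: (ltngtP (find P (iota 0 n)) k) => // lt.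
  have : has P (iota 0 n) by rewrite has_find size_iota; lia.
  by move=> /(nth_find 0); rewrite nth_iota; [rewrite (negbTE (H _ lt))|lia].
by have := before_find 0 lt; rewrite nth_iota // add0n Pk.
Qed.

Section Pairs.
Variables (n : nat) (b : nat -> bool) (x y : seq bool).
Hypothesis nE : n = size (pair_code x y).
Hypothesis bE : forall i, i < n -> b i = nth false (pair_code x y) i.

Lemma plenE : plen n b = size x.
Proof.
have nE' := nE; rewrite size_pair_code in nE'; apply: find_iotaE; first lia.
  by rewrite bE ?pair_code_even ?ltnn //; lia.
by move=> i ix; rewrite bE ?pair_code_even ?ix //; lia.
Qed.

Lemma pfstE i : pfst n b i = nth false x i.
Proof.
rewrite /pfst plenE; case: ltnP => ix; last by rewrite nth_default.
by rewrite bE ?pair_code_odd // nE size_pair_code; lia.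
Qed.

Lemma psndE i : i < size y -> psnd n b i = nth false y i.
Proof. by move=> iy; rewrite /psnd plenE bE ?pair_code_snd // nE size_pair_code; lia. Qed.
End Pairs.

Section DecodeInstance.
Variables (n : nat) (b : nat -> bool).
Definition iN := find (fun i => ~~ b i) (iota 0 n).
Definition imat u v := b (iN.+1 + (u * iN + v)).
Definition ioff := iN.+1 + iN * iN.
(* Capping [k] at [N] keeps it unary, and more than [N] identifications are useless. *)
Definition ik := iteri (n - ioff) (fun i a => minn (a + a + b (n.-1 - i)) iN) 0.
(** The last clause asks for a canonical binary tail; without it the string would not be the code of
    any instance. *)
Definition ivalid := [&& ioff <= n,
  all (fun u => all (fun v => (imat u v == imat v u) && ((u != v) || ~~ imat u v))
    (iota 0 iN)) (iota 0 iN) & (n == ioff) || b n.-1].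
End DecodeInstance.

Lemma eq_iteri (f g : nat -> nat -> nat) k :
  (forall i a, i < k -> f i a = g i a) -> iteri k f 0 = iteri k g 0.
Proof. by elim: k => //= k IH E; rewrite IH ?E // => i a ik; apply: E; lia. Qed.

(** Horner's rule from the most significant bit; capping every round has the same effect as capping
    the final value. *)
Lemma ik_val (s : seq bool) B :
  iteri (size s) (fun i a => minn (a + a + nth false s ((size s).-1 - i)) B) 0 = minn (bin_val s) B.
Proof.
elim: s => [|c s IH]; first by rewrite min0n.
rewrite [LHS]/= subnn (@eq_iteri _ (fun i a => minn (a + a + nth false s ((size s).-1 - i)) B)).
  rewrite IH /= -/(bin_val s); case: (c); lia.
by move=> i a ilt; have -> : size s - i = ((size s).-1 - i).+1 by lia.
Qed.

Lemma ivalidP (w : seq bool) : let n := size w in let b := nth false w in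
  ivalid n b -> exists k, ik n b = minn k (iN n b) /\
    w = instance_code (ograph (iN n b) (imat n b), k).
Proof.
move=> n b /and3P [off /all_iotaP sym tail]; set N := iN n b.
exists (bin_val (drop (ioff n b) w)); split.
  rewrite -ik_val size_drop /ik -/n -/N; apply: eq_iteri => i a ilt.
  by rewrite nth_drop; congr (minn (_ + _ + nat_of_bool (b _)) _); lia.
have Nn : N < n by rewrite /ioff -/N in off; lia.
have bN : ~~ b N.
  have : has (fun i => ~~ b i) (iota 0 n) by rewrite has_find size_iota.
  by move/(nth_find 0); rewrite nth_iota.
have bi i : i < N -> b i.
  move=> iN; have := before_find 0 (iN : i < find (fun i => ~~ b i) (iota 0 n)).
  by rewrite nth_iota; [move/negbFE|lia].
rewrite ograph_code bin_codeK; last first.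
  case/orP: tail => [/eqP E|bn]; first by have -> : drop (ioff n b) w = [::] by apply: drop_oversize; rewrite -E.
  case: (ltnP (ioff n b) n) => lt; last by rewrite drop_oversize.
  have E : ioff n b + (n - ioff n b).-1 = n.-1 by lia.
  by apply/orP; right; rewrite -nth_last nth_drop size_drop -/n E.
apply: (@eq_from_nth _ false).
  by rewrite !(size_cat, size_nseq, size_mkseq, size_drop) /= size_cat size_mkseq size_drop
    /ioff -/N -/n in off *; lia.
move=> i; rewrite -/n -/(b i) => iltn.
rewrite nth_cat size_nseq nth_nseq; case: ltnP => iN'; first by rewrite bi.
case: (eqVneq i N) => [->|ne]; first by rewrite subnn /= (negbTE bN).
have -> : i - N = (i - N.+1).+1 by lia.
rewrite [nth _ (_ :: _) _]/= nth_cat size_mkseq; case: ltnP => iM; last first.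
  by rewrite nth_drop; congr (nth _ _ _); rewrite /ioff -/N; lia.
rewrite nth_mkseq //; set j := i - N.+1.
have N0 : 0 < N by rewrite lt0n; apply/eqP => E; rewrite E in iM.
have [ju jv] : j %/ N < N /\ j %% N < N by rewrite ltn_divLR // ltn_pmod.
have /all_iotaP /(_ _ jv) := sym _ ju; rewrite -/N => /andP [/eqP E1 E2].
rewrite /oadj -E1 orbb /imat -/N -divn_eq in E2 *.
have -> : b i = b (N.+1 + j) by congr (b _); lia.
by case: eqP E2 => //= _ /negbTE ->.
Qed.

Lemma code_valid (x : instance) :
  ivalid (size (instance_code x)) (nth false (instance_code x)).
Proof.
case: x => G k; set w := instance_code _.
set M := [seq adj u v | u <- enum G, v <- enum G].
have [g Eg] : exists g, g = #|G| by exists #|G|.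
have sM : size M = g * g by rewrite size_allpairs -cardE Eg.
have Ew : w = nseq g true ++ false :: M ++ bin_code k by rewrite Eg.
have Sw : size w = g.+1 + g * g + size (bin_code k).
  by rewrite Ew size_cat size_nseq /= size_cat sM; lia.
have EN : iN (size w) (nth false w) = g.
  apply: find_iotaE; first by rewrite Sw; lia.
    by rewrite Ew nth_cat size_nseq ltnn subnn.
  by move=> i ilt; rewrite Ew nth_cat size_nseq ilt nth_nseq ilt.
have nthM i : i < g * g -> nth false w (g.+1 + i) = nth false M i.
  move=> ilt; rewrite Ew nth_cat size_nseq ifF; last lia.
  by rewrite (_ : _ - _ = i.+1) /=; [rewrite nth_cat sM ilt|lia].
rewrite /ivalid /ioff EN; apply/and3P; split; first by rewrite Sw; lia.
  apply/all_iotaP => u uG; apply/all_iotaP => v vG; rewrite /imat EN.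
  case: (pickP [pred x : G | true]) => [x0 _|E]; last by rewrite Eg (eq_card0 E) in uG.
  have lt i j : i < g -> j < g -> i * g + j < g * g by nia.
  have G0 : 0 < g by lia.
  rewrite !nthM ?lt // /M (allpairs_mkseq x0) -!cardE -!Eg !nth_mkseq ?lt //.
  rewrite !divnMDl // !modnMDl !(divn_small, modn_small) // !addn0.
  by rewrite adj_sym eqxx /=; case: eqP => //= ->; rewrite adj_irr.
case: (posnP k) => [k0|k0]; first by rewrite Sw k0 bin_code0 addn0 eqxx.
apply/orP; right; have := bin_code_last k0; rewrite -nth_last.
have s0 : 0 < size (bin_code k) by rewrite bin_codeS.
rewrite Ew nth_cat size_nseq -Ew ifF; last by rewrite Sw; lia.
have -> : (size w).-1 - g = ((g * g) + (size (bin_code k)).-1).+1 by rewrite Sw; lia.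
by rewrite /= nth_cat sM ifF; [rewrite addKn|lia].
Qed.

(** * The verifier *)

Section Verifier.
Variable chk : checker.
Variable W : seq bool.
Let n := plen (size W) (nth false W).
Definition vw := pfst (size W) (nth false W).
Definition vy := psnd (size W) (nth false W).
Definition vN := iN n vw.
(** The certificate begins with one row of [vN] bits per vertex, marking the label of its image, and
    continues with the table of [S]. *)
Definition vphi v := find (fun c => vy (v * vN + c)) (iota 0 vN).
Definition vused c := has (fun v => vphi v == c) (iota 0 vN).
Definition vcadj c d := (c != d) && has (fun u => has (fun v =>
  [&& vphi u == c, vphi v == d & oadj (imat n vw) u v]) (iota 0 vN)) (iota 0 vN).
Definition vS b a v := vy (vN * vN + ((b * vN + a) * vN + v)).
Definition verifier := [&& ivalid n vw, all (fun v => vphi v < vN) (iota 0 vN),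
  vN <= count vused (iota 0 vN) + ik n vw & chk vN vused vcadj vS].
End Verifier.

Section InNP.
Variables (H : graph_class) (chk : checker).
Hypothesis Hinv : iso_invariant H.
Hypothesis Hcert : certifies H chk.
Hypothesis Hdef : forall N (used : inp -> pred nat) (cadj : inp -> rel nat)
   (S : inp -> nat -> nat -> nat -> bool),
  def (fun w e => N w) ->
  (forall f, def f -> defb (fun w e => used w (f w e))) ->
  (forall f g, def f -> def g -> defb (fun w e => cadj w (f w e) (g w e))) ->
  (forall f g h, def f -> def g -> def h -> defb (fun w e => S w (f w e) (g w e) (h w e))) ->
  defb (fun w e => chk (N w) (used w) (cadj w) (S w)).

Lemma verifier_in_P : in_P (fun W => verifier chk W).
Proof.
exists (verifier chk); split=> //.
pose n (w : inp) := plen (size w.1) (nth false w.1).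
have Hn : def (fun w e => n w).
  by rewrite /n /plen; dsolve.
have Hw f : def f -> defb (fun w e => vw w.1 (f w e)) by move=> Hf; rewrite /vw /pfst; dsolve.
have Hy f : def f -> defb (fun w e => vy w.1 (f w e)) by move=> Hf; rewrite /vy /psnd; dsolve.
have HN : def (fun w e => vN w.1) by rewrite /vN /iN; dsolve.
have Hphi f : def f -> def (fun w e => vphi w.1 (f w e)) by move=> Hf; rewrite /vphi; dsolve.
have Hu f : def f -> defb (fun w e => vused w.1 (f w e)) by move=> Hf; rewrite /vused; dsolve.
have Hm f g : def f -> def g -> defb (fun w e => imat (n w) (vw w.1) (f w e) (g w e)).
  by move=> Hf Hg; rewrite /imat; dsolve.
have Hc f g : def f -> def g -> defb (fun w e => vcadj w.1 (f w e) (g w e)).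
  by move=> Hf Hg; rewrite /vcadj /oadj; dsolve.
have HS f g h : def f -> def g -> def h -> defb (fun w e => vS w.1 (f w e) (g w e) (h w e)).
  by move=> Hf Hg Hh; rewrite /vS; dsolve.
have Hk : def (fun w e => ik (n w) (vw w.1)).
  rewrite /ik /ioff; apply: (@def_rec _ _ (fun w e i a => a + a + vw w.1 ((n w).-1 - i))).
  - by dsolve.
  - by dsolve.
  by dsolve.
have Hv : defb (fun w e => ivalid (n w) (vw w.1)).
  by rewrite /ivalid /ioff; dsolve.
have HV : defb (fun w e => verifier chk w.1).
  rewrite /verifier; apply: defb_and => //; apply: defb_and; first by dsolve.
  apply: defb_and; first by dsolve.
  exact: (Hdef (N := fun w => vN w.1) (used := fun w => vused w.1)).
apply: (sdef_polytime (s := fun w => mkseq (fun=> verifier chk w.1) 1)) => //.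
exact: (sdef_mk (n := fun=> 1) (b := fun w _ => verifier chk w.1) (def_cst 1) HV).
Qed.

Lemma count_card (P : pred nat) N : count P (iota 0 N) = #|[set i : 'I_N | P i]|.
Proof.
rewrite -sum1_count -{1}[N]subn0 -/(index_iota 0 N) big_mkord -sum1_card.
by apply: eq_bigl => i; rewrite inE.
Qed.

Theorem Identification_in_NP : in_NP (language_of (Identification H)).
Proof.
have [c Hc] : polyb (fun n => n * n + n * n * n).
  by do !first [apply: polyb_add | apply: polyb_mul | apply: polyb_id].
exists (fun W => verifier chk W), (pb_poly c); split; first exact: verifier_in_P.
move=> w; rewrite pb_polyE.
pose n := size w; pose b := nth false w; set N := iN n b.
have Nn : N <= n by rewrite /N /iN -{2}(size_iota 0 n) find_size.
pose W y := pair_code w y.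
have nE y : plen (size (W y)) (nth false (W y)) = n by apply: (@plenE _ _ w y).
have bE y : vw (W y) = b.
  by apply: functional_extensionality => i; apply: (@pfstE _ _ w y).
have NE y : vN (W y) = N by rewrite /vN nE bE.
have yE y i : i < size y -> vy (W y) i = nth false y i by apply: (@psndE _ _ w y).
split.
  case=> x [Ew Qx]; have := code_valid x; rewrite -Ew -/n -/b => val.
  have [k [Ek Ew']] := ivalidP val; rewrite -/n -/b -/N in Ek Ew'.
  have : Identification H (ograph N (imat n b), k).
    by apply/(language_of_code _ Hinv); rewrite -Ew'; exists x.
  move/(Identification_qmap _ _ Hinv) => [G' [f [[sf af] le HG']]].
  rewrite card_ord in le.
  have [r [ir lr Hr]] := cert_complete Hcert HG'.
  have GN : #|G'| <= N.
    have := leq_imset_card f [set: 'I_N]; rewrite cardsT card_ord; apply: leq_trans.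
    rewrite -cardsT; apply: subset_leq_card.
    by apply/subsetP => z _; have [u <-] := sf z; apply: imset_f.
  pose phi v := if insub v is Some v' then r (f v') else 0.
  have phiE (v : 'I_N) : phi v = r (f v).
    by rewrite /phi (_ : insub _ = Some v) //; apply: valK.
  pose used0 d := has (fun v => phi v == d) (iota 0 N).
  pose cadj0 d d' := (d != d') && has (fun u => has (fun v =>
    [&& phi u == d, phi v == d' & oadj (imat n b) u v]) (iota 0 N)) (iota 0 N).
  have usedP d : used0 d <-> exists z, r z = d.
    split=> [/has_iotaP [v vN /eqP]|[z <-]].
      by rewrite (phiE (Ordinal vN)) => <-; exists (f (Ordinal vN)).
    by have [v <-] := sf z; apply/has_iotaP; exists v => //; rewrite phiE.
  have cadjP d d' : cadj0 d d' <-> exists z z', [/\ r z = d, r z' = d' & adj z z'].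
    split.
      move=> /andP [nd /has_iotaP [u uN /has_iotaP [v vN /and3P []]]].
      rewrite (phiE (Ordinal uN)) (phiE (Ordinal vN)) => /eqP Eu /eqP Ev uv.
      exists (f (Ordinal uN)), (f (Ordinal vN)); split=> //; apply/af; split.
        by move=> E; move: nd; rewrite -Eu -Ev E eqxx.
      by exists (Ordinal uN), (Ordinal vN).
    move=> [z [z' [<- <- /af [nz [u [v [Eu Ev uv]]]]]]]; apply/andP; split.
      by apply/eqP => /ir.
    apply/has_iotaP; exists u => //; apply/has_iotaP; exists v => //.
    by rewrite !phiE Eu Ev !eqxx.
  have L0 : labels N r used0 cadj0.
    split=> //.
    - by move=> z; apply: leq_trans (lr z) GN.
    - by move=> z; apply/usedP; exists z.
    - by move=> d /usedP.
    - move=> z z'; apply/idP/idP => [/cadjP [u [v [/ir -> /ir ->]]]|zz'] //.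
      by apply/cadjP; exists z, z'.
    by move=> d d' /cadjP [z [z' [<- <- _]]]; apply/andP; split; apply/usedP; [exists z|exists z'].
  have [S chkS] := Hr N used0 cadj0 L0.
  pose y := mkseq (fun i => if i < N * N then i %% N == phi (i %/ N) else
    let j := i - N * N in S (j %/ N %/ N) (j %/ N %% N) (j %% N)) (N * N + N * N * N).
  have Sy : size y = N * N + N * N * N by rewrite size_mkseq.
  exists y; split.
    rewrite Sy; apply: leq_trans (Hc n).
    by rewrite leq_add ?leq_mul.
  have phiN v : v < N -> phi v < N.
    by move=> vN; rewrite (phiE (Ordinal vN)); apply: leq_trans (lr _) GN.
  have vphiE v : v < N -> vphi (W y) v = phi v.
    move=> vN; rewrite /vphi NE.
    have E d : d < N -> vy (W y) (v * N + d) = (d == phi v).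
      move=> dN; have lt : v * N + d < N * N by nia.
      rewrite yE ?Sy; last lia.
      rewrite nth_mkseq; last lia.
      by rewrite lt modnMDl modn_small // divnMDl ?divn_small ?addn0 //; lia.
    apply: find_iotaE; first exact: phiN.
      by rewrite E ?phiN // eqxx.
    by move=> d dp; rewrite E; [rewrite ltn_eqF|have := phiN v vN; lia].
  have usedE : vused (W y) = used0.
    apply: functional_extensionality => d; rewrite /vused NE /used0.
    by apply: eq_in_has => v; rewrite mem_iota => /= vN; rewrite vphiE.
  have cadjE : vcadj (W y) = cadj0.
    apply: functional_extensionality => d; apply: functional_extensionality => d'.
    rewrite /vcadj NE nE bE /cadj0; congr (_ && _).
    apply: eq_in_has => u; rewrite mem_iota => /= uN.
    by apply: eq_in_has => v; rewrite mem_iota => /= vN; rewrite !vphiE.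
  rewrite /verifier -/(W y) nE bE NE usedE cadjE val /=; apply/and3P; split.
  - by apply/all_iotaP => v vN; rewrite vphiE ?phiN.
  - rewrite Ek count_card.
    suff : #|G'| <= #|[set i : 'I_N | used0 i]| by lia.
    have rN z : r z < N by apply: leq_trans (lr z) GN.
    have ir' : injective (fun z => Ordinal (rN z)) by move=> z z' [/ir].
    rewrite -cardsT -(card_imset _ ir'); apply: subset_leq_card.
    by apply/subsetP => i /imsetP [z _ ->]; rewrite inE; apply/usedP; exists z.
  apply: (cert_ext Hcert _ chkS) => d a v dN aN vN; rewrite /vS NE.
  have lt : (d * N + a) * N + v < N * N * N by nia.
  rewrite yE ?Sy; last lia.
  rewrite nth_mkseq; last lia.
  rewrite ifF; last lia.
  have N0 : 0 < N by lia.
  have dm u v' : v' < N -> (u * N + v') %/ N = u /\ (u * N + v') %% N = v'.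
    by move=> vN'; rewrite divnMDl // modnMDl divn_small // modn_small // addn0.
  by rewrite /= addKn; have [-> ->] := dm (d * N + a) v vN; have [-> ->] := dm d a aN.
case=> y [_]; rewrite /verifier -/(W y) nE bE NE => /and4P [Hval /all_iotaP phiN cnt chkS].
have [k [Ek Ew]] := ivalidP Hval; rewrite -/n -/b -/N in Ek Ew.
pose phi (v : ograph N (imat n b)) : 'I_N := Ordinal (phiN v (ltn_ord v)).
rewrite Ew; apply/(language_of_code _ Hinv)/(Identification_qmap _ _ Hinv).
exists (quot phi), (to_quot phi); split; first exact: qmap_quot.
  rewrite card_quot card_ord; apply: leq_trans cnt _; rewrite Ek count_card.
  apply: leq_add; last exact: geq_minl.
  apply: subset_leq_card; apply/subsetP => d; rewrite inE /vused NE => /has_iotaP [v vN /eqP Ed].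
  by apply/codomP; exists (Ordinal vN); apply: val_inj; rewrite /= Ed.
apply: (@cert_sound _ _ Hcert (quot phi) N (fun x => nat_of_ord (val x)) _ _ _ _ chkS).
have ulab (x : quot phi) : exists v : 'I_N, phi v = val x.
  by case: x => t /= /codomP [v ->]; exists v.
split.
- by move=> x x' /ord_inj /val_inj.
- by move=> x.
- move=> x; have [v Ev] := ulab x; rewrite /vused NE; apply/has_iotaP; exists v => //.
  by rewrite -Ev.
- rewrite /vused NE => d /has_iotaP [v vN /eqP <-].
  by exists (to_quot phi (Ordinal vN)).
- move=> x x'; rewrite /vcadj NE nE bE; apply/idP/idP.
    move=> /andP [nd /has_iotaP [u uN /has_iotaP [v vN /and3P [/eqP Eu /eqP Ev uv]]]].
    apply/quot_adjP; split; first by move=> E; rewrite E eqxx in nd.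
    by exists (Ordinal uN), (Ordinal vN); split=> //; apply: val_inj.
  move=> /quot_adjP [nx [u [v [Eu Ev uv]]]]; apply/andP; split.
    by apply/eqP => /ord_inj.
  apply/has_iotaP; exists u; first exact: (ltn_ord u).
  apply/has_iotaP; exists v; first exact: (ltn_ord v).
  by rewrite -Eu -Ev !eqxx.
rewrite /vcadj /vused NE nE bE => d d' /andP [_ /has_iotaP [u uN /has_iotaP [v vN /and3P [Eu Ev _]]]].
by apply/andP; split; apply/has_iotaP; [exists u|exists v].
Qed.
End InNP.

Lemma split_in_NP : in_NP (language_of (Identification split_graph)).
Proof.
apply: Identification_in_NP (tame_inv tame_split) split_certifies _ => N used cadj S *.
by rewrite /split_check; dsolve.
Qed.

Lemma interval_in_NP (R : realType) : in_NP (language_of (Identification (interval_graph R))).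
Proof.
apply: Identification_in_NP (tame_inv (tame_interval R)) (interval_certifies R) _ => N used cadj S *.
by rewrite /interval_check; dsolve.
Qed.

Lemma chordal_in_NP : in_NP (language_of (Identification chordal_graph)).
Proof.
apply: Identification_in_NP (tame_inv tame_chordal) chordal_certifies _ => N used cadj S *.
by rewrite /chordal_check; dsolve.
Qed.

(** * Computations as set splittings *)

Section Columns.
Variable M : machine.
Notation sym := (symbol (aux M)).

(* The tapes are kept centred at their heads: column [j] records, for every tape,
   the scanned symbol and the [j]-th symbols to its left and to its right. *)
Definition column : finType :=
  (state M * {ffun 'I_(ntapes M).+1 -> sym * sym * sym})%type.

Definition col (c : config M) (j : nat) : column :=
  (cstate c, [ffun i => (thead (ctape c i), nth None (tleft (ctape c i)) j,
                         nth None (tright (ctape c i)) j)]).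

(** Here [g] is column 0, whose cells become the scanned symbols after a move, and [a], [b], [c] are
    the columns [j - 1], [j], [j + 1]. Since the head stays put and the tapes shift past it, the
    rule is local; a written symbol enters at column 0, as told by [j0]. *)
Definition next (j0 : bool) (g a b c : column) : column :=
  if halted g.1 then b else
  let: (q, ac) := trans g.1 [ffun i => (g.2 i).1.1] in
  (q, [ffun i => let: (s, mv) := ac i in
    match mv with
    | MoveL => ((g.2 i).1.2, (c.2 i).1.2, if j0 then s else (a.2 i).2)
    | MoveN => (s, (b.2 i).1.2, (b.2 i).2)
    | MoveR => ((g.2 i).2, if j0 then s else (a.2 i).1.2, (c.2 i).2)
    end]).

Lemma col_step c j :
  col (step c) j = next (j == 0) (col c 0) (col c j.-1) (col c j) (col c j.+1).
Proof.
rewrite /step /next /=; case: ifP => // _.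
have -> : [ffun i => (([ffun i0 => (thead (ctape c i0), nth None (tleft (ctape c i0)) 0,
   nth None (tright (ctape c i0)) 0)] : {ffun _ -> _}) i).1.1] = [ffun i => thead (ctape c i)].
  by apply/ffunP => i; rewrite !ffunE.
case: (trans _ _) => q ac; congr (_, _); apply/ffunP => i; rewrite !ffunE /=.
by case: (ac i) => s [] /=; rewrite ?nth_behead ?nth0 //; case: j.
Qed.

Definition lsym (o : option bool) : sym := omap inl o.
Definition icol (h o : option bool) : column :=
  (start M, [ffun i => if i == ord0 then (lsym h, None, lsym o) else (None, None, None)]).

Lemma lsym_onth x p : nth None (bitsyms (aux M) x) p = lsym (onth x p).
Proof. by elim: x p => [|b x IH] [|p] //=. Qed.

Lemma col_init x j : col (init M x) j = icol (onth x 0) (onth x j.+1).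
Proof.
congr (_, _); apply/ffunP => i; rewrite !ffunE /=; case: eqP => _; last by rewrite !nth_nil.
by case: x => [|b x] /=; rewrite !nth_nil // -lsym_onth.
Qed.

Lemma icol_inj h : injective (icol h).
Proof.
move=> o o' [/ffunP /(_ ord0)]; rewrite !ffunE eqxx => -[].
by case: o o' => [b|] [b'|] //= [->].
Qed.

Definition nD := #|column|.
Definition enc (a : column) : nat := enum_rank a.
Definition dec (i : nat) : column := nth (icol None None) (enum column) i.

Lemma encK : cancel enc dec.
Proof. by move=> a; rewrite /enc /dec nth_enum_rank. Qed.
Lemma enc_lt a : enc a < nD. Proof. exact: ltn_ord. Qed.
Lemma nD_gt0 : 0 < nD. Proof. exact: leq_ltn_trans (enc_lt (icol None None)). Qed.

(** The letter [h] under the head is the first letter of a pair code, which is [true] exactly when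
    the first component is nonempty; hence the argument [0 < n] below. *)
Definition icode (h : bool) (o : option bool) := enc (icol (Some h) o).
Lemma icode_inj h : injective (icode h).
Proof. by move=> o o' /(can_inj encK) /icol_inj. Qed.

Definition ok_step (j0 : bool) (g a b c r : nat) :=
  [&& g < nD, a < nD, b < nD, c < nD & r == enc (next j0 (dec g) (dec a) (dec b) (dec c))].
Definition accepts (a : nat) :=
  (a < nD) && (halted (dec a).1 && (((dec a).2 ord0).1.1 == Some (inl true))).

Section Clauses.
(* [t] inputs of length [n], certificates of length at most [Q], time [T]. *)
Variables (n t Q T : nat) (X : nat -> nat -> bool).
Let T1 := T.+1.

Definition nvars := T1 * T1 * nD.
Definition vt v := v %/ nD %/ T1.
Definition vj v := v %/ nD %% T1.
Definition va v := v %% nD.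

(* Row 0 holds [pair_code x y]; column [j] carries its letter [j + 1]. *)
Definition allowed j a :=
  if j < n.*2 then
    if odd j then a == icode (0 < n) (Some (j.+1 < n.*2))
    else (a == icode (0 < n) (Some true)) || (a == icode (0 < n) (Some false))
  else (a == icode (0 < n) None) || (j < n.*2 + Q) &&
       ((a == icode (0 < n) (Some true)) || (a == icode (0 < n) (Some false))).

Definition forbidden v1 v2 v3 v4 v5 :=
  [|| [&& vt v1 == vt v3, vt v2 == vt v3, vt v4 == vt v3, vt v5 == (vt v3).+1,
          vj v1 == 0, vj v2 == (vj v3).-1, vj v4 == (vj v3).+1, vj v5 == vj v3
        & ~~ (if vj v3 == 0 then ok_step true (va v1) (va v2) (va v3) (va v4) (va v5)
              else ok_step false (va v1) (va v2) (va v3) (va v4) (va v5))],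
      (vt v1 == 0) && ~~ allowed (vj v1) (va v1),
      [&& vt v1 == 0, vt v2 == 0, vj v2 == (vj v1).+1, n.*2 <= vj v1,
          va v1 == icode (0 < n) None & va v2 != icode (0 < n) None]
    | [&& vt v1 == T, vj v1 == 0 & ~~ accepts (va v1)]].

(* No input continues the first [l] bits of input [i] by the opposite bit.  Forbidding
   every such deviation confines row 0 to the inputs, without a variable naming one. *)
Definition dead_end i l :=
  ~~ has (fun i' => all (fun l' => X i' l' == X i l') (iota 0 l) && (X i' l != X i l))
       (iota 0 t).

Definition in_trie i l v := [&& vt v == 0, ~~ odd (vj v), vj v <= l.*2 &
  va v == if (if vj v == l.*2 then ~~ X i l else X i (vj v %/ 2))
          then icode (0 < n) (Some true) else icode (0 < n) (Some false)].

Definition nforb := nvars * (nvars * (nvars * (nvars * nvars))).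
Definition nclauses := T1 * T1 + nforb + t * n.

(* Element [nvars] is true and [nvars.+1] is false, so a set containing both imposes
   nothing. *)
Definition incl (c v : nat) : bool :=
  if c < T1 * T1 then (v == nvars.+1) || (v < nvars) && (v %/ nD == c)
  else (v == nvars) ||
  let c := c - T1 * T1 in
  if c < nforb then
    let v1 := c %% nvars in let c := c %/ nvars in
    let v2 := c %% nvars in let c := c %/ nvars in
    let v3 := c %% nvars in let c := c %/ nvars in
    let v4 := c %% nvars in let v5 := c %/ nvars %% nvars in
    if forbidden v1 v2 v3 v4 v5 then [|| v == v1, v == v2, v == v3, v == v4 | v == v5]
    else v == nvars.+1
  else
    let i := (c - nforb) %/ n in let l := (c - nforb) %% n in
    if dead_end i l then (v < nvars) && in_trie i l v else v == nvars.+1.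

Lemma nvars_gt0 : 0 < nvars.
Proof. by rewrite /nvars !muln_gt0 nD_gt0. Qed.

Definition mkv tau j a := (tau * T1 + j) * nD + a.

Lemma mkvE tau j a : tau <= T -> j <= T -> a < nD ->
  [/\ mkv tau j a < nvars, vt (mkv tau j a) = tau, vj (mkv tau j a) = j,
      va (mkv tau j a) = a & mkv tau j a %/ nD = tau * T1 + j].
Proof.
move=> lt lj la; have d0 := nD_gt0.
have E : mkv tau j a %/ nD = tau * T1 + j.
  by rewrite /mkv divnMDl // divn_small // addn0.
split=> //.
- have : tau * T1 + j < T1 * T1 by rewrite /T1; nia.
  by rewrite /mkv /nvars; nia.
- by rewrite /vt E divnMDl // divn_small ?addn0 // ltnS.
- by rewrite /vj E modnMDl modn_small // ltnS.
by rewrite /va /mkv modnMDl modn_small.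
Qed.

Lemma mkv_surj v : v < nvars -> [/\ vt v <= T, vj v <= T, va v < nD & v = mkv (vt v) (vj v) (va v)].
Proof.
move=> vm; have d0 := nD_gt0; split.
- rewrite -ltnS /vt ltn_divLR // ltn_divLR // -/T1.
- by rewrite -ltnS /vj ltn_pmod.
- by rewrite /va ltn_pmod.
by rewrite /mkv /vt /vj /va -!divn_eq.
Qed.

(** A cell may carry several values at once: the forbidden patterns exclude every combination of
    them, so an arbitrary choice of one value per cell yields a run. *)
Definition sat (al : nat -> bool) :=
  [/\ forall tau j, tau <= T -> j <= T -> exists2 a, a < nD & al (mkv tau j a),
      forall v1 v2 v3 v4 v5, v1 < nvars -> v2 < nvars -> v3 < nvars -> v4 < nvars ->
        v5 < nvars -> forbidden v1 v2 v3 v4 v5 ->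
        ~~ [&& al v1, al v2, al v3, al v4 & al v5]
    & forall i l, i < t -> l < n -> dead_end i l ->
        exists v, [/\ v < nvars, in_trie i l v & ~~ al v]].

Lemma splits_sat : (exists al, splits nvars nclauses incl al) <-> exists al, sat al.
Proof.
have m0 := nvars_gt0; split=> -[al].
  case=> alm alm1 H; exists al; split.
  - move=> tau j lt lj.
    have cC : tau * T1 + j < T1 * T1 by rewrite /T1; nia.
    have [|[v [vU]]] := H (tau * T1 + j); first by rewrite /nclauses; lia.
    rewrite /incl cC => /orP [/eqP ->|/andP [vm /eqP Ev] av _]; first by rewrite (negbTE alm1).
    have [_ _ la E] := mkv_surj vm; exists (va v) => //.
    by rewrite /mkv -Ev /va -divn_eq.
  - move=> v1 v2 v3 v4 v5 l1 l2 l3 l4 l5 F.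
    (* The five variables are the digits of the clause index in base [nvars]. *)
    pose c0 := v1 + nvars * (v2 + nvars * (v3 + nvars * (v4 + nvars * v5))).
    have dm1 a b : a < nvars -> (a + nvars * b) %% nvars = a.
      by move=> an; rewrite addnC mulnC modnMDl modn_small.
    have dm2 a b : a < nvars -> (a + nvars * b) %/ nvars = b.
      by move=> an; rewrite addnC mulnC divnMDl // divn_small // addn0.
    have lt0 : c0 < nforb.
      have st a b B : a < nvars -> b < B -> a + nvars * b < nvars * B by nia.
      by apply: (st _ _ _ l1); apply: (st _ _ _ l2); apply: (st _ _ _ l3); apply: (st _ _ _ l4).
    have [|_ [v [vU]]] := H (T1 * T1 + c0); first by rewrite /nclauses; lia.
    rewrite /incl ifF; last lia.
    rewrite addKn /= lt0 /c0.
    rewrite !(dm2 _ _ l1) !(dm1 _ _ l1) !(dm2 _ _ l2) !(dm1 _ _ l2) !(dm2 _ _ l3).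
    rewrite !(dm1 _ _ l3) !(dm2 _ _ l4) !(dm1 _ _ l4) (modn_small l5) F.
    case/orP => [/eqP ->|]; first by rewrite alm.
    by case/or4P => [/eqP ->|/eqP ->|/eqP ->|/orP [] /eqP ->] /negbTE ->; rewrite ?andbF.
  move=> i l it ln D.
  have lt : i * n + l < t * n by nia.
  have n0 : 0 < n by lia.
  have [|_ [v [vU]]] := H (T1 * T1 + nforb + (i * n + l)); first by rewrite /nclauses; lia.
  rewrite /incl ifF; last lia.
  rewrite -addnA addKn /= ifF; last lia.
  rewrite addKn divnMDl // modnMDl divn_small // modn_small // addn0 D.
  case/orP => [/eqP ->|/andP [vm tr] av]; first by rewrite alm.
  by exists v.
case=> S1 S2 S3.
pose be v := if v < nvars then al v else v == nvars.
have b1 : be nvars by rewrite /be ltnn eqxx.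
have b2 : ~~ be nvars.+1 by rewrite /be ltnNge leqnSn /=; lia.
exists be; split=> // c cC.
have in1 : nvars < nvars.+2 by lia.
have in2 : nvars.+1 < nvars.+2 by lia.
have leU v : v < nvars -> v < nvars.+2 by lia.
case c1: (c < T1 * T1).
  have Ei v : incl c v = (v == nvars.+1) || (v < nvars) && (v %/ nD == c) by rewrite /incl c1.
  split; last by exists nvars.+1; rewrite Ei eqxx.
  have T10 : 0 < T1 by [].
  have l1 : c %/ T1 <= T by rewrite -ltnS ltn_divLR.
  have l2 : c %% T1 <= T by rewrite -ltnS ltn_pmod.
  have [a la ala] := S1 _ _ l1 l2.
  have [vm _ _ _ E] := mkvE l1 l2 la.
  exists (mkv (c %/ T1) (c %% T1) a); split; first exact: leU.
    by rewrite Ei vm E -divn_eq eqxx orbT.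
  by rewrite /be vm.
split; first by exists nvars; rewrite /incl c1 eqxx.
pose c' := c - T1 * T1.
case c2: (c' < nforb).
  pose v1 := c' %% nvars; pose v2 := c' %/ nvars %% nvars.
  pose v3 := c' %/ nvars %/ nvars %% nvars.
  pose v4 := c' %/ nvars %/ nvars %/ nvars %% nvars.
  pose v5 := c' %/ nvars %/ nvars %/ nvars %/ nvars %% nvars.
  have Ei v : incl c v = (v == nvars) || (if forbidden v1 v2 v3 v4 v5
      then [|| v == v1, v == v2, v == v3, v == v4 | v == v5] else v == nvars.+1).
    by rewrite /incl c1 /= -/c' c2.
  have [l1 l2 l3 l4 l5] : [/\ v1 < nvars, v2 < nvars, v3 < nvars, v4 < nvars & v5 < nvars].
    by split; rewrite ltn_pmod.
  case F: (forbidden v1 v2 v3 v4 v5); last by exists nvars.+1; rewrite Ei F eqxx orbT.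
  have := S2 _ _ _ _ _ l1 l2 l3 l4 l5 F.
  rewrite !negb_and => /or4P [H|H|H|/orP [] H];
    [exists v1|exists v2|exists v3|exists v4|exists v5]; rewrite Ei F /be ?l1 ?l2 ?l3 ?l4 ?l5;
    by split; rewrite ?leU // eqxx ?orbT.
have Ei v : incl c v = (v == nvars) || (if dead_end ((c' - nforb) %/ n) ((c' - nforb) %% n)
    then (v < nvars) && in_trie ((c' - nforb) %/ n) ((c' - nforb) %% n) v else v == nvars.+1).
  by rewrite /incl c1 /= -/c' c2.
case D: (dead_end ((c' - nforb) %/ n) ((c' - nforb) %% n)); last first.
  by exists nvars.+1; rewrite Ei D eqxx orbT.
have tn : c' - nforb < t * n by rewrite /nclauses in cC; rewrite /c'; lia.
have n0 : 0 < n by rewrite lt0n; apply/eqP => E; rewrite E muln0 in tn.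
have [||v [vm tr nav]] := S3 _ _ _ _ D; rewrite ?ltn_pmod ?ltn_divLR //.
by exists v; rewrite Ei D; split; rewrite ?leU // ?vm ?tr ?orbT // /be vm.
Qed.

Section Run.
Variables (i : nat) (y : seq bool).
Let w := pair_code (mkseq (X i) n) y.

Lemma onthE (s : seq bool) p : onth s p = if p < size s then Some (nth false s p) else None.
Proof. by elim: s p => [|b s IH] [|p] //=; rewrite IH. Qed.

Lemma letterE j : onth w j.+1 =
  if j < n.*2 then Some (if odd j then j.+1 < n.*2 else X i (j %/ 2)) else onth y (j - n.*2).
Proof.
have sx : size (mkseq (X i) n) = n by rewrite size_mkseq.
have Ej := odd_double_half j; rewrite onthE size_pair_code sx.
case: (ltnP j n.*2) => jn; last first.
  rewrite onthE (_ : (j.+1 < n.*2.+1 + size y) = (j - n.*2 < size y)); last lia.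
  have -> : j.+1 = (size (mkseq (X i) n)).*2.+1 + (j - n.*2) by rewrite sx; lia.
  by rewrite pair_code_snd.
rewrite ifT; last lia.
case: ifP Ej => oj Ej; last first.
  have -> : j.+1 = (j./2).*2.+1 by lia.
  by rewrite pair_code_odd ?sx ?nth_mkseq ?divn2 //; lia.
have {1}-> : j.+1 = (j./2.+1).*2 by lia.
by rewrite pair_code_even ?sx; [congr Some|]; lia.
Qed.

Lemma enc_init j : enc (col (init M w) j) = icode (0 < n) (onth w j.+1).
Proof.
rewrite col_init /icode; congr (enc (icol _ _)).
rewrite onthE size_pair_code ltn0Sn; congr Some.
by have /= := @pair_code_even (mkseq (X i) n) y 0 (leq0n _); rewrite size_mkseq.
Qed.

Definition acc := let c := iter T (@step M) (init M w) in
  halted (cstate c) /\ thead (ctape c ord0) = Some (inl true).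

Lemma acceptsE c : accepts (enc (col c 0)) <->
  halted (cstate c) /\ thead (ctape c ord0) = Some (inl true).
Proof.
rewrite /accepts enc_lt encK /= ffunE /=.
by split=> [/andP [-> /eqP]|[-> ->]] //; rewrite eqxx.
Qed.

Hypothesis (nQT : n.*2 + Q <= T).

Lemma run_sat : i < t -> size y <= Q -> acc -> exists al, sat al.
Proof.
move=> it yQ Hacc; pose conf tau := iter tau (@step M) (init M w).
exists (fun v => va v == enc (col (conf (vt v)) (vj v))); split.
- move=> tau j lt lj; exists (enc (col (conf tau) j)); first exact: enc_lt.
  by have [_ -> -> -> _] := mkvE lt lj (enc_lt (col (conf tau) j)); rewrite eqxx.
- move=> v1 v2 v3 v4 v5 l1 l2 l3 l4 l5 F.
  apply/negP => /and5P [/eqP a1 /eqP a2 /eqP a3 /eqP a4 /eqP a5].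
  case/or4P: F.
  + move=> /and5P [/eqP t1 /eqP t2 /eqP t4 /eqP t5] /and5P [/eqP j1 /eqP j2 /eqP j4 /eqP j5].
    rewrite t1 j1 in a1; rewrite t2 j2 in a2; rewrite t4 j4 in a4; rewrite t5 j5 in a5.
    have -> : (if vj v3 == 0 then ok_step true (va v1) (va v2) (va v3) (va v4) (va v5)
      else ok_step false (va v1) (va v2) (va v3) (va v4) (va v5)) =
      ok_step (vj v3 == 0) (va v1) (va v2) (va v3) (va v4) (va v5) by case: eqP.
    rewrite /ok_step a1 a2 a3 a4 a5 !enc_lt !encK /conf iterS -/(conf (vt v3)) col_step.
    by rewrite eqxx.
  + move=> /andP [/eqP t1 /negP[]]; rewrite a1 t1 enc_init letterE /allowed.
    case: ifP => jn.
      by rewrite jn; case oj: (odd (vj v1)); rewrite ?eqxx //; case: (X i _); rewrite eqxx ?orbT.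
    rewrite jn onthE; case: ifP => jy; rewrite ?eqxx //.
    have -> : vj v1 < n.*2 + Q by lia.
    by case: (nth false y _); rewrite eqxx ?orbT.
  + move=> /and5P [/eqP t1 /eqP t2 /eqP j2 jn /andP [/eqP b1 /eqP b2]]; apply: b2.
    rewrite a2 t2 enc_init letterE j2 ifF; last lia.
    move: b1; rewrite a1 t1 enc_init letterE ifF; last lia.
    move/icode_inj; rewrite !onthE; case: ifP => // jy _; rewrite ifF //; lia.
  move=> /and3P [/eqP t1 /eqP j1 /negP[]]; rewrite a1 t1 j1; exact/acceptsE.
(* The input [i] of the run leaves input [i'] before position [l] or agrees with it there. Either
   way some letter of the forbidden deviation is absent from row 0. *)
move=> i' l it' ln /hasPn /(_ i); rewrite mem_iota leq0n add0n it => /(_ isT) /=.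
have ev j : odd j.*2 = false by rewrite odd_double.
have al_l l' b : l' < n -> (va (mkv 0 l'.*2 (icode (0 < n) (Some b))) ==
    enc (col (conf (vt (mkv 0 l'.*2 (icode (0 < n) (Some b)))))
             (vj (mkv 0 l'.*2 (icode (0 < n) (Some b)))))) = (b == X i l').
  move=> ln'; have [|||_ -> -> -> _] := @mkvE 0 l'.*2 (icode (0 < n) (Some b)) => //.
  - by lia.
  - exact: enc_lt.
  rewrite enc_init letterE ifT; last lia.
  rewrite ev (inj_eq (@icode_inj _)) divn2 doubleK.
  by apply/eqP/eqP => [[]|->].
have mk l' b : l' < n -> [/\ mkv 0 l'.*2 (icode (0 < n) (Some b)) < nvars,
   vt (mkv 0 l'.*2 (icode (0 < n) (Some b))) = 0, vj (mkv 0 l'.*2 (icode (0 < n) (Some b))) = l'.*2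
   & va (mkv 0 l'.*2 (icode (0 < n) (Some b))) = icode (0 < n) (Some b)].
  move=> ln'; have [|||? ? ? ? _] := @mkvE 0 l'.*2 (icode (0 < n) (Some b)) => //.
  - by lia.
  exact: enc_lt.
rewrite negb_and negbK => /orP [/allPn [l' ]|/eqP E].
  rewrite mem_iota /= => ll ne; have ln' : l' < n by lia.
  have [m1 m2 m3 m4] := mk l' (X i' l') ln'.
  exists (mkv 0 l'.*2 (icode (0 < n) (Some (X i' l')))); split=> //.
    rewrite add0n in ll; have l1 : l'.*2 <= l.*2 by lia.
    have l2 : (l'.*2 == l.*2) = false by lia.
    by rewrite /in_trie m2 m3 m4 ev l1 l2 /= divn2 doubleK; case: (X i' l').
  by rewrite al_l // eq_sym.
have [m1 m2 m3 m4] := mk l (~~ X i' l) ln.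
exists (mkv 0 l.*2 (icode (0 < n) (Some (~~ X i' l)))); split=> //.
  by rewrite /in_trie m2 m3 m4 ev leqnn /= !eqxx; case: (X i' l) => /=; rewrite ?eqxx.
by rewrite al_l // E; case: (X i' l).
Qed.
End Run.

Lemma sat_run al : n.*2 + Q <= T -> 0 < t -> sat al ->
  exists i y, [/\ i < t, size y <= Q & acc i y].
Proof.
move=> nQT t0 [S1 S2 S3]; set h := 0 < n.
pose A tau j := find (fun a => al (mkv tau j a)) (iota 0 nD).
have alA tau j : tau <= T -> j <= T -> A tau j < nD /\ al (mkv tau j (A tau j)).
  move=> lt lj; have [a la ala] := S1 _ _ lt lj.
  have hs : has (fun a => al (mkv tau j a)) (iota 0 nD) by apply/has_iotaP; exists a.
  have lA : A tau j < nD by have := hs; rewrite has_find size_iota.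
  by split=> //; have := nth_find 0 hs; rewrite nth_iota.
pose v tau j := mkv tau j (A tau j).
have vE tau j : tau <= T -> j <= T ->
    [/\ v tau j < nvars, vt (v tau j) = tau, vj (v tau j) = j & va (v tau j) = A tau j].
  by move=> lt lj; have [lA _] := alA _ _ lt lj; have [] := mkvE lt lj lA.
have nf tau1 j1 tau2 j2 tau3 j3 tau4 j4 tau5 j5 : tau1 <= T -> j1 <= T -> tau2 <= T -> j2 <= T ->
  tau3 <= T -> j3 <= T -> tau4 <= T -> j4 <= T -> tau5 <= T -> j5 <= T ->
  forbidden (v tau1 j1) (v tau2 j2) (v tau3 j3) (v tau4 j4) (v tau5 j5) = false.
  have vlt a b : a <= T -> b <= T -> v a b < nvars by move=> la lb; have [] := vE a b la lb.
  have va' a b : a <= T -> b <= T -> al (v a b) by move=> la lb; have [] := alA a b la lb.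
  move=> a1 b1 a2 b2 a3 b3 a4 b4 a5 b5; apply/negP.
  move=> /(S2 _ _ _ _ _ (vlt _ _ a1 b1) (vlt _ _ a2 b2) (vlt _ _ a3 b3) (vlt _ _ a4 b4)
    (vlt _ _ a5 b5)).
  by rewrite !va'.
have row0 j : j <= T -> allowed j (A 0 j).
  move=> lj; have := nf 0 j 0 j 0 j 0 j 0 j; rewrite !leq0n !lj.
  do 10!move=> /(_ isT); rewrite /forbidden; have [_ -> -> ->] := vE 0 j (leq0n T) lj.
  by rewrite eqxx => /negbT; rewrite !negb_or => /and4P [_ /negbNE].
pose o j := if A 0 j == icode h None then None else Some (A 0 j == icode h (Some true)).
have ci := @icode_inj h.
have oE j : j <= T -> A 0 j = icode h (o j) /\
  (if j < n.*2 then o j = Some (if odd j then j.+1 < n.*2 else o j == Some true)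
   else n.*2 + Q <= j -> o j = None).
  move=> lj; have := row0 j lj; rewrite /allowed -/h /o; case: ifP => jn.
    case: ifP => oj.
      by move/eqP => ->; rewrite !(inj_eq ci) /=; case: (j.+1 < n.*2).
    by case/orP => /eqP ->; rewrite !(inj_eq ci).
  case/orP => [/eqP ->|/andP [jQ /orP [] /eqP ->]]; rewrite !(inj_eq ci) ?eqxx //=;
    split=> // ?; lia.
(* Walk down the trie with an input that agrees with row 0 so far. When row 0 deviates from it, the
   deviation is no dead end, so another input takes over. *)
have trie l : l <= n -> exists2 i, i < t & forall l', l' < l -> o l'.*2 = Some (X i l').
  elim: l => [|l IH] ln; first by exists 0.
  have [i it Hi] := IH (ltnW ln).
  have lT : l.*2 <= T by lia.
  have [EA] := oE _ lT; rewrite ifT; last lia.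
  rewrite odd_double => Eo.
  case: (eqVneq (o l.*2 == Some true) (X i l)) => [E|ne].
    by exists i => // l'; rewrite ltnS leq_eqVlt => /orP [/eqP ->|/Hi] //; rewrite Eo E.
  have : ~~ dead_end i l.
    apply/negP => /(S3 i l it ln) [u [um /and4P [/eqP u0 uodd ul /eqP ua] /negP[]]].
    have [_ lju _ Eu] := mkv_surj um.
    rewrite Eu u0; have : A 0 (vj u) = va u.
      have [-> _] := oE _ lju; rewrite ua.
      have Ej : vj u = (vj u)./2.*2.
        by have := odd_double_half (vj u); rewrite (negbTE uodd) add0n.
      case: eqP => [E|nl].
        rewrite E Eo; move: ne; case: (X i l); case: (o _ == _) => //.
      rewrite {1}Ej Hi; last lia.
      by rewrite divn2; case: (X i _).
    by move=> <-; apply: (alA _ _ _ lju).2.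
  rewrite /dead_end negbK => /has_iotaP [i' it' /andP [/all_iotaP ag nl]].
  exists i' => // l'; rewrite ltnS leq_eqVlt => /orP [/eqP ->|ll].
    by rewrite Eo; congr Some; move: ne nl; case: (X i l); case: (X i' l); case: (o _ == _).
  by rewrite Hi //; move/eqP: (ag _ ll) => ->.
have [i it Hi] := trie n (leqnn n).
(* The certificate ends at the first blank; the ban on letters after a blank keeps the rest of row 0
   blank. *)
pose r := find (fun k => o (n.*2 + k) == None) (iota 0 Q).
have rQ : r <= Q by rewrite /r -[X in _ <= X](size_iota 0 Q) find_size.
pose y := mkseq (fun k => o (n.*2 + k) == Some true) r.
have sy : size y = r by rewrite size_mkseq.
have oy k : n.*2 + k <= T -> o (n.*2 + k) = onth y k.
  rewrite onthE sy; case: ltnP => kr kT.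
    rewrite nth_mkseq //; have := before_find 0 kr; rewrite nth_iota ?add0n; last lia.
    by case: (o _) => [[]|].
  elim: k kr kT => [|k IH] kr kT.
    case: (ltnP 0 Q) => Q0; last by have [_] := oE _ kT; rewrite ifF; [apply; lia|lia].
    have hs : has (fun k => o (n.*2 + k) == None) (iota 0 Q) by rewrite has_find size_iota -/r; lia.
    have := nth_find 0 hs; rewrite -/r nth_iota ?add0n; last lia.
    have r0 : r = 0 by lia.
    by rewrite r0 => /eqP.
  case: (ltnP k r) => kr'.
    have Er : r = k.+1 by lia.
    case: (ltnP k.+1 Q) => kQ; last by have [_] := oE _ kT; rewrite ifF; [apply; lia|lia].
    have hs : has (fun k => o (n.*2 + k) == None) (iota 0 Q) by rewrite has_find size_iota -/r; lia.
    by have := nth_find 0 hs; rewrite -/r nth_iota ?add0n -?Er; [move/eqP|lia].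
  have kT' : n.*2 + k <= T by lia.
  have {}IH := IH kr' kT'.
  have := nf 0 (n.*2 + k) 0 (n.*2 + k.+1) 0 0 0 0 0 0; rewrite !leq0n kT kT'.
  do 10!move=> /(_ isT); rewrite /forbidden.
  have [_ -> -> ->] := vE 0 _ (leq0n T) kT'; have [_ -> -> ->] := vE 0 _ (leq0n T) kT.
  move/negbT; rewrite !negb_or => /and4P [_ _ + _].
  rewrite addnS !eqxx leq_addr /= (oE _ kT').1 IH eqxx /= negbK.
  by rewrite -addnS (oE _ kT).1 (inj_eq ci) => /eqP.
exists i, y; split=> //; first by rewrite sy.
pose w := pair_code (mkseq (X i) n) y; pose conf tau := iter tau (@step M) (init M w).
have A0 j : j <= T -> A 0 j = enc (col (init M w) j).
  move=> lj; rewrite enc_init -/h; have [-> +] := oE _ lj; rewrite letterE.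
  case: ifP => jn; last by rewrite -oy; rewrite subnKC //; lia.
  case: ifP => oj -> //; congr (icode _ _).
  have Ej : j = j./2.*2 by have := odd_double_half j; rewrite oj.
  by rewrite {1}Ej Hi ?divn2; [case: (X i _)|lia].
(* Each step loses one column at the right border, so the tableau is faithful on a triangle, whose
   corner at time [T] and column 0 is the accepting cell. *)
have At tau j : tau + j <= T -> A tau j = enc (col (conf tau) j).
  elim: tau j => [|tau IH] j lt; first exact: A0.
  have [l1 l2 l3 l4] : [/\ tau <= T, tau.+1 <= T, j <= T & j.+1 <= T] by split; lia.
  have l5 : j.-1 <= T by lia.
  have := nf tau 0 tau j.-1 tau j tau j.+1 tau.+1 j.
  rewrite !leq0n l1 l2 l3 l4 l5; do 10!move=> /(_ isT); rewrite /forbidden.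
  have [_ -> -> ->] := vE tau 0 l1 (leq0n T); have [_ -> -> ->] := vE tau _ l1 l5.
  have [_ -> -> ->] := vE tau _ l1 l3; have [_ -> -> ->] := vE tau _ l1 l4.
  have [_ -> -> ->] := vE tau.+1 _ l2 l3.
  rewrite !eqxx /= => /negbT; rewrite negb_or negbK => /andP [+ _].
  have -> a1 a2 a3 a4 a5 : (if j == 0 then ok_step true a1 a2 a3 a4 a5 else
    ok_step false a1 a2 a3 a4 a5) = ok_step (j == 0) a1 a2 a3 a4 a5 by case: eqP.
  case/and5P => _ _ _ _ /eqP ->; rewrite !IH; try lia.
  by rewrite !encK -col_step.
have := nf T 0 T 0 T 0 T 0 T 0; rewrite !leqnn !leq0n; do 10!move=> /(_ isT).
rewrite /forbidden; have [_ -> -> ->] := vE T 0 (leqnn T) (leq0n T).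
rewrite At ?addn0 // => /negbT; rewrite !negb_or !eqxx => /and4P [_ _ _ /negbNE].
by move/acceptsE.
Qed.

Theorem splits_accepts (f : seq bool -> bool) (pt : seq bool -> nat) :
  (forall x, computes_in M x [:: f x] (pt x)) ->
  (forall i y, size y <= Q -> pt (pair_code (mkseq (X i) n) y) <= T) ->
  n.*2 + Q <= T -> 0 < t ->
  (exists al, splits nvars nclauses incl al) <->
  exists i y, [/\ i < t, size y <= Q & f (pair_code (mkseq (X i) n) y)].
Proof.
move=> Hf HT nQT t0; rewrite splits_sat.
have accE i y : size y <= Q -> acc i y <-> f (pair_code (mkseq (X i) n) y).
  move=> yQ; rewrite /acc; set w := pair_code _ _; have [hlt out] := Hf w.
  rewrite (iter_halted hlt (HT i y yQ)); move: out; rewrite /output /=.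
  case: (thead _) => [[b|]|] //= [-> _]; split=> [[_ [->]]|->] //.
split=> [[al /(sat_run nQT t0) [i [y [it yQ /accE Ha]]]]|[i [y [it yQ /accE Ha]]]].
  by exists i, y; split=> //; apply: Ha.
exact: run_sat nQT it yQ (Ha yQ).
Qed.

End Clauses.
End Columns.

(** * Definability of the clauses *)

Section Definability.
Variables (M : machine) (n t Q T : inp -> nat) (X : inp -> nat -> nat -> bool).
Hypothesis Hn : def (fun w e => n w).
Hypothesis Ht : def (fun w e => t w).
Hypothesis HQ : def (fun w e => Q w).
Hypothesis HT : def (fun w e => T w).
Hypothesis HX : forall f g, def f -> def g -> defb (fun w e => X w (f w e) (g w e)).

(** A fixed machine has finitely many columns, so four nested tables turn the right-hand side of the
    step rule into constants. *)
Lemma def_ok_step j0 f1 f2 f3 f4 f5 : def f1 -> def f2 -> def f3 -> def f4 -> def f5 ->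
  defb (fun w e => ok_step M j0 (f1 w e) (f2 w e) (f3 w e) (f4 w e) (f5 w e)).
Proof.
move=> H1 H2 H3 H4 H5; rewrite /ok_step.
apply: (defb_fin (F := fun g w e => [&& f2 w e < nD M, f3 w e < nD M, f4 w e < nD M &
  f5 w e == enc (next j0 (dec M g) (dec M (f2 w e)) (dec M (f3 w e)) (dec M (f4 w e)))])) => // g _.
apply: (defb_fin (F := fun a w e => [&& f3 w e < nD M, f4 w e < nD M &
  f5 w e == enc (next j0 (dec M g) (dec M a) (dec M (f3 w e)) (dec M (f4 w e)))])) => // a _.
apply: (defb_fin (F := fun b w e => (f4 w e < nD M) &&
  (f5 w e == enc (next j0 (dec M g) (dec M a) (dec M b) (dec M (f4 w e)))))) => // b _.
apply: (defb_fin (F := fun c w e =>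
  f5 w e == enc (next j0 (dec M g) (dec M a) (dec M b) (dec M c)))) => // c _.
exact: defb_eq (def_cst _).
Qed.

Lemma def_accepts f : def f -> defb (fun w e => accepts M (f w e)).
Proof.
move=> Hf; apply: (defb_fin (F := fun a w e => halted (dec M a).1 &&
  (((dec M a).2 ord0).1.1 == Some (inl true)))) => // a _; exact: defb_cst.
Qed.

Lemma def_icode o : def (fun w e => icode M (0 < n w) o).
Proof.
have H0 : defb (fun w e => 0 < n w) by dsolve.
apply: def_ext (def_if H0 (def_cst (icode M true o)) (def_cst (icode M false o))) => w e.
by case: (0 < n w).
Qed.

Lemma def_icodeb f : defb f -> def (fun w e => icode M (0 < n w) (Some (f w e))).
Proof.
move=> Hf; apply: def_ext (def_if Hf (def_icode (Some true)) (def_icode (Some false))) => w e.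
by case: (f w e).
Qed.

Lemma def_nvars : def (fun w e => nvars M (T w)).
Proof. by rewrite /nvars; dsolve. Qed.

Lemma def_nclauses : def (fun w e => nclauses M (n w) (t w) (T w)).
Proof. by have := def_nvars => Hv; rewrite /nclauses /nforb; dsolve. Qed.

Lemma def_incl f g : def f -> def g ->
  defb (fun w e => incl M (n w) (t w) (Q w) (T w) (X w) (f w e) (g w e)).
Proof.
move=> Hf Hg; have Hv := def_nvars.
have Hvt h : def h -> def (fun w e => vt M (T w) (h w e)) by move=> Hh; rewrite /vt; dsolve.
have Hvj h : def h -> def (fun w e => vj M (T w) (h w e)) by move=> Hh; rewrite /vj; dsolve.
have Hva h : def h -> def (fun w e => va M (h w e)) by move=> Hh; rewrite /va; dsolve.
have Hi := def_icode; have Hib := def_icodeb; have Hacc := def_accepts.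
have Hok := def_ok_step.
have Hal h h' : def h -> def h' -> defb (fun w e => allowed M (n w) (Q w) (h w e) (h' w e)).
  by move=> Hh Hh'; rewrite /allowed; dsolve.
have HF f1 f2 f3 f4 f5 : def f1 -> def f2 -> def f3 -> def f4 -> def f5 ->
  defb (fun w e => forbidden M (n w) (Q w) (T w) (f1 w e) (f2 w e) (f3 w e) (f4 w e) (f5 w e)).
  by move=> H1 H2 H3 H4 H5; rewrite /forbidden; dsolve.
have HD h h' : def h -> def h' -> defb (fun w e => dead_end (t w) (X w) (h w e) (h' w e)).
  by move=> Hh Hh'; rewrite /dead_end; dsolve.
have Htr h1 h2 h3 : def h1 -> def h2 -> def h3 ->
  defb (fun w e => in_trie M (n w) (T w) (X w) (h1 w e) (h2 w e) (h3 w e)).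
  by move=> Hh1 Hh2 Hh3; rewrite /in_trie; dsolve.
have HN : def (fun w e => nforb M (T w)) by rewrite /nforb; dsolve.
by rewrite /incl; cbv zeta; dsolve.
Qed.
End Definability.

Lemma sdef_sg (m C : inp -> nat) (mem : inp -> nat -> nat -> bool) :
  def (fun w e => m w) -> def (fun w e => C w) ->
  (forall f g, def f -> def g -> defb (fun w e => mem w (f w e) (g w e))) ->
  sdef (fun w => instance_code (sg_graph (m w) (C w) (mem w), m w)).
Proof.
move=> Hm HC Hmem.
have HN : def (fun w e => sg_size (m w) (C w)) by rewrite /sg_size; dsolve.
have E w : nseq (sg_size (m w) (C w)) true ++ (nseq 1 false ++
   (mkseq (fun i => oadj (sg_rel (m w) (C w) (mem w)) (i %/ sg_size (m w) (C w))
     (i %% sg_size (m w) (C w))) (sg_size (m w) (C w) * sg_size (m w) (C w)) ++ bin_code (m w))) =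
   instance_code (sg_graph (m w) (C w) (mem w), m w) by rewrite ograph_code.
apply: sdef_ext E _; apply: sdef_cat; first exact: sdef_nseq.
apply: sdef_cat; first exact: (sdef_nseq _ (n := fun=> 1) (def_cst 1)).
apply: sdef_cat; last exact: sdef_bin.
apply: (sdef_mk (n := fun w => sg_size (m w) (C w) * sg_size (m w) (C w))
  (b := fun w i => oadj (sg_rel (m w) (C w) (mem w)) (i %/ sg_size (m w) (C w))
     (i %% sg_size (m w) (C w)))); first exact: def_mul.
by rewrite /oadj /sg_rel; dsolve.
Qed.

(** * NP-hardness with OR-composition *)

Lemma def_horner (p : {poly nat}) f : def f -> def (fun w e => p.[f w e]%R).
Proof.
move=> Hf; elim/poly_ind: p => [|p c IH].
  by apply: def_ext (def_cst 0) => w e; rewrite horner0.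
by apply: def_ext (def_add (def_mul IH Hf) (def_cst c)) => w e; rewrite hornerMXaddC.
Qed.

(* The parameter [k] of the composed instance depends on the length [n] of the
   inputs but not on their number [t]. *)
Record composition (H : graph_class) (L : language)
    (red : nat -> nat -> (nat -> nat -> bool) -> instance) (k : nat -> nat) : Prop := Composition {
  comp_correct : forall n t X, 0 < t ->
    Identification H (red n t X) <-> exists2 i, i < t & L (mkseq (X i) n);
  comp_param : forall n t X, (red n t X).2 = k n;
  comp_kdef : forall f, def f -> def (fun w e => k (f w e));
  comp_sdef : forall (n t : inp -> nat) (X : inp -> nat -> nat -> bool),
    def (fun w e => n w) -> def (fun w e => t w) ->
    (forall f g, def f -> def g -> defb (fun w e => X w (f w e) (g w e))) ->
    sdef (fun w => instance_code (red (n w) (t w) (X w)))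
}.

Lemma NP_composition H L : tame H -> in_NP L -> exists red k, composition H L red k.
Proof.
move=> tH [V [p [[f [[M [pM HM]] HV]] HL]]].
have [c Hc] := polyb_poly pM.
(* The first summand of [T] bounds the running time on all pairs of admissible size, the second
   makes row 0 wide enough for the whole pair code. *)
pose Q n := p.[n]%R; pose T n := pb c (n.*2.+1 + Q n) + (n.*2 + Q n).
have defQ g : def g -> def (fun w e => Q (g w e)) by apply: def_horner.
have defT g : def g -> def (fun w e => T (g w e)).
  move=> Hg; rewrite /T.
  apply: def_add; last first.
    by apply: def_add; [dsolve|exact: defQ].
  by apply: def_pb; apply: def_add; [dsolve|exact: defQ].
exists (fun n t X => (sg_graph (nvars M (T n)) (nclauses M n t (T n))
   (incl M n t (Q n) (T n) X), nvars M (T n))), (fun n => nvars M (T n)).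
split=> //.
- move=> n t X t0; rewrite (splitting_identification _ _ _ tH).
  rewrite (splits_accepts (f := f) (pt := fun x => pM.[size x]%R)) //; last first.
  + by rewrite /T; lia.
  + move=> i y yQ; apply: leq_trans (Hc _) _; rewrite size_pair_code size_mkseq /T.
    by apply: leq_trans (leq_addr _ _); apply: pb_mono => //; lia.
  split=> [[i [y [it yQ fy]]]|[i it /HL [y [yQ /HV fy]]]].
    exists i => //; apply/HL; exists y; rewrite size_mkseq; split=> //; exact/HV.
  by exists i, y; split=> //; move: yQ; rewrite size_mkseq.
- by move=> g /defT HT; rewrite /nvars; dsolve.
move=> n t X Hn Ht HX.
apply: (@sdef_sg (fun w => nvars M (T (n w))) (fun w => nclauses M (n w) (t w) (T (n w)))).
- by apply: def_nvars; apply: defT.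
- by apply: def_nclauses => //; apply: defT.
by move=> f1 g1 Hf1 Hg1; apply: def_incl => //; [apply: defQ|apply: defT].
Qed.

(** Hardness is the composition of a single input. *)
Lemma Identification_NP_hard H : tame H -> NP_hard (language_of (Identification H)).
Proof.
move=> tH L /(NP_composition tH) [red [k R]].
pose X (w : inp) (i l : nat) := nth false w.1 l.
exists (fun w => instance_code (red (size w) 1 (X (w, [::])))); split.
  apply: (sdef_polytime (s := fun w => instance_code (red (size w.1) 1 (X w)))) => //.
  by apply: (comp_sdef R (n := fun w => size w.1) (t := fun=> 1)); rewrite /X; dsolve.
move=> w; rewrite (language_of_code _ (tame_inv tH)) (comp_correct R) //.
have E i : mkseq (X (w, [::]) i) (size w) = w by apply: mkseq_nth.
by split=> [Lw|[i _]]; [exists 0 => //|]; rewrite E.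
Qed.

(** * No polynomial kernel *)

Section Covering.
Variables (A Z : finType) (t : nat) (F : {ffun 'I_t -> A} -> Z).
Hypothesis (t0 : 0 < t) (cardZ : #|Z| <= 2 ^ t).

Definition covered (B : {set A}) (z : Z) : {set A} :=
  [set x in B | [exists f : {ffun 'I_t -> A},
    [&& f \in ffun_on B, F f == z & [exists i, f i == x]]]].

(* A family [f] with values in [B] has all its entries in [covered B (F f)]. *)
Lemma covered_half (B : {set A}) : 0 < #|B| -> exists z, #|B| <= 2 * #|covered B z|.
Proof.
move=> B0; case: (boolP [exists z, #|B| <= 2 * #|covered B z|]) => [/existsP //|].
rewrite negb_exists => /forallP small; exfalso.
have E1 : #|B| ^ t = \sum_z #|[pred f : {ffun 'I_t -> A} | (f \in ffun_on B) && (F f == z)]|.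
  rewrite -{1}(card_ord t) -card_ffun_on -sum1_card (partition_big F predT) //=.
  by apply: eq_bigr => z _; rewrite sum1_card; apply: eq_card => f; rewrite !inE.
have E2 z : #|[pred f : {ffun 'I_t -> A} | (f \in ffun_on B) && (F f == z)]| <= #|covered B z| ^ t.
  have E := @card_ffun_on 'I_t A (mem (covered B z)); rewrite card_ord in E; rewrite -E.
  apply: subset_leq_card; apply/subsetP => f.
  rewrite inE => /andP [fB Ff]; apply/ffun_onP => i; rewrite inE (ffun_onP fB) /=.
  by apply/existsP; exists f; rewrite fB Ff; apply/existsP; exists i.
(* If every output covered less than half of [B], it would come from at most [c ^ t] families with
   [2 * c <= #|B|.-1], and [2 ^ t] outputs could not account for all [#|B| ^ t] families. *)
have : 2 ^ t * #|B| ^ t <= 2 ^ t * #|B|.-1 ^ t.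
  apply: leq_trans (_ : #|Z| * #|B|.-1 ^ t <= _); last by rewrite leq_mul2r cardZ orbT.
  rewrite E1 big_distrr /= -sum_nat_const; apply: leq_sum => z _.
  apply: leq_trans (_ : (2 * #|covered B z|) ^ t <= _); first by rewrite expnMn leq_mul.
  by rewrite leq_exp2r //; have := small z; lia.
by rewrite leq_pmul2l ?expn_gt0 // leq_exp2r //; lia.
Qed.

(** Each chosen output disposes of at least half of what is left, so [j] of them exhaust fewer than
    [2 ^ j] elements. Families over the remainder still have all their values in [B]. *)
Lemma cover_exists j (B : {set A}) : #|B| < 2 ^ j -> exists s : seq Z,
  [/\ size s <= j,
      forall z, z \in s -> exists2 f : {ffun 'I_t -> A}, (forall i, f i \in B) & F f = z
    & forall x, x \in B -> exists f : {ffun 'I_t -> A},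
        [/\ forall i, f i \in B, exists i, f i = x & F f \in s]].
Proof.
elim: j B => [|j IH] B Bj.
  exists [::]; split=> // x xB; move: Bj; rewrite expn0 ltnS leqn0 cards_eq0 => /eqP E.
  by rewrite E inE in xB.
case: (posnP #|B|) => [/eqP|B0].
  by rewrite cards_eq0 => /eqP E; exists [::]; split=> // x; rewrite E inE.
have [z hz] := covered_half B0.
pose B' := B :\: covered B z.
have sub : covered B z \subset B by apply/subsetP => x; rewrite inE => /andP [].
have cB' : #|B'| < 2 ^ j.
  rewrite /B' cardsDS // expnS in Bj *; have := subset_leq_card sub; lia.
have [s [ss s1 s2]] := IH _ cB'.
have sB x : x \in B' -> x \in B by rewrite inE => /andP [].
case: (set_0Vmem (covered B z)) => [E0|[x0 x0c]].
  by exfalso; move: hz; rewrite E0 cards0; lia.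
exists (z :: s); split=> //.
- move=> z'; rewrite inE => /orP [/eqP ->|/s1 [f fB <-]]; last first.
    by exists f => // i; apply: sB.
  move: x0c; rewrite inE => /andP [_ /existsP [f /and3P [/ffun_onP fB /eqP Ff _]]].
  by exists f.
move=> x xB; case: (boolP (x \in covered B z)) => [|xn].
  rewrite inE => /andP [_ /existsP [f /and3P [/ffun_onP fB /eqP Ff /existsP [i /eqP fi]]]].
  by exists f; split=> //; [exists i|rewrite Ff mem_head].
have [|f [fB fi Ff]] := s2 x; first by rewrite inE xn.
by exists f; split=> //; [move=> i; apply: sB|rewrite inE Ff orbT].
Qed.
End Covering.

(* The letters of [z], then a single 1, then 0s. *)
Definition padbit (z : seq bool) (l : nat) := if l < size z then nth false z l else l == size z.

Lemma padbit_inj t z z' : size z < t -> size z' < t ->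
  (forall l, l < t -> padbit z l = padbit z' l) -> z = z'.
Proof.
move=> zt zt' E.
have le a b : size a < size b -> size b < t -> padbit a (size b) = padbit b (size b) -> False.
  by move=> ab bt; rewrite /padbit ltnn eqxx ifF; lia.
case: (ltngtP (size z) (size z')) => [lt|lt|Es].
- by case: (le _ _ lt zt'); apply: E.
- by case: (le _ _ lt zt); apply/esym/E.
apply: (@eq_from_nth _ false) => // i iz.
by have := E i (ltn_trans iz zt); rewrite /padbit -Es iz.
Qed.

Lemma computes_in_le M x y t t' : t <= t' -> computes_in M x y t -> computes_in M x y t'.
Proof. by move=> tt [h o]; rewrite /computes_in (iter_halted h tt). Qed.

Lemma def_bound f : def f -> exists2 b, polyb b & forall w, f (w, [::]) [::] <= b (size w).
Proof.
case=> e He; exists (vb e); first exact: polyb_vb.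
by move=> w; rewrite -He; apply: eval_vb.
Qed.

Lemma sdef_bound s : sdef s -> exists2 b, polyb b & forall w, size (s (w, [::])) <= b (size w).
Proof.
case=> n [b [/def_bound [B HB Hn] _ Hs]]; exists B => // w.
by rewrite Hs size_mkseq; apply: Hn.
Qed.

(** * Advice from a kernel *)

Section Kernel.
Variables (H : graph_class) (L : language).
Hypothesis tH : tame H.
Variables (red : nat -> nat -> (nat -> nat -> bool) -> instance) (k : nat -> nat).
Hypothesis R : composition H (fun x => ~ L x) red k.
Variables (ker : instance -> instance) (p : {poly nat}) (M : machine) (pM : {poly nat}).
Hypothesis HM : forall a, computes_in M (instance_code a) (instance_code (ker a))
  pM.[size (instance_code a)]%R.
Hypothesis Hker : forall a, Identification H a <-> Identification H (ker a).
Hypothesis Hsize : forall a, size (instance_code (ker a)) <= p.[a.2]%R.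

Let t n := (p.[k n]%R : nat).+1.
Let out n X := instance_code (ker (red n (t n) X)).

Lemma out_lt n X : size (out n X) < t n.
Proof. by rewrite /t ltnS -(comp_param R n (t n) X); apply: Hsize. Qed.

(** Cut off outside the table, so that the table read back from a certificate is this very function
    and composes to the same instance. *)
Definition tuple_bits n (f : {ffun 'I_(t n) -> n.-tuple bool}) (i l : nat) :=
  [&& i < t n, l < n & if insub i is Some i' then nth false (f i') l else false].
Definition block n (f : {ffun 'I_(t n) -> n.-tuple bool}) : (t n).-tuple bool :=
  [tuple padbit (out n (tuple_bits f)) i | i < t n].

(** The covering is applied to the words of length [n] in [L]. They number at most [2 ^ n], strictly
    less than [2 ^ n.+1], whence [n.+1] strings; the kernel outputs, padded to exactly [t n] bits,
    take at most [2 ^ t n] values. *)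
Lemma advice_exists n : exists s : seq (seq bool), [/\ size s <= n.+1,
  forall b, b \in s -> exists2 X, (forall i, i < t n -> L (mkseq (X i) n)) &
    forall l, l < t n -> nth false b l = padbit (out n X) l
  & forall x, size x = n -> L x -> exists f : {ffun 'I_(t n) -> n.-tuple bool},
    (exists i, val (f i) = x) /\ exists2 b, b \in s &
    forall l, l < t n -> nth false b l = padbit (out n (tuple_bits f)) l].
Proof.
pose B := [set x : n.-tuple bool | if excluded_middle_informative (L x) then true else false].
have HP x : (x \in B) <-> L x by rewrite inE; case: excluded_middle_informative.
have cB : #|B| < 2 ^ n.+1.
  apply: leq_ltn_trans (max_card _) _; rewrite card_tuple card_bool ltn_exp2l //.
have cZ : #|{: (t n).-tuple bool}| <= 2 ^ t n by rewrite card_tuple card_bool.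
have [s [ss s1 s2]] := @cover_exists _ _ _ (@block n) (ltn0Sn _) cZ _ _ cB.
have nthb (f : {ffun 'I_(t n) -> n.-tuple bool}) l :
    l < t n -> nth false (block f) l = padbit (out n (tuple_bits f)) l.
  by move=> lt; rewrite -(tnth_nth false (block f) (Ordinal lt)) tnth_mktuple.
have seqE (f : {ffun 'I_(t n) -> n.-tuple bool}) i (lt : i < t n) :
   mkseq (tuple_bits f i) n = f (Ordinal lt).
  apply: (@eq_from_nth _ false) => [|l]; rewrite size_mkseq ?size_tuple // => ln.
  by rewrite nth_mkseq // /tuple_bits lt ln /= insubT.
exists [seq val b | b <- s]; split; first by rewrite size_map.
  move=> _ /mapP [b /s1 [f fB <-] ->]; exists (tuple_bits f); last by move=> l; apply: nthb.
  by move=> i lt; rewrite seqE; apply/HP.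
move=> x sx Lx; have [|f [fB [i fi] Fs]] := s2 (tcast sx (in_tuple x)).
  by apply/HP; rewrite val_tcast.
exists f; split; first by exists i; rewrite fi /= val_tcast.
by exists (val (block f)); [apply: map_f|move=> l; apply: nthb].
Qed.

Section Decide.
Variable W : seq bool.
Let w0 := plen (size W) (nth false W).
Definition kn := plen w0 (vw W).
Definition kx := pfst w0 (vw W).
Definition ka := psnd w0 (vw W).
Definition ktup i l := [&& i < t kn, l < kn & vy W (i * kn + l)].
(** The certificate is a tuple of words: the input must occur in it, and its kernel output [z] must
    be listed in the advice. *)
Definition decide (z : seq bool) :=
  has (fun i => all (fun l => ktup i l == kx l) (iota 0 kn)) (iota 0 (t kn)) &&
  has (fun r => all (fun l => ka (r * t kn + l) == padbit z l) (iota 0 (t kn))) (iota 0 kn.+1).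
End Decide.

(** One formula composes the tuple into an instance, the kernelization runs on it, and a second
    formula inspects the result. *)
Lemma decide_in_P : in_P (fun W => decide W (out (kn W) (ktup W))).
Proof.
exists (fun W => decide W (out (kn W) (ktup W))); split=> //.
have Ht f : def f -> def (fun w e => t (f w e)).
  by move=> Hf; rewrite /t; apply/def_succ/def_horner/(comp_kdef R).
pose n0 (w : inp) := plen (size w.1) (nth false w.1).
have Hn0 : def (fun w e => n0 w) by rewrite /n0 /plen; dsolve.
have Hw f : def f -> defb (fun w e => vw w.1 (f w e)) by move=> Hf; rewrite /vw /pfst; dsolve.
have Hy f : def f -> defb (fun w e => vy w.1 (f w e)) by move=> Hf; rewrite /vy /psnd; dsolve.
have Hn : def (fun w e => kn w.1) by rewrite /kn {1}/plen; dsolve.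
have Hx f : def f -> defb (fun w e => kx w.1 (f w e)) by move=> Hf; rewrite /kx /pfst; dsolve.
have Ha f : def f -> defb (fun w e => ka w.1 (f w e)) by move=> Hf; rewrite /ka /psnd; dsolve.
have Hk f g : def f -> def g -> defb (fun w e => ktup w.1 (f w e) (g w e)).
  by move=> Hf Hg; rewrite /ktup; dsolve.
have Hd : defb (fun w e => decide w.1 w.2) by rewrite /decide /padbit; dsolve.
have Htn : def (fun w e => t (kn w.1)) by dsolve.
have S1 := comp_sdef R (n := fun w => kn w.1) (t := fun w => t (kn w.1))
  (X := fun w => ktup w.1) Hn Htn Hk.
have S2 : sdef (fun w => mkseq (fun=> decide w.1 w.2) 1).
  exact: (sdef_mk (n := fun=> 1) (b := fun w _ => decide w.1 w.2) (def_cst 1) Hd).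
have [b1 Pb1 B1] := sdef_bound S1; have [b2 Pb2 B2] := def_bound Htn.
have [c Hc] := polyb_poly pM.
apply: (run_polytime (pt := fun s => pb c (b1 s)) (ps := b2) _ Pb2 S1 S2).
  by apply: polyb_comp Pb1; exists c.
move=> W /=; exists (out (kn W) (ktup W)); split=> //.
  apply: computes_in_le (HM _); apply: leq_trans (Hc _) _.
  by apply: pb_mono => //; apply: (B1 W).
by apply: leq_trans (ltnW (out_lt _ _)) _; apply: (B2 W).
Qed.

(** Every word of [L] occurs in a tuple with a listed output. Conversely, a listed output stems from
    a tuple inside [L], a no-instance of the OR over the complement; any tuple with the same output
    is then a no-instance as well, so all its entries, the input among them, lie in [L]. *)
Lemma kernel_NPpoly : in_NPpoly L.
Proof.
have [adv Hadv] : exists adv : nat -> seq (seq bool), forall n, [/\ size (adv n) <= n.+1,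
  forall b, b \in adv n -> exists2 X, (forall i, i < t n -> L (mkseq (X i) n)) &
    forall l, l < t n -> nth false b l = padbit (out n X) l
  & forall x, size x = n -> L x -> exists f : {ffun 'I_(t n) -> n.-tuple bool},
    (exists i, val (f i) = x) /\ exists2 b, b \in adv n &
    forall l, l < t n -> nth false b l = padbit (out n (tuple_bits f)) l].
  exists (fun n => sval (constructive_indefinite_description _ (advice_exists n))) => n.
  exact: (svalP (constructive_indefinite_description _ (advice_exists n))).
have [bt Pbt Bt] : exists2 b, polyb b & forall n, t n <= b n.
  have Hs : def (fun w e => t (size w.1)).
    by rewrite /t; apply/def_succ/def_horner/(comp_kdef R)/def_len1.
  have [b Pb Hb] := def_bound Hs; exists b => // n.
  by have := Hb (nseq n true); rewrite /= size_nseq.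
have [c1 H1] : polyb (fun n => n.+1 * bt n).
  apply: polyb_mul => //; apply: polyb_le (polyb_add polyb_id (polyb_cst 1)) => n; lia.
pose advice n := mkseq (fun i => nth false (nth [::] (adv n) (i %/ t n)) (i %% t n)) (n.+1 * t n).
exists (fun w => exists y, size y <= pb c1 (size w) /\
  decide (pair_code w y) (out (kn (pair_code w y)) (ktup (pair_code w y)))), advice, (pb_poly c1).
split.
- exists (fun W => decide W (out (kn W) (ktup W))), (pb_poly c1); split; first exact: decide_in_P.
  by move=> w; rewrite pb_polyE.
- move=> n; rewrite pb_polyE size_mkseq; apply: leq_trans (H1 n).
  by rewrite leq_mul2l Bt orbT.
move=> x; set n := size x; set w := pair_code x (advice n).
have [_ A1 A2] := Hadv n.
have t0 : 0 < t n by [].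
have wE y : plen (size (pair_code w y)) (nth false (pair_code w y)) = size w.
  by apply: (@plenE _ _ w y).
have vwE y i : i < size w -> vw (pair_code w y) i = nth false w i.
  by move=> iw; apply: (@pfstE _ _ w y).
have nE y : kn (pair_code w y) = n.
  by rewrite /kn wE; apply: (@plenE _ _ x (advice n)) => // i; apply: vwE.
have xE y i : kx (pair_code w y) i = nth false x i.
  by rewrite /kx wE; apply: (@pfstE _ _ x (advice n)) => // j; apply: vwE.
have aE y i : i < n.+1 * t n -> ka (pair_code w y) i =
    nth false (nth [::] (adv n) (i %/ t n)) (i %% t n).
  move=> ilt; rewrite /ka wE (@psndE _ _ x (advice n)) //; [|by move=> j; apply: vwE|].
    by rewrite nth_mkseq.
  by rewrite size_mkseq.
have aE2 y r l : r < n.+1 -> l < t n -> ka (pair_code w y) (r * t n + l) =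
    nth false (nth [::] (adv n) r) l.
  move=> rn lt; rewrite aE; last by nia.
  by rewrite divnMDl // divn_small // modnMDl modn_small // addn0.
split.
  move=> Lx; have [f [[i fi] [b bs Hb]]] := A2 x erefl Lx.
  pose y := mkseq (fun j => tuple_bits f (j %/ n) (j %% n)) (t n * n).
  have kE : ktup (pair_code w y) = tuple_bits f.
    apply: functional_extensionality => i'; apply: functional_extensionality => l.
    rewrite /ktup nE [RHS]/tuple_bits.
    case: (ltnP i' (t n)) => it //; case: (ltnP l n) => ln //.
    have lt : i' * n + l < t n * n by nia.
    have n0 : 0 < n by lia.
    rewrite /= /vy (@psndE _ _ w y) ?size_mkseq // nth_mkseq //.
    by rewrite divnMDl // divn_small // modnMDl modn_small // addn0 /tuple_bits it ln.
  exists y; split.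
    rewrite size_mkseq; apply: leq_trans (_ : n.+1 * t n <= _); first by rewrite mulnC leq_mul.
    apply: leq_trans (_ : pb c1 n <= _); last by apply: pb_mono => //; rewrite size_pair_code; lia.
    by apply: leq_trans (H1 n); rewrite leq_mul2l Bt orbT.
  rewrite nE kE /decide nE kE; apply/andP; split; apply/has_iotaP.
    exists i => //; apply/all_iotaP => l ln; rewrite xE -fi /tuple_bits ltn_ord ln /=.
    by rewrite (_ : insub _ = Some i) //; apply: valK.
  exists (index b (adv n)).
    by apply: leq_trans (_ : size (adv n) <= _); [rewrite index_mem|case: (Hadv n)].
  apply/all_iotaP => l lt; rewrite aE2 // ?nth_index ?Hb //.
  by apply: leq_trans (_ : size (adv n) <= _); [rewrite index_mem|case: (Hadv n)].
move=> [y [_]]; rewrite nE /decide nE => /andP [/has_iotaP [i it /all_iotaP Hi]].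
move=> /has_iotaP [r rn /all_iotaP Hr].
set X := ktup (pair_code w y) in Hi Hr *.
have Hr' l : l < t n -> nth false (nth [::] (adv n) r) l = padbit (out n X) l.
  by move=> lt; have /eqP := Hr l lt; rewrite aE2.
have xX : x = mkseq (X i) n.
  apply: (@eq_from_nth _ false) => [|l ln]; first by rewrite size_mkseq.
  by rewrite nth_mkseq //; have /eqP := Hi l ln; rewrite xE => ->.
(* An index past the list reads only zeros, whereas a padded output has a 1 right after its last
   letter. *)
case: (ltnP r (size (adv n))) => rs; last first.
  have := Hr' (size (out n X)) (out_lt n X).
  by rewrite (nth_default _ rs) nth_nil /padbit ltnn eqxx.
have [X' LX' HX'] := A1 _ (mem_nth [::] rs).
have Eo : out n X = out n X'.
  by apply: (@padbit_inj (t n)); rewrite ?out_lt // => l lt; rewrite -Hr' // HX'.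
have := Identification_code (tame_inv tH) Eo; rewrite -!Hker !(comp_correct R) // => E.
apply: NNPP => nL; case: E => E _; case: E; first by exists i => //; rewrite -xX.
by move=> i' it'; apply; apply: LX'.
Qed.
End Kernel.

Theorem no_kernel H : tame H -> ~ coNP_sub_NPpoly -> ~ has_polynomial_kernel (Identification H).
Proof.
move=> tH ncoNP [ker [p [[M [pM HM]] Hk Hs]]]; apply: ncoNP => L /(NP_composition tH) [red [k R]].
exact: (kernel_NPpoly tH R HM Hk Hs).
Qed.

Theorem theorem5p1 (R : realType) (H : graph_class)
    (hH : H = split_graph \/ H = interval_graph R \/ H = chordal_graph) :
  NP_complete (language_of (Identification H)) /\
  (~ coNP_sub_NPpoly -> ~ has_polynomial_kernel (Identification H)).
Proof.
have [tH NH] : tame H /\ in_NP (language_of (Identification H)).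
  case: hH => [->|[->|->]]; split.
  - exact: tame_split.
  - exact: split_in_NP.
  - exact: tame_interval.
  - exact: interval_in_NP.
  - exact: tame_chordal.
  exact: chordal_in_NP.
by split; [split=> //; apply: Identification_NP_hard|apply: no_kernel].
Qed.
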